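(* For $n=3$ the algebra $\mathcal{A}$ of differential invariants of the $\mathcal{G}$-action on $\mathcal{E}$ (general Kundt metrics) is generated by the differential invariants $$I_1=\frac{W_v^2}{h},\qquad J_1=\frac{HW_{vv}^2+(-H_{vv}W+H_{xv}-W_{uv})W_{vv}+H_{vv}^2h}{h},$$ $$J_2=\frac{4H_{vv}h^2+2(W_{xv}-WW_{vv})h-W_vh_x}{h^2}$$ and the invariant derivations $$\nabla_1=\frac{W_v}{W_{vv}}\mathcal{D}_v,\qquad \nabla_2=\frac{2}{W_v}\mathcal{D}_x+\frac{h_xW_v-2hW_{xv}}{hW_vW_{vv}}\mathcal{D}_v,$$ $$\nabla_3=\frac{1}{W_v}\left(H_{vv}\mathcal{D}_x-W_{vv}\mathcal{D}_u+(W_{uv}-H_{xv})\mathcal{D}_v\right).$$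
   Context: Three-dimensional Kundt metrics in adapted coordinates $(u,x,v)$ are $g=du\,(dv+H\,du+W\,dx)+h\,dx^2$ with $H,W$ functions of $(u,x,v)$ and $h=h(u,x)>0$. Let $\pi$ be the trivial bundle over $\mathbb{R}^3(u,x,v)$ with fiber coordinates $H,W,h$ ($h>0$). $\mathcal{E}^0=J^0\pi$, and for $k\ge1$ $\mathcal{E}^k\subset J^k\pi$ is given by $h_v=0$ and its total derivatives of order $\le k$; $\mathcal{E}^\infty$ is the infinite prolongation. $\mathcal{G}$ is the Lie pseudogroup of local diffeomorphisms $(u,x,v)\mapsto(C(u),A(u,x),v/C'(u)+B(u,x))$ with $A_x\neq0$, $C'\ne0$; it acts on Kundt metrics of the form $g=du\,(dv+H\,du+W\,dx)+h\,dx^2$, hence on $J^0\pi$ (so that $g$, viewed as a horizontal symmetric 2-form on $\pi$, is invariant), and the action prolongs to jets preserving $\mathcal{E}^k$. Subscripts denote jet variables; $\mathcal{D}_u,\mathcal{D}_x,\mathcal{D}_v$ are the total derivatives. A differential invariant of order $\le k$ is a function on $\mathcal{E}^k$ constant on $\mathcal{G}$-orbits, which is rational in the jet variables (and polynomial in jet variables of sufficiently high order); $\mathcal{A}$ is the union over $k$ of the spaces of these. An invariant derivation is a horizontal vector field (combination of total derivatives with coefficients functions on some $\mathcal{E}^r$) invariant under $\mathcal{G}$. ''$\mathcal{A}$ is generated by invariants $I_a$ and invariant derivations $\nabla_b$'' is meant in the Lie–Tresse sense: $\mathcal{A}$ is generated by the $I_a$ and all their iterated derivatives $\nabla_{b_1}\cdots\nabla_{b_t}I_a$,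 so that generic $\mathcal{G}$-orbits in $\mathcal{E}^\infty$ are separated by these functions. *)

(* Defs.v *)
From Stdlib Require Import Reals List.
From Coquelicot Require Import Coquelicot.
Open Scope R_scope.

(** * Calculus on R^3(u,x,v) *)

(* Points (u,x,v); also used for the components (xi^u, xi^x, xi^v) of tangent
   vectors. *)
Definition point : Type := (R * R * R)%type.

Definition pu (p : point) : R := fst (fst p).
Definition px (p : point) : R := snd (fst p).
Definition pv (p : point) : R := snd p.

Definition pd_u (f : point -> R) (p : point) : R :=
  Derive (fun t => f (t, px p, pv p)) (pu p).
Definition pd_x (f : point -> R) (p : point) : R :=
  Derive (fun t => f (pu p, t, pv p)) (px p).
Definition pd_v (f : point -> R) (p : point) : R :=
  Derive (fun t => f (pu p, px p, t)) (pv p).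

Definition pd (i j k : nat) (f : point -> R) : point -> R :=
  Nat.iter i pd_u (Nat.iter j pd_x (Nat.iter k pd_v f)).

(* Class C^n on an open set U: for n > 0 the continuity of f itself follows from
   that of its partial derivatives. *)
Fixpoint Ck (n : nat) (U : point -> Prop) (f : point -> R) : Prop :=
  match n with
  | O => forall p, U p -> continuous f p
  | S m =>
      (forall p, U p ->
         ex_derive (fun t => f (t, px p, pv p)) (pu p) /\
         ex_derive (fun t => f (pu p, t, pv p)) (px p) /\
         ex_derive (fun t => f (pu p, px p, t)) (pv p)) /\
      Ck m U (pd_u f) /\ Ck m U (pd_x f) /\ Ck m U (pd_v f)
  end.

Definition smooth_on (U : point -> Prop) (f : point -> R) : Prop :=
  forall n, Ck n U f.

Definition differential (f : point -> R) (p xi : point) : R :=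
  pd_u f p * pu xi + pd_x f p * px xi + pd_v f p * pv xi.

Definition tangent_map (phi : point -> point) (p xi : point) : point :=
  (differential (fun q => pu (phi q)) p xi,
   differential (fun q => px (phi q)) p xi,
   differential (fun q => pv (phi q)) p xi).

(** * The bundle pi and the metrics *)

Record fields : Type := mkFields {
  fH : point -> R;
  fW : point -> R;
  fh : point -> R
}.

Definition local_section (U : point -> Prop) (s : fields) : Prop :=
  smooth_on U (fH s) /\ smooth_on U (fW s) /\ smooth_on U (fh s) /\
  forall p, U p -> 0 < fh s p.

(* The quadratic form du (dv + H du + W dx) + h dx^2 at p, evaluated at xi. *)
Definition metric (s : fields) (p xi : point) : R :=
  pu xi * (pv xi + fH s p * pu xi + fW s p * px xi) + fh s p * px xi ^ 2.

(** * Jets *)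

(* A point of J^infinity(pi).  [jH th i j k] is the value of the jet variable
   of H differentiated i times in u, j times in x and k times in v; likewise
   for W and h.  Functions on J^k(pi) and on E^k are identified with their
   pull-backs to the infinite jets. *)
Record jet : Type := mkJet {
  base : point;
  jH : nat -> nat -> nat -> R;
  jW : nat -> nat -> nat -> R;
  jh : nat -> nat -> nat -> R
}.

Definition jet_of (s : fields) (p : point) : jet :=
  mkJet p (fun i j k => pd i j k (fH s) p)
          (fun i j k => pd i j k (fW s) p)
          (fun i j k => pd i j k (fh s) p).

(* E^infinity: h_v = 0 together with all its total derivatives. *)
Definition in_E (th : jet) : Prop :=
  0 < jh th 0 0 0 /\ forall i j k, jh th i j (S k) = 0.

(* [th] displaced by t along xi^u D_u + xi^x D_x + xi^v D_v, the components of
   this vector field being frozen at [th]: D_u = d/du + sum H_(K+u) d/dH_K + ... *)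
Definition displace (xi : point) (th : jet) (t : R) : jet :=
  let along (f : nat -> nat -> nat -> R) i j k :=
    f i j k + t * (pu xi * f (S i) j k + px xi * f i (S j) k
                   + pv xi * f i j (S k)) in
  mkJet (pu (base th) + t * pu xi, px (base th) + t * px xi,
         pv (base th) + t * pv xi)
        (along (jH th)) (along (jW th)) (along (jh th)).

Definition D_u (F : jet -> R) (th : jet) : R :=
  Derive (fun t => F (displace (1, 0, 0) th t)) 0.
Definition D_x (F : jet -> R) (th : jet) : R :=
  Derive (fun t => F (displace (0, 1, 0) th t)) 0.
Definition D_v (F : jet -> R) (th : jet) : R :=
  Derive (fun t => F (displace (0, 0, 1) th t)) 0.

(* A horizontal vector field a D_u + b D_x + c D_v is given by (a, b, c). *)
Definition hfield : Type := jet -> point.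

Definition apply (X : hfield) (F : jet -> R) (th : jet) : R :=
  pu (X th) * D_u F th + px (X th) * D_x F th + pv (X th) * D_v F th.

(** * The pseudogroup and its prolonged action *)

Definition in_G (U : point -> Prop) (phi : point -> point) : Prop :=
  open U /\
  smooth_on U (fun p => pu (phi p)) /\
  smooth_on U (fun p => px (phi p)) /\
  smooth_on U (fun p => pv (phi p)) /\
  exists (c : R -> R) (a b : R -> R -> R),
    forall u x v, U (u, x, v) ->
      Derive c u <> 0 /\ Derive (a u) x <> 0 /\
      phi (u, x, v) = (c u, a u x, v / Derive c u + b u x).

(* The prolongation of phi maps th to th': they are the jets of sections s, s'
   whose metrics satisfy g_s = phi^* g_s'. *)
Definition prolonged (phi : point -> point) (th th' : jet) : Prop :=
  exists (U V : point -> Prop) (s s' : fields),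
    in_G U phi /\ U (base th) /\
    open V /\ (forall q, U q -> V (phi q)) /\
    local_section U s /\ local_section V s' /\
    (forall q xi, U q ->
       metric s q xi = metric s' (phi q) (tangent_map phi q xi)) /\
    th = jet_of s (base th) /\ th' = jet_of s' (phi (base th)).

Definition same_orbit (th th' : jet) : Prop :=
  exists phi, prolonged phi th th'.

(** * Rational functions on E *)

Inductive poly_in (S : (jet -> R) -> Prop) : (jet -> R) -> Prop :=
| poly_const c : poly_in S (fun _ => c)
| poly_gen F : S F -> poly_in S F
| poly_add F G : poly_in S F -> poly_in S G -> poly_in S (fun th => F th + G th)
| poly_mul F G : poly_in S F -> poly_in S G -> poly_in S (fun th => F th * G th).

Inductive coordinate (r : nat) : (jet -> R) -> Prop :=
| coord_u : coordinate r (fun th => pu (base th))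
| coord_x : coordinate r (fun th => px (base th))
| coord_v : coordinate r (fun th => pv (base th))
| coord_H i j k : (i + j + k <= r)%nat -> coordinate r (fun th => jH th i j k)
| coord_W i j k : (i + j + k <= r)%nat -> coordinate r (fun th => jW th i j k)
| coord_h i j k : (i + j + k <= r)%nat -> coordinate r (fun th => jh th i j k).

Definition jet_poly (r : nat) : (jet -> R) -> Prop := poly_in (coordinate r).

(* E is irreducible, so that {Q <> 0} is then Zariski open and dense in E. *)
Definition nonzero_on_E (Q : jet -> R) : Prop :=
  exists th, in_E th /\ Q th <> 0.

(** * Differential invariants *)

(* Invariants rational in the jet variables of order <= l and polynomial in
   those of order > l, considered where the denominator does not vanish; the
   values of F elsewhere (e.g. x / 0) are irrelevant. *)
Definition diff_invariant (l : nat) (F : jet -> R) : Prop :=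
  exists (r : nat) (P Q : jet -> R),
    jet_poly r P /\ jet_poly l Q /\ nonzero_on_E Q /\
    (forall th, in_E th -> Q th <> 0 -> F th = P th / Q th) /\
    (forall th th', in_E th -> in_E th' -> same_orbit th th' ->
       Q th <> 0 -> Q th' <> 0 -> F th = F th').

Definition in_A (F : jet -> R) : Prop := exists l, diff_invariant l F.

Definition invariant_derivation (X : hfield) : Prop :=
  exists (r : nat) (Pu Px Pv Q : jet -> R),
    jet_poly r Pu /\ jet_poly r Px /\ jet_poly r Pv /\
    jet_poly r Q /\ nonzero_on_E Q /\
    (forall th, in_E th -> Q th <> 0 ->
       X th = (Pu th / Q th, Px th / Q th, Pv th / Q th)) /\
    (forall phi th th', in_E th -> in_E th' -> prolonged phi th th' ->
       Q th <> 0 -> Q th' <> 0 -> tangent_map phi (base th) (X th) = X th').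

(** * Generation in the Lie-Tresse sense *)

Inductive iterated (Is : list (jet -> R)) (Ns : list hfield) :
  nat -> (jet -> R) -> Prop :=
| iterated_0 F : In F Is -> iterated Is Ns 0 F
| iterated_S n X F :
    In X Ns -> iterated Is Ns n F -> iterated Is Ns (S n) (apply X F).

(* The iterated derivatives are themselves invariants; every invariant is a
   rational function of them; and they separate generic orbits in E^infinity.
   As the invariants are polynomial in jets of order > l, so is their
   expression: denominators involve only derivatives of length at most N = N(l).
   Denominators cannot be dispensed with, since A contains the inverses of its
   low order elements. *)
Definition lie_tresse_generated (Is : list (jet -> R)) (Ns : list hfield) : Prop :=
  (forall n F, iterated Is Ns n F -> in_A F) /\
  (forall l, exists N, forall F, diff_invariant l F ->
     exists P Q : jet -> R,
       poly_in (fun G => exists n, iterated Is Ns n G) P /\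
       poly_in (fun G => exists n, (n <= N)%nat /\ iterated Is Ns n G) Q /\
       exists (r : nat) (q : jet -> R),
         jet_poly r q /\ nonzero_on_E q /\
         forall th, in_E th -> q th <> 0 -> Q th <> 0 /\ F th = P th / Q th) /\
  (exists (r : nat) (q : jet -> R),
     jet_poly r q /\ nonzero_on_E q /\
     forall th th', in_E th -> in_E th' -> q th <> 0 -> q th' <> 0 ->
       (forall n F, iterated Is Ns n F -> F th = F th') ->
       same_orbit th th').

(** * The generators *)

Definition var_H (th : jet) : R := jH th 0 0 0.
Definition var_W (th : jet) : R := jW th 0 0 0.
Definition var_h (th : jet) : R := jh th 0 0 0.
Definition h_x (th : jet) : R := jh th 0 1 0.
Definition W_v (th : jet) : R := jW th 0 0 1.
Definition W_vv (th : jet) : R := jW th 0 0 2.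
Definition W_xv (th : jet) : R := jW th 0 1 1.
Definition W_uv (th : jet) : R := jW th 1 0 1.
Definition H_vv (th : jet) : R := jH th 0 0 2.
Definition H_xv (th : jet) : R := jH th 0 1 1.

Definition I1 (th : jet) : R := W_v th ^ 2 / var_h th.

Definition J1 (th : jet) : R :=
  (var_H th * W_vv th ^ 2
   + (- H_vv th * var_W th + H_xv th - W_uv th) * W_vv th
   + H_vv th ^ 2 * var_h th) / var_h th.

Definition J2 (th : jet) : R :=
  (4 * H_vv th * var_h th ^ 2
   + 2 * (W_xv th - var_W th * W_vv th) * var_h th
   - W_v th * h_x th) / var_h th ^ 2.

Definition nabla1 : hfield := fun th => (0, 0, W_v th / W_vv th).

Definition nabla2 : hfield := fun th =>
  (0,
   2 / W_v th,
   (h_x th * W_v th - 2 * var_h th * W_xv th)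
     / (var_h th * W_v th * W_vv th)).

Definition nabla3 : hfield := fun th =>
  (1 / W_v th * - W_vv th,
   1 / W_v th * H_vv th,
   1 / W_v th * (W_uv th - H_xv th)).

(* Main.v *)
(** The metric is invariant, and its components in the frame nabla_1, nabla_2,
    nabla_3 are functions of I1, J1, J2; for instance
    g(nabla_2, nabla_2) = 4 / I1, g(nabla_3, nabla_3) = J1 / I1 and
    2 g(nabla_2, nabla_3) = J2 / I1.  The components of [nabla_1, nabla_3] and
    [nabla_2, nabla_3] in the frame are obtained by Cramer's rule from the action
    of these commutators on I1, J1, J2, so they are rational in the iterated
    derivatives.  The denominator is Delta = det (nabla_b J_a).

    Let Z consist of u, x, v, the restrictions of W, W_v to a surface v = const, of
    H, H_v, H_vv to a curve x, v = const (all their derivatives), and W_vv at the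
    point.  Reading I1, J1, J2, nabla_3 I1 and the commutators as equations for
    h, h_x, H_xv, W_vvv, H_vvv, W_xvv, H_xvv, W_uvv, H_x, one finds that the ring
    generated by Z, the iterated derivatives of the invariants and the inverses of
    W_v, W_vv, I1, Delta is closed under the total derivatives; hence it contains
    every jet coordinate.

    Conversely the pseudogroup acts transitively on the values of Z.  For
    (C(u), A(u,x), v / C'(u) + B(u,x)) the prescription of Z is a formal system of
    differential equations for C, A, B, solved as the fixed point of a contractive
    operator on Taylor coefficients and realised by smooth functions through
    Borel's lemma.  So two generic jets with equal invariants lie on one orbit, and
    an arbitrary invariant is computed by moving a jet to fixed values of Z, where
    its coordinates are rational in the iterated derivatives. *)

Require Import Defs.
From Stdlib Require Import Reals List Arith Lra Lia FunctionalExtensionality ClassicalEpsilon FinFun.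
From Coquelicot Require Import Coquelicot.
Import Defs.
Open Scope R_scope.

(** * Calculus on R^3 *)

(** Closure under the total derivatives hinges on the order u, x, v. Under D_u only W_vv leaves Z,
    and W_uvv comes from differentiating the J1 equation in v. Under D_x the new coordinate H_x
    enters the J1 equation together with H_xxv; the circle is broken by nabla_3 I1, which contains
    H_xv but not H, and whose h_u is available once D_u is settled. Under D_v the coordinates W_vv,
    H_vvv with further derivatives in u and x are then derivatives of known elements. In the
    equations for C, A, B, taking C' as a separate unknown lets each first derivative be given by
    undifferentiated unknowns, except that B_x involves A_u; there A is first recomputed from its
    own equations, which regains the lost order. The functions obtained satisfy the equations to
    infinite order at the point, not near it; jets see no difference. Orbits are defined through
    sections, invariants through rational functions on E; the link is that a total derivative, taken
    along a section with h_v = 0, is a partial derivative. *)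

Lemma Rmult_neq_0 (a b : R) : a <> 0 -> b <> 0 -> a * b <> 0.
Proof. exact (Rmult_integral_contrapositive_currified a b). Qed.

Tactic Notation "fext" ident(x) := apply functional_extensionality; intros x.

(** One index for the three coordinates, so that each fact about [pd_u], [pd_x], [pd_v] is stated
    and proved once. *)
Inductive dir : Type := Du | Dx | Dv.

Definition co (d : dir) (p : point) : R :=
  match d with Du => pu p | Dx => px p | Dv => pv p end.

Definition up (d : dir) (p : point) (t : R) : point :=
  match d with
  | Du => (t, px p, pv p) | Dx => (pu p, t, pv p) | Dv => (pu p, px p, t)
  end.

Definition pdd (d : dir) (f : point -> R) : point -> R :=
  match d with Du => pd_u f | Dx => pd_x f | Dv => pd_v f end.

Lemma pddE d f p : pdd d f p = Derive (fun t => f (up d p t)) (co d p).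
Proof. destruct d; reflexivity. Qed.

Lemma up_co d p : up d p (co d p) = p.
Proof. destruct d, p as [[u x] v]; reflexivity. Qed.

Lemma co_up_same d p t : co d (up d p t) = t.
Proof. destruct d; reflexivity. Qed.

Lemma co_up_other d e p t : d <> e -> co e (up d p t) = co e p.
Proof. destruct d, e; intros H; try reflexivity; congruence. Qed.

Lemma up_up d p s t : up d (up d p s) t = up d p t.
Proof. destruct d; reflexivity. Qed.

Lemma dir_eq_dec (d e : dir) : {d = e} + {d <> e}.
Proof. decide equality. Defined.

Lemma co_ext p q : (forall d, co d p = co d q) -> p = q.
Proof.
  intros H; destruct p as [[u x] v], q as [[u' x'] v'].
  generalize (H Du) (H Dx) (H Dv); cbn; congruence.
Qed.

Lemma locally_box (p : point) (Q : point -> Prop) :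
  locally p Q <->
  exists del : posreal, forall q, (forall d, Rabs (co d q - co d p) < del) -> Q q.
Proof.
  split; intros [del H]; exists del; intros q Hq; apply H.
  - generalize (Hq Du) (Hq Dx) (Hq Dv).
    destruct p as [[u x] v], q as [[u' x'] v']; intros; repeat split; assumption.
  - destruct p as [[u x] v], q as [[u' x'] v'], Hq as [[H1 H2] H3].
    intros []; assumption.
Qed.

Lemma continuous_co d p : continuous (co d) p.
Proof.
  intros Q [eps HQ]; apply locally_box; exists eps; intros q Hq.
  apply HQ, Hq.
Qed.

Lemma continuous_upd d p (t : R) : continuous (up d p) t.
Proof.
  intros Q HQ; apply locally_box in HQ; destruct HQ as [eps HQ].
  exists eps; intros s Hs; apply HQ; intros e.
  destruct (dir_eq_dec d e) as [<- | Hne].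
  - rewrite !co_up_same; exact Hs.
  - rewrite !co_up_other, Rminus_diag, Rabs_R0 by exact Hne; apply cond_pos.
Qed.

Lemma locally_up d p (Q : point -> Prop) :
  locally p Q -> locally (co d p) (fun t => Q (up d p t)).
Proof.
  intros HQ; apply (continuous_upd d p (co d p)); rewrite up_co; exact HQ.
Qed.

Lemma pdd_ext_loc d (f g : point -> R) p :
  locally p (fun q => f q = g q) -> pdd d f p = pdd d g p.
Proof.
  intros H; rewrite !pddE; apply Derive_ext_loc, (locally_up d p _ H).
Qed.

Lemma pdd_loc d (f g : point -> R) p :
  locally p (fun q => f q = g q) -> locally p (fun q => pdd d f q = pdd d g q).
Proof.
  intros H; apply locally_locally in H; revert H; apply filter_imp; intros q.
  apply pdd_ext_loc.
Qed.

Lemma Ck_S m (U : point -> Prop) (f : point -> R) :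
  Ck (S m) U f <->
  (forall d p, U p -> ex_derive (fun t => f (up d p t)) (co d p)) /\
  (forall d, Ck m U (pdd d f)).
Proof.
  split.
  - intros (H1 & H2 & H3 & H4); split; intros [] *; try assumption;
      intros Hp; destruct (H1 _ Hp) as (? & ? & ?); assumption.
  - intros [H1 H2]; split; [|exact (conj (H2 Du) (conj (H2 Dx) (H2 Dv)))].
    intros p Hp; exact (conj (H1 Du p Hp) (conj (H1 Dx p Hp) (H1 Dv p Hp))).
Qed.

Lemma Ck_sub n (U V : point -> Prop) (f : point -> R) : (forall p, V p -> U p) -> Ck n U f -> Ck n V f.
Proof.
  intros HVU; revert f; induction n as [|n IH]; intros f Hf.
  - intros p Hp; apply Hf; auto.
  - apply Ck_S in Hf; apply Ck_S; destruct Hf as [H1 H2]; split; auto.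
Qed.

Lemma Ck_ext n (U : point -> Prop) (f g : point -> R) :
  open U -> (forall p, U p -> f p = g p) -> Ck n U f -> Ck n U g.
Proof.
  intros HU; revert f g; induction n as [|n IH]; intros f g Hfg Hf.
  - intros p Hp; apply (continuous_ext_loc (T := prod_UniformSpace (prod_UniformSpace R_UniformSpace R_UniformSpace) R_UniformSpace)) with (g := f).
    + apply filter_imp with (2 := HU p Hp); auto.
    + apply Hf; exact Hp.
  - apply Ck_S in Hf; apply Ck_S; destruct Hf as [H1 H2]; split.
    + intros d p Hp; apply (ex_derive_ext_loc (fun t => f (up d p t))); [|auto].
      apply (locally_up d p (fun q => f q = g q)); apply filter_imp with (2 := HU p Hp); auto.
    + intros d; apply (IH (pdd d f)); [|auto].
      intros p Hp; apply pdd_ext_loc; apply filter_imp with (2 := HU p Hp); auto.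
Qed.

(* Mean value theorem along the path (a,b,c) -> (a',b,c) -> (a',b',c) -> (a',b',c'). *)
Lemma C1_approx (f : point -> R) (p : point) (eps : posreal) :
  locally p (fun q => forall d, ex_derive (fun t => f (up d q t)) (co d q)) ->
  (forall d, continuous (pdd d f) p) ->
  locally p (fun q =>
    Rabs (f q - f p - differential f p (pu q - pu p, px q - px p, pv q - pv p))
    <= eps * (Rabs (pu q - pu p) + Rabs (px q - px p) + Rabs (pv q - pv p))).
Proof.
  intros Hex Hc.
  assert (Hn : locally p (fun q => forall d,
      ex_derive (fun t => f (up d q t)) (co d q) /\
      Rabs (pdd d f q - pdd d f p) < eps)).
  { assert (Hd : forall d, locally p (fun q => Rabs (pdd d f q - pdd d f p) < eps)).
    { intros d; apply (Hc d (fun y => Rabs (y - pdd d f p) < eps)).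
      exists eps; intros y Hy; exact Hy. }
    generalize (filter_and _ _ Hex (filter_and _ _ (Hd Du)
                  (filter_and _ _ (Hd Dx) (Hd Dv)))).
    apply filter_imp; intros q (H1 & H2 & H3 & H4) d; split; [apply H1|].
    destruct d; assumption. }
  apply locally_box in Hn; destruct Hn as [del Hn].
  apply locally_box; exists del; intros q Hq.
  (* One leg of the path: on the whole box the partial derivative differs from its value at [p] by
     less than [eps]. *)
  assert (Hmv : forall d r s, (forall e, Rabs (co e r - co e p) < del) ->
      Rabs (s - co d p) < del ->
      Rabs (f (up d r s) - f r - pdd d f p * (s - co d r)) <= eps * Rabs (s - co d r)).
  { intros d r s Hr Hs.
    assert (Hseg : forall t, Rmin (co d r) s <= t <= Rmax (co d r) s ->
        forall e, Rabs (co e (up d r t) - co e p) < del).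
    { intros t Ht e; destruct (dir_eq_dec d e) as [<- | Hne].
      - rewrite co_up_same; generalize (Hr d); revert Hs Ht.
        unfold Rmin, Rmax; destruct (Rle_dec (co d r) s); intros Hs Ht Hr';
          apply Rabs_def1; apply Rabs_def2 in Hs; apply Rabs_def2 in Hr'; lra.
      - rewrite co_up_other by exact Hne; apply Hr. }
    assert (Hder : forall t, Rmin (co d r) s <= t <= Rmax (co d r) s ->
        is_derive (fun t => f (up d r t)) t (pdd d f (up d r t))).
    { intros t Ht; destruct (Hn _ (Hseg t Ht) d) as [He _].
      rewrite pddE, co_up_same in *.
      apply is_derive_ext with (f := fun t0 => f (up d (up d r t) t0));
        [intros; now rewrite up_up|].
      apply Derive_correct; exact He. }
    destruct (MVT_gen (fun t => f (up d r t)) (co d r) s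
                (fun t => pdd d f (up d r t))) as (c & Hc1 & Hc2).
    - intros t Ht; apply Hder; lra.
    - intros t Ht; apply continuity_pt_filterlim.
      apply (ex_derive_continuous (fun t => f (up d r t))).
      eexists; apply Hder; exact Ht.
    - rewrite up_co in Hc2; rewrite Hc2.
      replace (_ - _) with ((pdd d f (up d r c) - pdd d f p) * (s - co d r)) by ring.
      rewrite Rabs_mult; apply Rmult_le_compat_r; [apply Rabs_pos|].
      left; apply Hn, Hseg, Hc1. }
  destruct p as [[u x] v], q as [[u' x'] v'].
  generalize (Hq Du) (Hq Dx) (Hq Dv); cbn; intros Hu Hx Hv.
  assert (H0 : Rabs 0 < del) by (rewrite Rabs_R0; apply cond_pos).
  generalize (Hmv Du (u, x, v) u'), (Hmv Dx (u', x, v) x'), (Hmv Dv (u', x', v) v').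
  cbn; intros M1 M2 M3.
  assert (N1 := M1 (ltac:(intros []; cbn; rewrite ?Rminus_diag; assumption)) Hu).
  assert (N2 := M2 (ltac:(intros []; cbn; rewrite ?Rminus_diag; assumption)) Hx).
  assert (N3 := M3 (ltac:(intros []; cbn; rewrite ?Rminus_diag; assumption)) Hv).
  unfold differential; cbn.
  match goal with |- Rabs ?e <= _ => replace e with
    ((f (u', x, v) - f (u, x, v) - pd_u f (u, x, v) * (u' - u)) +
     (f (u', x', v) - f (u', x, v) - pd_x f (u, x, v) * (x' - x)) +
     (f (u', x', v') - f (u', x', v) - pd_v f (u, x, v) * (v' - v))) by ring end.
  eapply Rle_trans; [apply Rabs_triang|].
  eapply Rle_trans; [apply Rplus_le_compat_r, Rabs_triang|].
  lra.
Qed.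

Lemma point_norm (a b c : R) :
  Rabs a <= norm (a, b, c) /\ Rabs b <= norm (a, b, c) /\ Rabs c <= norm (a, b, c).
Proof.
  destruct (norm_prod (a, b) c) as [N1 _], (norm_prod a b) as [N2 _].
  repeat split; (eapply Rle_trans; [|exact N1]);
    first [apply (Rmax_r (norm (a, b))) | eapply Rle_trans; [|apply Rmax_l]];
    (eapply Rle_trans; [|exact N2]); [apply (Rmax_l (norm a)) | apply (Rmax_r (norm a))].
Qed.

Lemma C1_filterdiff (f : point -> R) (p : point) :
  locally p (fun q => forall d, ex_derive (fun t => f (up d q t)) (co d q)) ->
  (forall d, continuous (pdd d f) p) ->
  filterdiff f (locally p) (fun xi => differential f p xi).
Proof.
  intros Hex Hc; split.
  - split.
    + intros xi eta; unfold differential, plus; cbn; unfold plus; cbn.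
      unfold pu, px, pv; cbn; ring.
    + intros k xi; unfold differential, scal; cbn; unfold scal; cbn; unfold mult; cbn.
      unfold pu, px, pv; cbn; ring.
    + exists (Rabs (pd_u f p) + Rabs (pd_x f p) + Rabs (pd_v f p) + 1); split.
      { generalize (Rabs_pos (pd_u f p)) (Rabs_pos (pd_x f p)) (Rabs_pos (pd_v f p)); lra. }
      intros [[a b] c].
      match goal with |- _ <= _ * ?n => set (N := n) end.
      destruct (point_norm a b c : _ /\ _ /\ _) as (Ha & Hb & Hc').
      change (norm (a, b, c)) with N in Ha, Hb, Hc'.
      clearbody N.
      unfold differential, pu, px, pv; cbn.
      change (norm ?e) with (Rabs e).
      eapply Rle_trans; [apply Rabs_triang|].
      eapply Rle_trans; [apply Rplus_le_compat_r, Rabs_triang|].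
      rewrite !Rabs_mult.
      assert (H0 : 0 <= N) by exact (Rle_trans _ _ _ (Rabs_pos a) Ha).
      generalize (Rmult_le_compat_l _ _ _ (Rabs_pos (pd_u f p)) Ha)
        (Rmult_le_compat_l _ _ _ (Rabs_pos (pd_x f p)) Hb)
        (Rmult_le_compat_l _ _ _ (Rabs_pos (pd_v f p)) Hc').
      intros; lra.
  - intros x Hx.
    generalize (is_filter_lim_locally_unique (V := prod_NormedModule _
      (prod_NormedModule _ R_NormedModule R_NormedModule) R_NormedModule) _ _ Hx).
    clear Hx; intros <-.
    intros eps.
    assert (He : 0 < eps / 3) by (generalize (cond_pos eps); lra).
    generalize (C1_approx f p (mkposreal _ He) Hex Hc).
    apply filter_imp; intros q Hq.
    destruct p as [[u x] v], q as [[u' x'] v'].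
    change (minus (u', x', v') (u, x, v)) with (u' + - u, x' + - x, v' + - v).
    destruct (point_norm (u' + - u) (x' + - x) (v' + - v)) as (Ha & Hb & Hc').
    match goal with |- _ <= _ * ?n => set (N := n) end.
    change (norm (u' + - u, x' + - x, v' + - v)) with N in Ha, Hb, Hc'.
    change (Rabs (u' - u) <= N) in Ha; change (Rabs (x' - x) <= N) in Hb.
    change (Rabs (v' - v) <= N) in Hc'; clearbody N.
    change (Rabs (f (u', x', v') + - f (u, x, v) +
        - differential f (u, x, v) (u' + - u, x' + - x, v' + - v)) <= eps * N).
    unfold pu, px, pv in *; cbn in *.
    eapply Rle_trans; [exact Hq|].
    assert (Hs : Rabs (u' - u) + Rabs (x' - x) + Rabs (v' - v) <= 3 * N) by lra.
    generalize (Rmult_le_compat_l _ _ _ (Rlt_le _ _ He) Hs); lra.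
Qed.

Lemma filterdiff_point (a b c : R -> R) (t : R) (la lb lc : R) :
  is_derive a t la -> is_derive b t lb -> is_derive c t lc ->
  filterdiff (fun s => (a s, b s, c s) : point) (locally t)
    (fun s => (scal s la, scal s lb, scal s lc) : point).
Proof.
  intros Ha Hb Hc.
  apply (filterdiff_comp'_2 (fun s => (a s, b s)) c (fun x y => (x, y)) t
           (fun s => (scal s la, scal s lb)) (fun s => scal s lc) (fun x y => (x, y))).
  - apply (filterdiff_comp'_2 a b (fun x y => (x, y)) t
             (fun s => scal s la) (fun s => scal s lb) (fun x y => (x, y)));
      [exact Ha|exact Hb|].
    apply filterdiff_ext with (f := fun x => x); [intros []; reflexivity|].
    apply filterdiff_ext_lin with (l1 := fun x => x); [apply filterdiff_id|].
    intros []; reflexivity.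
  - exact Hc.
  - apply filterdiff_ext with (f := fun x => x); [intros []; reflexivity|].
    apply filterdiff_ext_lin with (l1 := fun x => x); [apply filterdiff_id|].
    intros []; reflexivity.
Qed.

Lemma C1_curve (f : point -> R) (a b c : R -> R) (t la lb lc : R) :
  locally ((a t, b t, c t) : point)
    (fun q => forall d, ex_derive (fun s => f (up d q s)) (co d q)) ->
  (forall d, continuous (pdd d f) (a t, b t, c t)) ->
  is_derive a t la -> is_derive b t lb -> is_derive c t lc ->
  is_derive (fun s => f (a s, b s, c s)) t
    (differential f (a t, b t, c t) (la, lb, lc)).
Proof.
  intros Hex Hc Ha Hb Hd.
  generalize (filterdiff_comp' (fun s => (a s, b s, c s) : point) f t _ _
    (filterdiff_point a b c t la lb lc Ha Hb Hd) (C1_filterdiff f _ Hex Hc)).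
  intros H; apply filterdiff_ext_lin with (1 := H).
  intros s; unfold differential, scal; cbn; unfold mult; cbn.
  unfold pu, px, pv; cbn; ring.
Qed.

(** For n > 0 the definition of [Ck] does not mention continuity of f itself; here it follows from
    differentiability, by the criterion of continuous partial derivatives. *)
Lemma Ck_S_n n (U : point -> Prop) (f : point -> R) : open U -> Ck (S n) U f -> Ck n U f.
Proof.
  intros HU; revert f; induction n as [|n IH]; intros f Hf.
  - intros p Hp; apply Ck_S in Hf; destruct Hf as [H1 H2].
    apply (filterdiff_continuous (K := R_AbsRing) f p).
    eexists; apply C1_filterdiff; [|intros d; apply H2; exact Hp].
    apply filter_imp with (2 := HU p Hp); intros q Hq d; auto.
  - apply Ck_S in Hf; destruct Hf as [H1 H2]; apply Ck_S; split; auto.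
Qed.

(** ** Smooth functions near a point *)

(** A property of germs: quotients and composites may shrink the domain without the statement having
    to name the new one. *)
Definition smooth_at (p : point) (f : point -> R) : Prop :=
  exists U, open U /\ U p /\ smooth_on U f.

Lemma smooth_on_at (U : point -> Prop) (f : point -> R) p : open U -> smooth_on U f -> U p -> smooth_at p f.
Proof. intros; exists U; auto. Qed.

Lemma smooth_on_pdd U d f : smooth_on U f -> smooth_on U (pdd d f).
Proof. intros H n; generalize (H (S n)); intros Hn; apply Ck_S in Hn; apply Hn. Qed.

Lemma smooth_at_on (U : point -> Prop) (f : point -> R) : open U -> (forall p, U p -> smooth_at p f) -> smooth_on U f.
Proof.
  intros HU H n; revert f H; induction n as [|n IH]; intros f H.
  - intros p Hp; destruct (H p Hp) as (V & _ & HV & Hs); apply (Hs O p HV).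
  - apply Ck_S; split.
    + intros d p Hp; destruct (H p Hp) as (V & _ & HV & Hs).
      generalize (Hs 1%nat); intros H1; apply Ck_S in H1; apply H1; exact HV.
    + intros d; apply IH; intros p Hp; destruct (H p Hp) as (V & HVo & HV & Hs).
      exists V; repeat split; auto; apply smooth_on_pdd; exact Hs.
Qed.

Lemma smooth_at_pdd p d f : smooth_at p f -> smooth_at p (pdd d f).
Proof. intros (U & HU & Hp & Hs); exists U; repeat split; auto; apply smooth_on_pdd; exact Hs. Qed.

Lemma smooth_at_loc p (f : point -> R) : smooth_at p f -> locally p (fun q => smooth_at q f).
Proof.
  intros (U & HU & Hp & Hs); apply filter_imp with (2 := HU p Hp); intros q Hq.
  exists U; auto.
Qed.

Lemma smooth_at_ext p (f g : point -> R) :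
  locally p (fun q => f q = g q) -> smooth_at p f -> smooth_at p g.
Proof.
  intros Hfg (U & HU & Hp & Hs).
  exists (fun q => U q /\ locally q (fun r => f r = g r)).
  assert (Ho : open (fun q => U q /\ locally q (fun r => f r = g r))).
  { apply open_and; [exact HU|]; intros q Hq; apply locally_locally; exact Hq. }
  split; [exact Ho|split; [auto|]].
  intros n; apply (Ck_ext n _ f g Ho).
  - intros q [_ Hq]; apply (locally_singleton q (fun r => f r = g r)), Hq.
  - apply Ck_sub with (2 := Hs n); intros q [Hq _]; exact Hq.
Qed.

Lemma smooth_at_ex_derive p f d :
  smooth_at p f -> ex_derive (fun t => f (up d p t)) (co d p).
Proof.
  intros (U & HU & Hp & Hs); generalize (Hs 1%nat); intros H; apply Ck_S in H.
  apply H; exact Hp.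
Qed.

Lemma smooth_at_is_derive p f d :
  smooth_at p f -> is_derive (fun t => f (up d p t)) (co d p) (pdd d f p).
Proof. intros H; rewrite pddE; apply Derive_correct, smooth_at_ex_derive, H. Qed.

Lemma smooth_at_continuous p (f : point -> R) : smooth_at p f -> continuous f p.
Proof. intros (U & HU & Hp & Hs); apply (Hs O p Hp). Qed.

Lemma pdd_eq f d p l :
  is_derive (fun t => f (up d p t)) (co d p) l -> pdd d f p = l.
Proof. intros H; rewrite pddE; apply is_derive_unique, H. Qed.

Lemma pdd_const d (c : R) : pdd d (fun _ => c) = (fun _ => 0).
Proof. fext p; rewrite pddE; apply Derive_const. Qed.

Lemma pdd_co d e : pdd d (co e) = (fun _ => if dir_eq_dec d e then 1 else 0).
Proof.
  fext p; apply pdd_eq.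
  destruct (dir_eq_dec d e) as [<- | Hne].
  - apply is_derive_ext with (f := fun t => t); [intros; now rewrite co_up_same|].
    apply (is_derive_id (K := R_AbsRing)).
  - apply is_derive_ext with (f := fun t => co e p);
      [intros; now rewrite co_up_other|].
    apply @is_derive_const.
Qed.

Lemma smooth_on_const U (c : R) : smooth_on U (fun _ => c).
Proof.
  intros n; revert c; induction n as [|n IH]; intros c.
  - intros p _; apply continuous_const.
  - apply Ck_S; split.
    + intros d p _; apply @ex_derive_const.
    + intros d; rewrite pdd_const; apply IH.
Qed.

Lemma smooth_on_co U e : smooth_on U (co e).
Proof.
  intros n; destruct n as [|n].
  - intros p _; apply continuous_co.
  - apply Ck_S; split.
    + intros d p _; destruct (dir_eq_dec d e) as [<- | Hne].
      * apply ex_derive_ext with (f := fun t => t); [intros; now rewrite co_up_same|].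
        apply (ex_derive_id (K := R_AbsRing)).
      * apply ex_derive_ext with (f := fun t => co e p);
          [intros; now rewrite co_up_other|].
        apply @ex_derive_const.
    + intros d; rewrite pdd_co; apply smooth_on_const.
Qed.

Lemma Ck_plus n (U : point -> Prop) (f g : point -> R) :
  open U -> Ck n U f -> Ck n U g -> Ck n U (fun p => f p + g p).
Proof.
  intros HU; revert f g; induction n as [|n IH]; intros f g Hf Hg.
  - intros p Hp; apply (continuous_plus f g); auto.
  - apply Ck_S in Hf; apply Ck_S in Hg; destruct Hf as [F1 F2], Hg as [G1 G2].
    apply Ck_S; split.
    + intros d p Hp; apply (ex_derive_plus (fun t => f (up d p t)) (fun t => g (up d p t)));
        auto.
    + intros d; apply (Ck_ext n U (fun p => pdd d f p + pdd d g p) _ HU); [|auto].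
      intros p Hp; rewrite !pddE; symmetry; apply Derive_plus; auto.
Qed.

Lemma Ck_mult n (U : point -> Prop) (f g : point -> R) :
  open U -> Ck n U f -> Ck n U g -> Ck n U (fun p => f p * g p).
Proof.
  intros HU; revert f g; induction n as [|n IH]; intros f g Hf Hg.
  - intros p Hp; apply (continuous_mult f g); auto.
  - assert (Hf' := Ck_S_n _ _ _ HU Hf); assert (Hg' := Ck_S_n _ _ _ HU Hg).
    apply Ck_S in Hf; apply Ck_S in Hg; destruct Hf as [F1 F2], Hg as [G1 G2].
    apply Ck_S; split.
    + intros d p Hp; apply (ex_derive_mult (fun t => f (up d p t)) (fun t => g (up d p t)));
        auto.
    + intros d; apply (Ck_ext n U (fun p => pdd d f p * g p + f p * pdd d g p) _ HU).
      * intros p Hp; rewrite !pddE; symmetry; rewrite Derive_mult by auto.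
        now rewrite !up_co.
      * apply Ck_plus; auto.
Qed.

Lemma Ck_inv n (U : point -> Prop) (f : point -> R) :
  open U -> (forall p, U p -> f p <> 0) -> Ck n U f -> Ck n U (fun p => / f p).
Proof.
  intros HU H0; revert f H0; induction n as [|n IH]; intros f H0 Hf.
  - intros p Hp; apply (continuous_comp f Rinv); [auto|].
    apply continuity_pt_filterlim, continuity_pt_inv; [|auto].
    apply continuity_pt_id.
  - assert (Hf' := Ck_S_n _ _ _ HU Hf).
    apply Ck_S in Hf; destruct Hf as [F1 F2].
    apply Ck_S; split.
    + intros d p Hp; apply (ex_derive_inv (fun t => f (up d p t))); [auto|].
      rewrite up_co; auto.
    + intros d; apply (Ck_ext n U (fun p => -1 * (pdd d f p * (/ f p * / f p))) _ HU).
      * intros p Hp; rewrite !pddE; symmetry; rewrite Derive_inv;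
          [|auto|rewrite up_co; auto].
        rewrite up_co; field; auto.
      * apply Ck_mult; [auto|apply smooth_on_const|].
        apply Ck_mult; auto; apply Ck_mult; auto.
Qed.

Lemma smooth_at_const p (c : R) : smooth_at p (fun _ => c).
Proof. exists (fun _ => True); repeat split; [apply open_true|apply smooth_on_const]. Qed.

Lemma smooth_at_co p e : smooth_at p (co e).
Proof. exists (fun _ => True); repeat split; [apply open_true|apply smooth_on_co]. Qed.

Lemma smooth_at_pu p : smooth_at p pu. Proof. exact (smooth_at_co p Du). Qed.
Lemma smooth_at_px p : smooth_at p px. Proof. exact (smooth_at_co p Dx). Qed.
Lemma smooth_at_pv p : smooth_at p pv. Proof. exact (smooth_at_co p Dv). Qed.

Lemma smooth_at_plus p (f g : point -> R) :
  smooth_at p f -> smooth_at p g -> smooth_at p (fun q => f q + g q).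
Proof.
  intros (U & HU & Up & Hf) (V & HV & Vp & Hg).
  exists (fun q => U q /\ V q); split; [apply open_and; auto|split; [auto|]].
  intros n; apply Ck_plus; [apply open_and; auto| |];
    [apply Ck_sub with (2 := Hf n)|apply Ck_sub with (2 := Hg n)]; tauto.
Qed.

Lemma smooth_at_mult p (f g : point -> R) :
  smooth_at p f -> smooth_at p g -> smooth_at p (fun q => f q * g q).
Proof.
  intros (U & HU & Up & Hf) (V & HV & Vp & Hg).
  exists (fun q => U q /\ V q); split; [apply open_and; auto|split; [auto|]].
  intros n; apply Ck_mult; [apply open_and; auto| |];
    [apply Ck_sub with (2 := Hf n)|apply Ck_sub with (2 := Hg n)]; tauto.
Qed.

Lemma smooth_at_opp p (f : point -> R) : smooth_at p f -> smooth_at p (fun q => - f q).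
Proof.
  intros H; apply (smooth_at_ext p (fun q => -1 * f q)).
  - apply filter_forall; intros; ring.
  - apply (smooth_at_mult p (fun _ => -1) f); [apply smooth_at_const|exact H].
Qed.

Lemma smooth_at_minus p (f g : point -> R) :
  smooth_at p f -> smooth_at p g -> smooth_at p (fun q => f q - g q).
Proof.
  intros Hf Hg; apply (smooth_at_plus p f (fun q => - g q)); [exact Hf|].
  apply smooth_at_opp, Hg.
Qed.

Lemma continuous_neq0 {T : UniformSpace} (f : T -> R) (x : T) :
  continuous f x -> f x <> 0 -> locally x (fun y => f y <> 0).
Proof.
  intros Hc H0; apply (Hc (fun y => y <> 0)).
  exists (mkposreal _ (Rabs_pos_lt _ H0)); intros y Hy ->.
  unfold ball in Hy; cbn in Hy; unfold AbsRing_ball, abs, minus, plus, opp in Hy; cbn in Hy.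
  rewrite Rplus_0_l, Rabs_Ropp in Hy; lra.
Qed.

Lemma smooth_at_inv p (f : point -> R) : smooth_at p f -> f p <> 0 -> smooth_at p (fun q => / f q).
Proof.
  intros Hf H0; assert (Hf' := Hf); destruct Hf' as (U & HU & Up & Hs).
  exists (fun q => U q /\ locally q (fun r => f r <> 0)).
  assert (Ho : open (fun q => U q /\ locally q (fun r => f r <> 0))).
  { apply open_and; [exact HU|]; intros q Hq; apply locally_locally; exact Hq. }
  split; [exact Ho|split].
  - split; [exact Up|]; apply continuous_neq0; [|exact H0].
    apply smooth_at_continuous, Hf.
  - intros n; apply Ck_inv; [exact Ho| |].
    + intros q [_ Hq]; apply (locally_singleton q (fun r => f r <> 0)), Hq.
    + apply Ck_sub with (2 := Hs n); tauto.
Qed.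

Lemma smooth_at_div p (f g : point -> R) :
  smooth_at p f -> smooth_at p g -> g p <> 0 -> smooth_at p (fun q => f q / g q).
Proof.
  intros Hf Hg H0; apply (smooth_at_mult p f (fun q => / g q)); [exact Hf|].
  apply smooth_at_inv; assumption.
Qed.

Lemma smooth_at_pow p f n : smooth_at p f -> smooth_at p (fun q => f q ^ n).
Proof.
  intros Hf; induction n as [|n IH]; cbn; [apply smooth_at_const|].
  apply (smooth_at_mult p f (fun q => f q ^ n)); assumption.
Qed.

(** * Smooth maps and the chain rule *)

Definition map_smooth_at (p : point) (phi : point -> point) : Prop :=
  forall d, smooth_at p (fun q => co d (phi q)).

Lemma map_smooth_continuous p phi : map_smooth_at p phi -> continuous phi p.
Proof.
  intros H Q HQ; apply locally_box in HQ; destruct HQ as [eps HQ].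
  assert (Hd : forall d, locally p (fun q => Rabs (co d (phi q) - co d (phi p)) < eps)).
  { intros d; apply (smooth_at_continuous _ _ (H d)
      (fun y => Rabs (y - co d (phi p)) < eps)).
    exists eps; intros y Hy; exact Hy. }
  generalize (filter_and _ _ (Hd Du) (filter_and _ _ (Hd Dx) (Hd Dv))).
  apply (filter_imp (F := locally p)); intros q (H1 & H2 & H3); apply HQ.
  intros []; assumption.
Qed.

Lemma chain_is_derive p phi (f : point -> R) d :
  map_smooth_at p phi -> smooth_at (phi p) f ->
  is_derive (fun t => f (phi (up d p t))) (co d p)
    (pd_u f (phi p) * pdd d (fun q => pu (phi q)) p +
     pd_x f (phi p) * pdd d (fun q => px (phi q)) p +
     pd_v f (phi p) * pdd d (fun q => pv (phi q)) p).
Proof.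
  intros Hphi Hf.
  assert (E : phi p = (pu (phi (up d p (co d p))), px (phi (up d p (co d p))),
                       pv (phi (up d p (co d p))))).
  { rewrite up_co; destruct (phi p) as [[? ?] ?]; reflexivity. }
  apply is_derive_ext with (f := fun t =>
    f (pu (phi (up d p t)), px (phi (up d p t)), pv (phi (up d p t)))).
  { intros t; destruct (phi (up d p t)) as [[? ?] ?]; reflexivity. }
  match goal with |- is_derive _ _ ?l => assert (El : l =
    differential f (pu (phi (up d p (co d p))), px (phi (up d p (co d p))),
                       pv (phi (up d p (co d p))))
     (pdd d (fun q => pu (phi q)) p, pdd d (fun q => px (phi q)) p,
      pdd d (fun q => pv (phi q)) p)) end.
  { rewrite <- E; reflexivity. }
  rewrite El.
  apply (C1_curve f (fun t => pu (phi (up d p t))) (fun t => px (phi (up d p t)))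
           (fun t => pv (phi (up d p t)))).
  - rewrite <- E; apply smooth_at_loc in Hf; revert Hf; apply filter_imp; intros q Hq e.
    apply smooth_at_ex_derive, Hq.
  - intros e; rewrite <- E; apply smooth_at_continuous, smooth_at_pdd, Hf.
  - exact (smooth_at_is_derive p _ d (Hphi Du)).
  - exact (smooth_at_is_derive p _ d (Hphi Dx)).
  - exact (smooth_at_is_derive p _ d (Hphi Dv)).
Qed.

Lemma pdd_comp p phi (f : point -> R) d :
  map_smooth_at p phi -> smooth_at (phi p) f ->
  pdd d (fun q => f (phi q)) p =
    pd_u f (phi p) * pdd d (fun q => pu (phi q)) p +
    pd_x f (phi p) * pdd d (fun q => px (phi q)) p +
    pd_v f (phi p) * pdd d (fun q => pv (phi q)) p.
Proof. intros; apply pdd_eq, chain_is_derive; assumption. Qed.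

(** Induction on n with f general: the derivative of the composite is a sum of products of
    composites [pdd e f (phi q)] with derivatives of the components of phi. *)
Lemma Ck_comp n (U V : point -> Prop) (phi : point -> point) (f : point -> R) :
  open U -> open V -> (forall q, U q -> V (phi q)) ->
  (forall d, smooth_on U (fun q => co d (phi q))) -> smooth_on V f ->
  Ck n U (fun q => f (phi q)).
Proof.
  intros HU HV HUV Hphi; revert f; induction n as [|n IH]; intros f Hf.
  - intros p Hp; apply (continuous_comp phi f).
    + apply map_smooth_continuous; intros d; apply (smooth_on_at U); auto.
    + apply smooth_at_continuous, (smooth_on_at V); auto.
  - assert (Hm : forall p, U p -> map_smooth_at p phi).
    { intros p Hp d; apply (smooth_on_at U); auto. }
    assert (Hs : forall p, U p -> smooth_at (phi p) f).
    { intros p Hp; apply (smooth_on_at V); auto. }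
    apply Ck_S; split.
    + intros d p Hp; eexists; apply chain_is_derive; auto.
    + intros d; apply (Ck_ext n U (fun p =>
        pd_u f (phi p) * pdd d (fun q => pu (phi q)) p +
        pd_x f (phi p) * pdd d (fun q => px (phi q)) p +
        pd_v f (phi p) * pdd d (fun q => pv (phi q)) p) _ HU).
      * intros p Hp; symmetry; apply pdd_comp; auto.
      * assert (Hc : forall e, Ck n U (fun p => pdd e f (phi p) * pdd d (fun q => co e (phi q)) p)).
        { intros e; apply Ck_mult; [exact HU| |].
          - apply IH, smooth_on_pdd, Hf.
          - apply smooth_on_pdd, Hphi. }
        apply Ck_plus; [exact HU| |apply (Hc Dv)].
        apply Ck_plus; [exact HU|apply (Hc Du)|apply (Hc Dx)].
Qed.

Lemma smooth_at_comp p phi (f : point -> R) :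
  map_smooth_at p phi -> smooth_at (phi p) f -> smooth_at p (fun q => f (phi q)).
Proof.
  intros Hphi (V & HV & Vp & Hf).
  destruct (Hphi Du) as (U1 & O1 & P1 & S1), (Hphi Dx) as (U2 & O2 & P2 & S2),
    (Hphi Dv) as (U3 & O3 & P3 & S3).
  set (U := fun q => (U1 q /\ U2 q /\ U3 q) /\ locally q (fun r => V (phi r))).
  assert (HU : open U).
  { apply open_and.
    - apply open_and; [auto|apply open_and; auto].
    - intros q Hq; apply locally_locally; exact Hq. }
  exists U; split; [exact HU|split].
  - split; [auto|]; apply (map_smooth_continuous _ _ Hphi), HV, Vp.
  - intros n; apply (Ck_comp n U V); auto.
    + intros q [_ Hq]; apply (locally_singleton q (fun r => V (phi r))), Hq.
    + intros d m; destruct d; [apply Ck_sub with (2 := S1 m)|apply Ck_sub with (2 := S2 m)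
        |apply Ck_sub with (2 := S3 m)]; intros q Hq; apply Hq.
Qed.

Lemma pdd_plus p (f g : point -> R) d :
  smooth_at p f -> smooth_at p g ->
  pdd d (fun q => f q + g q) p = pdd d f p + pdd d g p.
Proof. intros Hf Hg; rewrite !pddE; apply Derive_plus; apply smooth_at_ex_derive; assumption. Qed.

Lemma pdd_mult p (f g : point -> R) d :
  smooth_at p f -> smooth_at p g ->
  pdd d (fun q => f q * g q) p = pdd d f p * g p + f p * pdd d g p.
Proof.
  intros Hf Hg; rewrite !pddE, Derive_mult by (apply smooth_at_ex_derive; assumption).
  now rewrite !up_co.
Qed.

Lemma pdd_inv p f d :
  smooth_at p f -> f p <> 0 -> pdd d (fun q => / f q) p = - pdd d f p / f p ^ 2.
Proof.
  intros Hf H0; rewrite !pddE, Derive_inv;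
    [|apply smooth_at_ex_derive, Hf|rewrite up_co; exact H0].
  rewrite up_co; reflexivity.
Qed.

(** * Symmetry of mixed derivatives *)

Lemma pdd_comm_ux p f : smooth_at p f -> pd_u (pd_x f) p = pd_x (pd_u f) p.
Proof.
  intros Hf; destruct p as [[u x] v].
  (* The slice with v frozen is a function of two variables, to which Schwarz's theorem applies. *)
  assert (Hl : locally_2d (fun a b => smooth_at (a, b, v) f) u x).
  { apply smooth_at_loc in Hf; destruct Hf as [del Hf]; exists del; intros a b Ha Hb.
    apply Hf; repeat split; cbn; try assumption.
    unfold AbsRing_ball, abs, minus, plus, opp; cbn.
    rewrite Rplus_opp_r, Rabs_R0; apply cond_pos. }
  assert (Hcc : forall g, smooth_at (u, x, v) g ->
    continuity_2d_pt (fun a b => g (a, b, v)) u x).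
  { intros g Hg; apply continuity_2d_pt_filterlim.
    apply (continuous_comp (fun z : R * R => (fst z, snd z, v)) g (u, x));
      [|apply smooth_at_continuous, Hg].
    intros Q [eps HQ]; exists eps; intros z [Hz1 Hz2]; apply HQ; repeat split; try assumption.
    apply ball_center. }
  apply (Schwarz (fun a b => f (a, b, v)) u x).
  - destruct Hl as [del Hl]; exists del; intros a b Ha Hb.
    generalize (Hl a b Ha Hb); intros Hs; repeat split.
    + exact (smooth_at_ex_derive _ _ Du Hs).
    + exact (smooth_at_ex_derive _ _ Dx Hs).
    + exact (smooth_at_ex_derive _ _ Du (smooth_at_pdd _ Dx _ Hs)).
    + exact (smooth_at_ex_derive _ _ Dx (smooth_at_pdd _ Du _ Hs)).
  - exact (Hcc _ (smooth_at_pdd _ Du _ (smooth_at_pdd _ Dx _ Hf))).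
  - exact (Hcc _ (smooth_at_pdd _ Dx _ (smooth_at_pdd _ Du _ Hf))).
Qed.

Lemma map_smooth_at_mk p (f g h : point -> R) :
  smooth_at p f -> smooth_at p g -> smooth_at p h ->
  map_smooth_at p (fun q => (f q, g q, h q)).
Proof. intros Hf Hg Hh []; assumption. Qed.

(* The two remaining cases follow from [pdd_comm_ux] by permuting the coordinates. *)
Lemma pdd_comm_uv p f : smooth_at p f -> pd_u (pd_v f) p = pd_v (pd_u f) p.
Proof.
  intros Hf; destruct p as [[u x] v].
  apply (pdd_comm_ux (u, v, x) (fun q => f (pu q, pv q, px q))).
  apply (smooth_at_comp (u, v, x) (fun q => (pu q, pv q, px q)) f); [|exact Hf].
  apply map_smooth_at_mk; [apply smooth_at_pu|apply smooth_at_pv|apply smooth_at_px].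
Qed.

Lemma pdd_comm_xv p f : smooth_at p f -> pd_x (pd_v f) p = pd_v (pd_x f) p.
Proof.
  intros Hf; destruct p as [[u x] v].
  apply (pdd_comm_ux (x, v, u) (fun q => f (pv q, pu q, px q))).
  apply (smooth_at_comp (x, v, u) (fun q => (pv q, pu q, px q)) f); [|exact Hf].
  apply map_smooth_at_mk; [apply smooth_at_pv|apply smooth_at_pu|apply smooth_at_px].
Qed.

Lemma pdd_comm d e p f : smooth_at p f -> pdd d (pdd e f) p = pdd e (pdd d f) p.
Proof.
  intros Hf; destruct d, e; cbn [pdd].
  - reflexivity.
  - exact (pdd_comm_ux p f Hf).
  - exact (pdd_comm_uv p f Hf).
  - symmetry; exact (pdd_comm_ux p f Hf).
  - reflexivity.
  - exact (pdd_comm_xv p f Hf).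
  - symmetry; exact (pdd_comm_uv p f Hf).
  - symmetry; exact (pdd_comm_xv p f Hf).
  - reflexivity.
Qed.

Definition itd (d : dir) (n : nat) (f : point -> R) : point -> R := Nat.iter n (pdd d) f.

Lemma pd_itd i j k f : pd i j k f = itd Du i (itd Dx j (itd Dv k f)).
Proof. reflexivity. Qed.

Lemma smooth_at_itd p d n f : smooth_at p f -> smooth_at p (itd d n f).
Proof. intros Hf; induction n as [|n IH]; [exact Hf|]; apply (smooth_at_pdd p d), IH. Qed.

Lemma smooth_at_pd p i j k f : smooth_at p f -> smooth_at p (pd i j k f).
Proof. intros; rewrite pd_itd; now repeat apply smooth_at_itd. Qed.

Lemma itd_ext_loc d n f g p :
  locally p (fun q => f q = g q) -> locally p (fun q => itd d n f q = itd d n g q).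
Proof.
  intros H; induction n as [|n IH]; [exact H|]; apply (pdd_loc d _ _ p IH).
Qed.

Lemma itd_comm d e n p f :
  smooth_at p f -> itd e n (pdd d f) p = pdd d (itd e n f) p.
Proof.
  revert p; induction n as [|n IH]; intros p Hf; [reflexivity|].
  change (pdd e (itd e n (pdd d f)) p = pdd d (pdd e (itd e n f)) p).
  rewrite (pdd_comm d e) by (apply smooth_at_itd, Hf).
  apply pdd_ext_loc; generalize (smooth_at_loc p f Hf); apply filter_imp.
  intros q Hq; apply IH, Hq.
Qed.

Definition bi (d : dir) (i : nat) : nat := match d with Du => S i | _ => i end.
Definition bj (d : dir) (i : nat) : nat := match d with Dx => S i | _ => i end.
Definition bk (d : dir) (i : nat) : nat := match d with Dv => S i | _ => i end.

(** In [pd] the derivatives in u are outermost and those in v innermost, so a further derivative has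
    to be commuted inwards to its slot. *)
Lemma pdd_pd d i j k f p :
  smooth_at p f -> pdd d (pd i j k f) p = pd (bi d i) (bj d j) (bk d k) f p.
Proof.
  intros Hf; rewrite !pd_itd; destruct d; cbn [bi bj bk].
  - reflexivity.
  - rewrite <- itd_comm by (now repeat apply smooth_at_itd); reflexivity.
  - rewrite <- itd_comm by (now repeat apply smooth_at_itd).
    apply (locally_singleton p (fun q => itd Du i _ q = itd Du i _ q)).
    apply itd_ext_loc; generalize (smooth_at_loc p f Hf); apply filter_imp.
    intros q Hq; symmetry.
    exact (itd_comm Dv Dx j q (itd Dv k f) (smooth_at_itd q Dv k f Hq)).
Qed.

Lemma pd_pdd d i j k f p :
  smooth_at p f -> pd i j k (pdd d f) p = pd (bi d i) (bj d j) (bk d k) f p.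
Proof.
  intros Hf; rewrite <- pdd_pd by exact Hf; rewrite !pd_itd.
  rewrite <- itd_comm by (now repeat apply smooth_at_itd).
  apply (locally_singleton p (fun q => itd Du i _ q = itd Du i _ q)).
  apply itd_ext_loc; generalize (smooth_at_loc p f Hf); apply filter_imp.
  intros q Hq; rewrite <- itd_comm by (now apply smooth_at_itd).
  apply (locally_singleton q (fun r => itd Dx j _ r = itd Dx j _ r)).
  apply itd_ext_loc; generalize (smooth_at_loc q f Hq); apply filter_imp.
  intros r Hr; apply itd_comm, Hr.
Qed.

(** ** Agreement of jets at a point *)

(** Derivatives are compared in every order of differentiation, not only in the one fixed by [pd];
    Leibniz and chain rule then yield plain inductions, without binomial or Faa di Bruno
    formulas. *)
Fixpoint agr (n : nat) (p : point) (f g : point -> R) : Prop :=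
  f p = g p /\
  match n with O => True | S m => forall d, agr m p (pdd d f) (pdd d g) end.

Lemma agr_val n p f g : agr n p f g -> f p = g p.
Proof. destruct n; intros []; assumption. Qed.

Lemma agr_loc n p f g : locally p (fun q => f q = g q) -> agr n p f g.
Proof.
  revert f g; induction n as [|n IH]; intros f g H; split.
  - apply (locally_singleton p (fun q => f q = g q)), H.
  - exact I.
  - apply (locally_singleton p (fun q => f q = g q)), H.
  - intros d; apply IH, pdd_loc, H.
Qed.

Lemma agr_refl n p f : agr n p f f.
Proof. apply agr_loc, filter_forall; reflexivity. Qed.

Lemma agr_sym n p f g : agr n p f g -> agr n p g f.
Proof.
  revert f g; induction n as [|n IH]; intros f g [H1 H2]; split; auto.
  all: intros d; apply IH, H2.
Qed.

Lemma agr_trans n p f g h : agr n p f g -> agr n p g h -> agr n p f h.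
Proof.
  revert f g h; induction n as [|n IH]; intros f g h [F1 F2] [G1 G2]; split;
    try congruence; auto.
  all: intros d; exact (IH _ _ _ (F2 d) (G2 d)).
Qed.

Lemma agr_S n p f g : agr (S n) p f g -> agr n p f g.
Proof.
  revert f g; induction n as [|n IH]; intros f g [H1 H2]; split; auto.
  all: intros d; apply IH, H2.
Qed.

Lemma agr_loc2 n p f f' g g' :
  locally p (fun q => f q = f' q) -> locally p (fun q => g q = g' q) ->
  agr n p f' g' -> agr n p f g.
Proof.
  intros Hf Hg H; apply (agr_trans n p f f'); [apply agr_loc, Hf|].
  apply (agr_trans n p f' g'); [exact H|]; apply agr_sym, agr_loc, Hg.
Qed.

Lemma agr_pd n p f g i j k :
  agr n p f g -> (i + j + k <= n)%nat -> pd i j k f p = pd i j k g p.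
Proof.
  revert f g i j k; induction n as [|n IH]; intros f g i j k [H1 H2] Hn.
  - destruct i, j, k; try lia; exact H1.
  - destruct k as [|k].
    + destruct j as [|j].
      * destruct i as [|i]; [exact H1|].
        assert (E : forall f, pd (S i) 0 0 f = pd i 0 0 (pdd Du f)).
        { intros f0; unfold pd; now rewrite Nat.iter_succ_r. }
        rewrite !E; apply IH; [apply H2|lia].
      * assert (E : forall f, pd i (S j) 0 f = pd i j 0 (pdd Dx f)).
        { intros f0; unfold pd; now rewrite Nat.iter_succ_r. }
        rewrite !E; apply IH; [apply H2|lia].
    + assert (E : forall f, pd i j (S k) f = pd i j k (pdd Dv f)).
      { intros f0; unfold pd; now rewrite Nat.iter_succ_r. }
      rewrite !E; apply IH; [apply H2|lia].
Qed.

Lemma pd_agr n p f g :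
  smooth_at p f -> smooth_at p g ->
  (forall i j k, (i + j + k <= n)%nat -> pd i j k f p = pd i j k g p) -> agr n p f g.
Proof.
  revert f g; induction n as [|n IH]; intros f g Hf Hg H; split.
  - apply (H O O O); lia.
  - exact I.
  - apply (H O O O); lia.
  - intros d; apply IH; try (apply smooth_at_pdd; assumption).
    intros i j k Hn; rewrite !pd_pdd by assumption; apply H; destruct d; cbn; lia.
Qed.

(** Equality of n-jets, with smoothness carried along so that the rules of calculus apply at each
    step. Later computations with Taylor series take place in this relation. *)
Definition sim (n : nat) (p : point) (f g : point -> R) : Prop :=
  smooth_at p f /\ smooth_at p g /\ agr n p f g.

Lemma sim_refl n p f : smooth_at p f -> sim n p f f.
Proof. intros H; repeat split; auto; apply agr_refl. Qed.

Lemma sim_sym n p f g : sim n p f g -> sim n p g f.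
Proof. intros (H1 & H2 & H3); repeat split; auto; apply agr_sym, H3. Qed.

Lemma sim_trans n p f g h : sim n p f g -> sim n p g h -> sim n p f h.
Proof.
  intros (H1 & H2 & H3) (H4 & H5 & H6); repeat split; auto.
  apply (agr_trans n p f g h); assumption.
Qed.

Lemma sim_val n p f g : sim n p f g -> f p = g p.
Proof. intros (_ & _ & H); exact (agr_val _ _ _ _ H). Qed.

Lemma sim_S n p f g : sim (S n) p f g -> sim n p f g.
Proof. intros (H1 & H2 & H3); repeat split; auto; apply agr_S, H3. Qed.

Lemma sim_pdd n p f g d : sim (S n) p f g -> sim n p (pdd d f) (pdd d g).
Proof.
  intros (H1 & H2 & H3); repeat split; try (apply smooth_at_pdd; assumption); apply H3.
Qed.

Lemma sim_loc n p f g :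
  smooth_at p f -> locally p (fun q => f q = g q) -> sim n p f g.
Proof.
  intros Hf H; repeat split; [exact Hf|apply (smooth_at_ext p f); assumption|].
  apply agr_loc, H.
Qed.

Lemma pdd_plus_loc p f g d :
  smooth_at p f -> smooth_at p g ->
  locally p (fun q => pdd d (fun r => f r + g r) q = pdd d f q + pdd d g q).
Proof.
  intros Hf Hg; generalize (filter_and _ _ (smooth_at_loc p f Hf) (smooth_at_loc p g Hg)).
  apply filter_imp; intros q [H1 H2]; apply pdd_plus; assumption.
Qed.

Lemma pdd_mult_loc p f g d :
  smooth_at p f -> smooth_at p g ->
  locally p (fun q => pdd d (fun r => f r * g r) q = pdd d f q * g q + f q * pdd d g q).
Proof.
  intros Hf Hg; generalize (filter_and _ _ (smooth_at_loc p f Hf) (smooth_at_loc p g Hg)).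
  apply filter_imp; intros q [H1 H2]; apply pdd_mult; assumption.
Qed.

Lemma sim_plus n p f f' g g' :
  sim n p f f' -> sim n p g g' -> sim n p (fun q => f q + g q) (fun q => f' q + g' q).
Proof.
  intros (F1 & F2 & F3) (G1 & G2 & G3).
  repeat split; try (apply smooth_at_plus; assumption).
  revert f f' g g' F1 F2 F3 G1 G2 G3; induction n as [|n IH];
    intros f f' g g' F1 F2 [F3 F4] G1 G2 [G3 G4]; split; try congruence; auto.
  intros d; eapply agr_loc2; [apply pdd_plus_loc; assumption|apply pdd_plus_loc; assumption|].
  apply IH; try (apply smooth_at_pdd; assumption); auto.
Qed.

Lemma sim_mult n p f f' g g' :
  sim n p f f' -> sim n p g g' -> sim n p (fun q => f q * g q) (fun q => f' q * g' q).
Proof.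
  revert f f' g g'; induction n as [|n IH]; intros f f' g g' HF HG;
    assert (HF' := HF); assert (HG' := HG);
    destruct HF' as (F1 & F2 & [F3 F4]), HG' as (G1 & G2 & [G3 G4]).
  - repeat split; try (apply smooth_at_mult; assumption); cbn; congruence.
  - repeat split; try (apply smooth_at_mult; assumption); [congruence|].
    intros d; eapply agr_loc2;
      [apply pdd_mult_loc; assumption|apply pdd_mult_loc; assumption|].
    apply (sim_plus n p (fun q => pdd d f q * g q) (fun q => pdd d f' q * g' q)
             (fun q => f q * pdd d g q) (fun q => f' q * pdd d g' q)).
    + apply IH; [apply sim_pdd, HF|apply sim_S, HG].
    + apply IH; [apply sim_S, HF|apply sim_pdd, HG].
Qed.

Lemma sim_const n p c : sim n p (fun _ => c) (fun _ => c).
Proof. apply sim_refl, smooth_at_const. Qed.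

Lemma sim_opp n p f f' : sim n p f f' -> sim n p (fun q => - f q) (fun q => - f' q).
Proof.
  intros H; assert (H' := sim_mult n p _ _ _ _ (sim_const n p (-1)) H).
  destruct H as (F1 & F2 & _), H' as (_ & _ & H3).
  repeat split; try (apply smooth_at_opp; assumption).
  eapply agr_loc2; [| |exact H3]; apply filter_forall; intros; ring.
Qed.

Lemma sim_minus n p f f' g g' :
  sim n p f f' -> sim n p g g' -> sim n p (fun q => f q - g q) (fun q => f' q - g' q).
Proof. intros H1 H2; apply sim_plus; [exact H1|apply sim_opp, H2]. Qed.

Lemma sim_pow n p f f' m : sim n p f f' -> sim n p (fun q => f q ^ m) (fun q => f' q ^ m).
Proof.
  intros H; induction m as [|m IH]; cbn; [apply sim_const|].
  apply (sim_mult n p f f' (fun q => f q ^ m) (fun q => f' q ^ m)); assumption.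
Qed.

Lemma map_smooth_at_loc p phi :
  map_smooth_at p phi -> locally p (fun q => map_smooth_at q phi).
Proof.
  intros H; generalize (filter_and _ _ (smooth_at_loc _ _ (H Du))
    (filter_and _ _ (smooth_at_loc _ _ (H Dx)) (smooth_at_loc _ _ (H Dv)))).
  apply filter_imp; intros q (H1 & H2 & H3) []; assumption.
Qed.

Lemma pdd_comp_loc p phi f d :
  map_smooth_at p phi -> smooth_at (phi p) f ->
  locally p (fun r => pdd d (fun q => f (phi q)) r =
    pd_u f (phi r) * pdd d (fun q => pu (phi q)) r +
    pd_x f (phi r) * pdd d (fun q => px (phi q)) r +
    pd_v f (phi r) * pdd d (fun q => pv (phi q)) r).
Proof.
  intros Hphi Hf.
  assert (Hc : locally p (fun r => smooth_at (phi r) f)).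
  { exact (map_smooth_continuous p phi Hphi _ (smooth_at_loc _ _ Hf)). }
  generalize (filter_and _ _ Hc (map_smooth_at_loc p phi Hphi)).
  apply filter_imp; intros r [H1 H2]; apply pdd_comp; assumption.
Qed.

(** The n-jet of a composite depends only on the n-jets of its parts: one application of the chain
    rule lowers n in every factor. *)
Lemma sim_comp n p phi psi f g :
  (forall d, sim n p (fun q => co d (phi q)) (fun q => co d (psi q))) ->
  sim n (phi p) f g ->
  sim n p (fun q => f (phi q)) (fun q => g (psi q)).
Proof.
  revert f g; induction n as [|n IH]; intros f g Hphi Hf;
    assert (E : phi p = psi p) by (apply co_ext; intros d; exact (sim_val _ _ _ _ (Hphi d)));
    assert (M1 : map_smooth_at p phi) by (intros d; apply Hphi);
    assert (M2 : map_smooth_at p psi) by (intros d; apply Hphi);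
    assert (Hf' := Hf); destruct Hf' as (F1 & F2 & [F3 F4]);
    assert (F2' : smooth_at (psi p) g) by (rewrite <- E; exact F2).
  - repeat split; try (apply smooth_at_comp; assumption); rewrite <- E; exact F3.
  - repeat split; try (apply smooth_at_comp; assumption); [rewrite <- E; exact F3|].
    intros d; eapply agr_loc2;
      [apply pdd_comp_loc; assumption|apply pdd_comp_loc; assumption|].
    assert (H : forall e, sim n p
      (fun r => pdd e f (phi r) * pdd d (fun q => co e (phi q)) r)
      (fun r => pdd e g (psi r) * pdd d (fun q => co e (psi q)) r)).
    { intros e; apply sim_mult.
      - apply IH; [intros a; apply sim_S, Hphi|apply sim_pdd, Hf].
      - apply sim_pdd, Hphi. }
    apply (sim_plus n p _ _ _ _ (sim_plus n p _ _ _ _ (H Du) (H Dx)) (H Dv)).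
Qed.

(** Inversion is composition with the fixed function [/ pu], so the chain rule spares an induction
    of its own. *)
Lemma sim_inv n p f f' :
  sim n p f f' -> f p <> 0 -> sim n p (fun q => / f q) (fun q => / f' q).
Proof.
  intros H H0.
  apply (sim_comp n p (fun q => (f q, 0, 0)) (fun q => (f' q, 0, 0)) (fun q => / pu q)
           (fun q => / pu q)).
  - intros []; [exact H|exact (sim_const n p 0)|exact (sim_const n p 0)].
  - apply sim_refl, smooth_at_inv; [apply smooth_at_pu|exact H0].
Qed.

Lemma sim_div n p f f' g g' :
  sim n p f f' -> sim n p g g' -> g p <> 0 ->
  sim n p (fun q => f q / g q) (fun q => f' q / g' q).
Proof.
  intros H1 H2 H0; apply (sim_mult n p f f' (fun q => / g q) (fun q => / g' q));
    [exact H1|apply sim_inv; assumption].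
Qed.

Ltac sim_tac nz :=
  repeat first [assumption | apply sim_const | apply sim_minus | apply sim_plus | apply sim_opp
    | apply sim_div; [| |first [exact nz | apply pow_nonzero; exact nz]]
    | apply sim_inv; [|exact nz] | apply sim_pow | apply sim_mult].

(** ** Restriction to coordinate subspaces *)

(** Composition with [frzX v0] restricts a function to the surface v = v0 and extends it
    independently of v; [frzU] does the same for a curve x, v = const. Functions of (u, x) or of u
    alone thus remain functions on R^3. *)
Definition frzX (v0 : R) (p : point) : point := (pu p, px p, v0).
Definition frzU (x0 v0 : R) (p : point) : point := (pu p, x0, v0).

Lemma map_smooth_frzX v0 p : map_smooth_at p (frzX v0).
Proof.
  apply map_smooth_at_mk; [apply smooth_at_pu|apply smooth_at_px|apply smooth_at_const].
Qed.

Lemma map_smooth_frzU x0 v0 p : map_smooth_at p (frzU x0 v0).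
Proof.
  apply map_smooth_at_mk; [apply smooth_at_pu|apply smooth_at_const|apply smooth_at_const].
Qed.

Lemma itd_frzX d n v0 f :
  d <> Dv -> itd d n (fun q => f (frzX v0 q)) = fun q => itd d n f (frzX v0 q).
Proof.
  intros Hd; induction n as [|n IH]; [reflexivity|].
  change (pdd d (itd d n (fun q => f (frzX v0 q))) = fun q => pdd d (itd d n f) (frzX v0 q)).
  rewrite IH; destruct d; [reflexivity|reflexivity|contradiction].
Qed.

Lemma pd_frzX v0 f i j : pd i j 0 (fun q => f (frzX v0 q)) = fun q => pd i j 0 f (frzX v0 q).
Proof.
  change (itd Du i (itd Dx j (fun q => f (frzX v0 q))) =
    fun q => itd Du i (itd Dx j f) (frzX v0 q)).
  rewrite !itd_frzX by discriminate; reflexivity.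
Qed.

Lemma pd_const i j k : pd i j k (fun _ => 0) = fun _ => 0.
Proof.
  rewrite pd_itd.
  assert (H : forall d n, itd d n (fun _ => 0) = fun _ => 0).
  { intros d n; induction n as [|n IH]; [reflexivity|].
    change (pdd d (itd d n (fun _ => 0)) = fun _ => 0); rewrite IH; apply pdd_const. }
  rewrite !H; reflexivity.
Qed.

Lemma pd_v_frzX v0 f : pd_v (fun q => f (frzX v0 q)) = fun _ => 0.
Proof. fext p; apply (Derive_const (f (frzX v0 p))). Qed.

Lemma pd_Sv i j k f : pd i j (S k) f = pd i j k (pd_v f).
Proof. unfold pd; now rewrite Nat.iter_succ_r. Qed.

Lemma pd_frzX_v v0 f i j k : pd i j (S k) (fun q => f (frzX v0 q)) = fun _ => 0.
Proof. rewrite pd_Sv, pd_v_frzX; apply pd_const. Qed.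

Lemma pd_frzU x0 v0 f i :
  pd i 0 0 (fun q => f (frzU x0 v0 q)) = fun q => pd i 0 0 f (frzU x0 v0 q).
Proof.
  change (itd Du i (fun q => f (frzU x0 v0 q)) = fun q => itd Du i f (frzU x0 v0 q)).
  induction i as [|i IH]; [reflexivity|].
  change (pdd Du (itd Du i (fun q => f (frzU x0 v0 q))) =
    fun q => pdd Du (itd Du i f) (frzU x0 v0 q)).
  rewrite IH; reflexivity.
Qed.

Lemma pd_frzU_v x0 v0 f i j k :
  (0 < j + k)%nat -> pd i j k (fun q => f (frzU x0 v0 q)) = fun _ => 0.
Proof.
  intros H; destruct k as [|k].
  - destruct j as [|j]; [lia|].
    assert (E : forall g, pd i (S j) 0 g = pd i j 0 (pd_x g)).
    { intros g; unfold pd; now rewrite Nat.iter_succ_r. }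
    rewrite E; replace (pd_x (fun q => f (frzU x0 v0 q))) with (fun _ : point => 0).
    + apply pd_const.
    + symmetry; fext p; apply (Derive_const (f (frzU x0 v0 p))).
  - rewrite pd_Sv; replace (pd_v (fun q => f (frzU x0 v0 q))) with (fun _ : point => 0).
    + apply pd_const.
    + symmetry; fext p; apply (Derive_const (f (frzU x0 v0 p))).
Qed.

Lemma frzX_self p : frzX (pv p) p = p.
Proof. destruct p as [[? ?] ?]; reflexivity. Qed.

Lemma frzU_self p : frzU (px p) (pv p) p = p.
Proof. destruct p as [[? ?] ?]; reflexivity. Qed.

Lemma smooth_at_frzX p f : smooth_at p f -> smooth_at p (fun q => f (frzX (pv p) q)).
Proof.
  intros H; apply smooth_at_comp; [apply map_smooth_frzX|rewrite frzX_self; exact H].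
Qed.

Lemma smooth_at_frzU p f : smooth_at p f -> smooth_at p (fun q => f (frzU (px p) (pv p) q)).
Proof.
  intros H; apply smooth_at_comp; [apply map_smooth_frzU|rewrite frzU_self; exact H].
Qed.

Lemma sim_frzX n p f g :
  smooth_at p f -> smooth_at p g ->
  (forall i j, (i + j <= n)%nat -> pd i j 0 f p = pd i j 0 g p) ->
  sim n p (fun q => f (frzX (pv p) q)) (fun q => g (frzX (pv p) q)).
Proof.
  intros Hf Hg H; assert (Sf := smooth_at_frzX p f Hf); assert (Sg := smooth_at_frzX p g Hg).
  repeat split; auto; apply pd_agr; auto.
  intros i j k Hn; destruct k as [|k].
  - rewrite !pd_frzX, !frzX_self; apply H; lia.
  - rewrite !pd_frzX_v; reflexivity.
Qed.

Lemma sim_frzU n p f g :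
  smooth_at p f -> smooth_at p g ->
  (forall i, (i <= n)%nat -> pd i 0 0 f p = pd i 0 0 g p) ->
  sim n p (fun q => f (frzU (px p) (pv p) q)) (fun q => g (frzU (px p) (pv p) q)).
Proof.
  intros Hf Hg H; assert (Sf := smooth_at_frzU p f Hf); assert (Sg := smooth_at_frzU p g Hg).
  repeat split; auto; apply pd_agr; auto.
  intros i j k Hn; destruct (Nat.eq_dec (j + k) 0) as [E | E].
  - replace j with O by lia; replace k with O by lia.
    rewrite !pd_frzU, !frzU_self; apply H; lia.
  - rewrite !pd_frzU_v by lia; reflexivity.
Qed.

Lemma sim_frzX_pd n p f g i j :
  sim n p (fun q => f (frzX (pv p) q)) (fun q => g (frzX (pv p) q)) ->
  (i + j <= n)%nat -> pd i j 0 f p = pd i j 0 g p.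
Proof.
  intros (_ & _ & H) Hn; generalize (agr_pd n p _ _ i j 0 H ltac:(lia)).
  rewrite !pd_frzX, !frzX_self; auto.
Qed.

Lemma sim_frzU_pd n p f g i :
  sim n p (fun q => f (frzU (px p) (pv p) q)) (fun q => g (frzU (px p) (pv p) q)) ->
  (i <= n)%nat -> pd i 0 0 f p = pd i 0 0 g p.
Proof.
  intros (_ & _ & H) Hn; generalize (agr_pd n p _ _ i 0 0 H ltac:(lia)).
  rewrite !pd_frzU, !frzU_self; auto.
Qed.

(** ** Contractive operators on families of Taylor tables *)

Definition table : Type := nat -> nat -> nat -> R.

Definition tabeq (n : nat) (T T' : nat -> table) : Prop :=
  forall m i j k, (i + j + k < n)%nat -> T m i j k = T' m i j k.

(** Banach's theorem for the ultrametric in which tables agreeing below order n have distance at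
    most 2^-n; along the iteration each entry becomes constant. *)
Lemma table_fixpoint (Phi : (nat -> table) -> nat -> table) :
  (forall n T T', tabeq n T T' -> tabeq (S n) (Phi T) (Phi T')) ->
  exists T, forall m i j k, T m i j k = Phi T m i j k.
Proof.
  intros HPhi.
  set (A := fun n => Nat.iter n Phi (fun _ _ _ _ => 0)).
  assert (HA : forall n, tabeq n (A n) (A (S n))).
  { induction n as [|n IH]; [intros m i j k H; lia|]; exact (HPhi _ _ _ IH). }
  assert (HA' : forall n d, tabeq n (A n) (A (n + d)%nat)).
  { intros n d; induction d as [|d IH]; [rewrite Nat.add_0_r; intros m i j k _; reflexivity|].
    intros m i j k H; rewrite (IH m i j k H), Nat.add_succ_r; apply HA; lia. }
  (* An entry of order d is read off from iterate d + 1, from which on it no longer changes. *)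
  set (T := fun m i j k => A (S (i + j + k)) m i j k).
  assert (HT : forall n, tabeq n T (A n)).
  { intros n m i j k H; unfold T.
    replace n with (S (i + j + k) + (n - S (i + j + k)))%nat by lia.
    apply HA'; lia. }
  exists T; intros m i j k.
  transitivity (A (S (i + j + k)) m i j k); [reflexivity|].
  symmetry; apply (HPhi (i + j + k)%nat T (A (i + j + k)%nat)); [apply HT|lia].
Qed.

(** * Borel's lemma *)

Definition smooth (f : point -> R) : Prop := forall p, smooth_at p f.

Lemma smooth_pdd d f : smooth f -> smooth (pdd d f).
Proof. intros H p; apply smooth_at_pdd, H. Qed.

Lemma smooth_plus f g : smooth f -> smooth g -> smooth (fun q => f q + g q).
Proof. intros H1 H2 p; apply smooth_at_plus; auto. Qed.

Lemma smooth_mult f g : smooth f -> smooth g -> smooth (fun q => f q * g q).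
Proof. intros H1 H2 p; apply smooth_at_mult; auto. Qed.

Lemma smooth_const c : smooth (fun _ => c).
Proof. intros p; apply smooth_at_const. Qed.

Lemma pdd_plus_fun d f g :
  smooth f -> smooth g -> pdd d (fun q => f q + g q) = fun q => pdd d f q + pdd d g q.
Proof. intros; fext p; apply pdd_plus; auto. Qed.

Lemma pdd_mult_fun d f g :
  smooth f -> smooth g ->
  pdd d (fun q => f q * g q) = fun q => pdd d f q * g q + f q * pdd d g q.
Proof. intros; fext p; apply pdd_mult; auto. Qed.

Lemma pdd_scal_fun d c f : smooth f -> pdd d (fun q => c * f q) = fun q => c * pdd d f q.
Proof.
  intros H; rewrite (pdd_mult_fun d (fun _ => c) f) by (auto; apply smooth_const).
  rewrite pdd_const; fext p; ring.
Qed.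

Lemma smooth_itd d n f : smooth f -> smooth (itd d n f).
Proof. intros H p; apply smooth_at_itd, H. Qed.

Lemma itd_S d n f : itd d (S n) f = pdd d (itd d n f).
Proof. reflexivity. Qed.

Lemma itd_plus_fun d n f g :
  smooth f -> smooth g -> itd d n (fun q => f q + g q) = fun q => itd d n f q + itd d n g q.
Proof.
  intros Hf Hg; induction n as [|n IH]; [reflexivity|].
  rewrite itd_S, IH; apply pdd_plus_fun; apply smooth_itd; assumption.
Qed.

Lemma pd_plus i j k f g :
  smooth f -> smooth g ->
  pd i j k (fun q => f q + g q) = fun q => pd i j k f q + pd i j k g q.
Proof.
  intros Hf Hg; rewrite !pd_itd, !itd_plus_fun by (repeat apply smooth_itd; assumption).
  reflexivity.
Qed.

Lemma itd_scal_fun d n c f : smooth f -> itd d n (fun q => c * f q) = fun q => c * itd d n f q.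
Proof.
  intros Hf; induction n as [|n IH]; [reflexivity|].
  rewrite itd_S, IH; apply pdd_scal_fun, smooth_itd, Hf.
Qed.

Lemma pd_scal i j k c f :
  smooth f -> pd i j k (fun q => c * f q) = fun q => c * pd i j k f q.
Proof.
  intros Hf; rewrite !pd_itd, !itd_scal_fun by (repeat apply smooth_itd; assumption).
  reflexivity.
Qed.

(** The bounds hold on all of R^3, which makes the convergence in Borel's lemma uniform
    everywhere. *)
Fixpoint bd (n : nat) (f : point -> R) : Prop :=
  (exists M, forall p, Rabs (f p) <= M) /\
  match n with O => True | S m => forall d, bd m (pdd d f) end.

Lemma bd_S n f : bd (S n) f -> bd n f.
Proof.
  revert f; induction n as [|n IH]; intros f [H1 H2]; split; auto.
  all: intros d; apply IH, H2.
Qed.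

Lemma bd_plus n f g : smooth f -> smooth g -> bd n f -> bd n g -> bd n (fun q => f q + g q).
Proof.
  revert f g; induction n as [|n IH]; intros f g Sf Sg [[M HM] Hf] [[N HN] Hg]; split; auto.
  - exists (M + N); intros p; eapply Rle_trans; [apply Rabs_triang|].
    generalize (HM p) (HN p); lra.
  - exists (M + N); intros p; eapply Rle_trans; [apply Rabs_triang|].
    generalize (HM p) (HN p); lra.
  - intros d; rewrite pdd_plus_fun by assumption; apply IH; auto using smooth_pdd.
Qed.

Lemma bd_mult n f g : smooth f -> smooth g -> bd n f -> bd n g -> bd n (fun q => f q * g q).
Proof.
  revert f g; induction n as [|n IH]; intros f g Sf Sg Hf Hg.
  - destruct Hf as [[M HM] _], Hg as [[N HN] _]; split; [|exact I].
    exists (M * N); intros p; rewrite Rabs_mult.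
    apply Rmult_le_compat; auto using Rabs_pos.
  - assert (Hf' := bd_S _ _ Hf); assert (Hg' := bd_S _ _ Hg).
    destruct Hf as [[M HM] Hf], Hg as [[N HN] Hg]; split.
    + exists (M * N); intros p; rewrite Rabs_mult.
      apply Rmult_le_compat; auto using Rabs_pos.
    + intros d; rewrite pdd_mult_fun by assumption.
      apply bd_plus; try apply smooth_mult; auto using smooth_pdd.
Qed.

Lemma bd_const n c : bd n (fun _ => c).
Proof.
  revert c; induction n as [|n IH]; intros c; split; auto;
    try (exists (Rabs c); intros; lra).
  intros d; rewrite pdd_const; apply IH.
Qed.

Lemma bd_uniform n f :
  bd n f -> exists M, forall i j k p, (i + j + k <= n)%nat -> Rabs (pd i j k f p) <= M.
Proof.
  revert f; induction n as [|n IH]; intros f [[M HM] Hf].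
  - exists M; intros i j k p H; destruct i, j, k; try lia; apply HM.
  - destruct (IH _ (Hf Du)) as [Mu Hu], (IH _ (Hf Dx)) as [Mx Hx], (IH _ (Hf Dv)) as [Mv Hv].
    exists (Rmax (Rmax M Mu) (Rmax Mx Mv)); intros i j k p H.
    assert (B1 := Rmax_l (Rmax M Mu) (Rmax Mx Mv)); assert (B2 := Rmax_r (Rmax M Mu) (Rmax Mx Mv)).
    assert (B3 := Rmax_l M Mu); assert (B4 := Rmax_r M Mu).
    assert (B5 := Rmax_l Mx Mv); assert (B6 := Rmax_r Mx Mv).
    destruct k as [|k]; [destruct j as [|j]; [destruct i as [|i]|]|].
    + generalize (HM p); cbn; lra.
    + assert (E : pd (S i) 0 0 f = pd i 0 0 (pdd Du f)) by (unfold pd; now rewrite Nat.iter_succ_r).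
      rewrite E; generalize (Hu i O O p ltac:(lia)); lra.
    + assert (E : pd i (S j) 0 f = pd i j 0 (pdd Dx f)) by (unfold pd; now rewrite Nat.iter_succ_r).
      rewrite E; generalize (Hx i j O p ltac:(lia)); lra.
    + rewrite pd_Sv; generalize (Hv i j k p ltac:(lia)); cbn; lra.
Qed.

(** * Products of powers of sines *)

Lemma pdd_sin d e :
  pdd d (fun p => sin (co e p)) = fun p => (if dir_eq_dec d e then 1 else 0) * cos (co e p).
Proof.
  fext p; apply pdd_eq.
  destruct (dir_eq_dec d e) as [<- | Hne].
  - apply is_derive_ext with (f := sin); [intros; now rewrite co_up_same|].
    rewrite Rmult_1_l; apply is_derive_sin.
  - apply is_derive_ext with (f := fun t => sin (co e p));
      [intros; now rewrite co_up_other|].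
    rewrite Rmult_0_l; apply @is_derive_const.
Qed.

Lemma pdd_cos d e :
  pdd d (fun p => cos (co e p)) = fun p => (if dir_eq_dec d e then -1 else 0) * sin (co e p).
Proof.
  fext p; apply pdd_eq.
  destruct (dir_eq_dec d e) as [<- | Hne].
  - apply is_derive_ext with (f := cos); [intros; now rewrite co_up_same|].
    replace (-1 * _) with (- sin (co d p)) by ring; apply is_derive_cos.
  - apply is_derive_ext with (f := fun t => cos (co e p));
      [intros; now rewrite co_up_other|].
    rewrite Rmult_0_l; apply @is_derive_const.
Qed.

Lemma smooth_sin_cos e : smooth (fun p => sin (co e p)) /\ smooth (fun p => cos (co e p)).
Proof.
  assert (H : forall n, Ck n (fun _ => True) (fun p => sin (co e p)) /\
                        Ck n (fun _ => True) (fun p => cos (co e p))).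
  { assert (HT : open (fun _ : point => True)) by apply open_true.
    induction n as [|n [IH1 IH2]].
    - split; intros p _.
      + apply (continuous_comp (co e) sin); [apply continuous_co|apply continuous_sin].
      + apply (continuous_comp (co e) cos); [apply continuous_co|apply continuous_cos].
    - split; apply Ck_S; split; intros d.
      + intros p _; destruct (dir_eq_dec d e) as [<- | Hne].
        * apply ex_derive_ext with (f := sin); [intros; now rewrite co_up_same|].
          eexists; apply is_derive_sin.
        * apply ex_derive_ext with (f := fun t => sin (co e p));
            [intros; now rewrite co_up_other|]; apply @ex_derive_const.
      + rewrite pdd_sin; apply (Ck_mult n _ _ _ HT); [apply smooth_on_const|exact IH2].
      + intros p _; destruct (dir_eq_dec d e) as [<- | Hne].
        * apply ex_derive_ext with (f := cos); [intros; now rewrite co_up_same|].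
          eexists; apply is_derive_cos.
        * apply ex_derive_ext with (f := fun t => cos (co e p));
            [intros; now rewrite co_up_other|]; apply @ex_derive_const.
      + rewrite pdd_cos; apply (Ck_mult n _ _ _ HT); [apply smooth_on_const|exact IH1]. }
  split; intros p; exists (fun _ => True); repeat split; try apply open_true; intros n; apply H.
Qed.

Lemma bd_sin_cos n e : bd n (fun p => sin (co e p)) /\ bd n (fun p => cos (co e p)).
Proof.
  destruct (smooth_sin_cos e) as [S1 S2].
  induction n as [|n [IH1 IH2]].
  - split; (split; [|exact I]); exists 1; intros p; apply Rabs_le;
      [apply SIN_bound|apply COS_bound].
  - split; split.
    + exists 1; intros p; apply Rabs_le, SIN_bound.
    + intros d; rewrite pdd_sin; apply bd_mult; auto using smooth_const, bd_const.
    + exists 1; intros p; apply Rabs_le, COS_bound.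
    + intros d; rewrite pdd_cos; apply bd_mult; auto using smooth_const, bd_const.
Qed.

(* Powers of sines replace the monomials: their derivatives are bounded on all
   of R^3, so that no cut-off function is needed. *)
Definition spow (e : dir) (a : nat) (p : point) : R := sin (co e p) ^ a.

Lemma smooth_spow e a : smooth (spow e a).
Proof. intros p; apply smooth_at_pow, (proj1 (smooth_sin_cos e)). Qed.

Lemma bd_spow n e a : bd n (spow e a).
Proof.
  induction a as [|a IH]; unfold spow; cbn; [apply bd_const|].
  apply bd_mult; [apply smooth_sin_cos|apply (smooth_spow e a)|apply bd_sin_cos|exact IH].
Qed.

Lemma pdd_spow d e a :
  pdd d (spow e (S a)) =
  fun p => (if dir_eq_dec d e then 1 else 0) * (INR (S a) * (spow e a p * cos (co e p))).
Proof.
  destruct (smooth_sin_cos e) as [S1 S2].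
  fext p; induction a as [|a IH].
  - unfold spow; cbn [pow INR].
    rewrite (pdd_mult_fun d _ (fun _ => 1)) by auto using smooth_const.
    rewrite pdd_sin, pdd_const; ring.
  - change (spow e (S (S a))) with (fun q => sin (co e q) * spow e (S a) q).
    rewrite (pdd_mult_fun d _ (spow e (S a))) by (auto using smooth_spow).
    rewrite IH, pdd_sin, (S_INR (S a)); unfold spow; cbn [pow]; ring.
Qed.

Lemma pdd_spow_other d e a : d <> e -> pdd d (spow e a) = fun _ => 0.
Proof.
  intros Hne; destruct a as [|a]; [apply pdd_const|].
  rewrite pdd_spow; fext p.
  destruct (dir_eq_dec d e); [contradiction|ring].
Qed.

(* With an arbitrary smooth factor [g] the induction on [a] goes through. *)
Lemma itd_spow d a g p m :
  smooth g -> co d p = 0 -> (m <= a)%nat ->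
  itd d m (fun q => spow d a q * g q) p = if Nat.eq_dec m a then INR (fact a) * g p else 0.
Proof.
  revert a g; induction m as [|m IH]; intros a g Hg Hp Hm.
  - destruct a as [|a]; cbn.
    + unfold spow; cbn; ring.
    + unfold spow; rewrite Hp, sin_0; cbn; ring.
  - destruct a as [|a]; [lia|].
    destruct (smooth_sin_cos d) as [S1 S2].
    assert (E : itd d (S m) (fun q => spow d (S a) q * g q) =
      itd d m (fun q => spow d a q *
        (INR (S a) * cos (co d q) * g q + sin (co d q) * pdd d g q))).
    { unfold itd; rewrite Nat.iter_succ_r; f_equal.
      rewrite (pdd_mult_fun d (spow d (S a)) g) by (auto using smooth_spow).
      rewrite pdd_spow; fext q.
      destruct (dir_eq_dec d d) as [_ | Hn]; [|contradiction].
      unfold spow; cbn [pow]; ring. }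
    rewrite E, IH; [|apply smooth_plus|exact Hp|lia].
    + destruct (Nat.eq_dec m a) as [Ea | Ea], (Nat.eq_dec (S m) (S a)); try lia; [|reflexivity].
      rewrite Hp, sin_0, cos_0, fact_simpl, mult_INR; ring.
    + apply smooth_mult; [apply (smooth_mult (fun _ => INR (S a)))|];
        auto using smooth_const.
    + apply smooth_mult; auto using smooth_pdd.
Qed.

Lemma itd_mult_indep d n f g :
  smooth f -> smooth g -> pdd d g = (fun _ => 0) ->
  itd d n (fun q => f q * g q) = fun q => itd d n f q * g q.
Proof.
  intros Hf Hg H0; induction n as [|n IH]; [reflexivity|].
  rewrite itd_S, IH, pdd_mult_fun by (auto using smooth_itd).
  rewrite H0; fext q; rewrite itd_S; ring.
Qed.

Lemma pdd_itd_spow d e a n : d <> e -> pdd d (itd e n (spow e a)) = fun _ => 0.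
Proof.
  intros Hne; fext p.
  rewrite <- itd_comm by apply smooth_spow.
  rewrite pdd_spow_other by exact Hne; clear.
  assert (H : itd e n (fun _ => 0) = fun _ => 0).
  { induction n as [|n IH]; [reflexivity|]; rewrite itd_S, IH; apply pdd_const. }
  now rewrite H.
Qed.

Definition mono (a b c : nat) (p : point) : R := spow Du a p * (spow Dx b p * spow Dv c p).

Lemma smooth_mono a b c : smooth (mono a b c).
Proof. repeat apply smooth_mult; apply smooth_spow. Qed.

Lemma bd_mono n a b c : bd n (mono a b c).
Proof. repeat apply bd_mult; try apply smooth_mult; auto using smooth_spow, bd_spow. Qed.

Lemma pd_mono i j k a b c p :
  pd i j k (mono a b c) p =
  itd Du i (spow Du a) p * (itd Dx j (spow Dx b) p * itd Dv k (spow Dv c) p).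
Proof.
  rewrite pd_itd.
  assert (E1 : itd Dv k (mono a b c) =
    fun q => itd Dv k (spow Dv c) q * (spow Du a q * spow Dx b q)).
  { rewrite <- (itd_mult_indep Dv k (spow Dv c) (fun q => spow Du a q * spow Dx b q)).
    - apply (f_equal (itd Dv k)), functional_extensionality; intros q; unfold mono; ring.
    - apply smooth_spow.
    - apply smooth_mult; apply smooth_spow.
    - rewrite pdd_mult_fun, !pdd_spow_other by (congruence || apply smooth_spow).
      fext q; ring. }
  assert (E2 : itd Dx j (itd Dv k (mono a b c)) =
    fun q => itd Dx j (spow Dx b) q * (itd Dv k (spow Dv c) q * spow Du a q)).
  { rewrite E1, <- (itd_mult_indep Dx j (spow Dx b)
      (fun q => itd Dv k (spow Dv c) q * spow Du a q)).
    - apply (f_equal (itd Dx j)), functional_extensionality; intros q; ring.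
    - apply smooth_spow.
    - apply smooth_mult; [apply smooth_itd|]; apply smooth_spow.
    - rewrite pdd_mult_fun, pdd_itd_spow, pdd_spow_other
        by (congruence || (try apply smooth_itd; apply smooth_spow)).
      fext q; ring. }
  rewrite E2.
  assert (E3 : itd Du i (fun q => itd Dx j (spow Dx b) q * (itd Dv k (spow Dv c) q * spow Du a q)) =
    fun q => itd Du i (spow Du a) q * (itd Dx j (spow Dx b) q * itd Dv k (spow Dv c) q)).
  { rewrite <- (itd_mult_indep Du i (spow Du a)
      (fun q => itd Dx j (spow Dx b) q * itd Dv k (spow Dv c) q)).
    - apply (f_equal (itd Du i)), functional_extensionality; intros q; ring.
    - apply smooth_spow.
    - apply smooth_mult; apply smooth_itd; apply smooth_spow.
    - rewrite pdd_mult_fun, !pdd_itd_spow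
        by (congruence || (try apply smooth_itd; apply smooth_spow)).
      fext q; ring. }
  rewrite E3; reflexivity.
Qed.

Lemma itd_spow0 d a m p :
  co d p = 0 -> (m <= a)%nat ->
  itd d m (spow d a) p = if Nat.eq_dec m a then INR (fact a) else 0.
Proof.
  intros Hp Hm; generalize (itd_spow d a (fun _ => 1) p m (smooth_const 1) Hp Hm).
  replace (fun q => spow d a q * 1) with (spow d a)
    by (fext q; ring).
  intros ->; destruct (Nat.eq_dec m a); ring.
Qed.

Definition origin : point := (0, 0, 0).

(** As sin t = t + O(t^3), the product has the leading term of a monomial; beyond its degree the
    derivatives differ, hence the bound on i + j + k. *)
Lemma pd_mono0 i j k a b c :
  (i + j + k <= a + b + c)%nat ->
  pd i j k (mono a b c) origin =
  if Nat.eq_dec i a then if Nat.eq_dec j b then if Nat.eq_dec k c then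
    INR (fact a) * (INR (fact b) * INR (fact c)) else 0 else 0 else 0.
Proof.
  intros H; rewrite pd_mono.
  (* If one index exceeds its exponent, another falls short of its own, and the corresponding factor
     vanishes at the origin. *)
  destruct (le_lt_dec i a) as [Hi | Hi];
    [|destruct (le_lt_dec j b) as [Hj | Hj]; [|]];
    [destruct (le_lt_dec j b) as [Hj | Hj];
      [destruct (le_lt_dec k c) as [Hk | Hk]|]| |].
  - rewrite !itd_spow0 by (reflexivity || assumption).
    destruct (Nat.eq_dec i a), (Nat.eq_dec j b), (Nat.eq_dec k c); ring.
  - rewrite (itd_spow0 Du a i), (itd_spow0 Dx b j) by (reflexivity || assumption).
    destruct (Nat.eq_dec i a), (Nat.eq_dec j b), (Nat.eq_dec k c); try lia; ring.
  - destruct (Nat.eq_dec i a) as [E | E].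
    + destruct (Nat.eq_dec j b); [lia|].
      rewrite (itd_spow0 Dv c k) by (reflexivity || lia).
      destruct (Nat.eq_dec k c); [lia|ring].
    + rewrite (itd_spow0 Du a i) by (reflexivity || lia).
      destruct (Nat.eq_dec i a); [contradiction|ring].
  - destruct (Nat.eq_dec i a); [lia|].
    destruct (Nat.eq_dec j b) as [E | E].
    + rewrite (itd_spow0 Dv c k) by (reflexivity || lia).
      destruct (Nat.eq_dec k c); [lia|ring].
    + rewrite (itd_spow0 Dx b j) by (reflexivity || lia).
      destruct (Nat.eq_dec j b); [contradiction|ring].
  - destruct (Nat.eq_dec i a); [lia|].
    rewrite (itd_spow0 Dv c k) by (reflexivity || lia).
    destruct (Nat.eq_dec k c); [lia|ring].
Qed.

Lemma homogeneous_jet n (c : table) :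
  exists G, smooth G /\ (forall m, bd m G) /\
    forall i j k, (i + j + k <= n)%nat ->
      pd i j k G origin = if Nat.eq_dec (i + j + k) n then c i j k else 0.
Proof.
  (* Induction over an arbitrary list of multi-indices; repetitions and entries of degree other than
     n are skipped by [Hskip]. *)
  assert (H : forall L : list (nat * nat * nat), exists G, smooth G /\ (forall m, bd m G) /\
    forall i j k, (i + j + k <= n)%nat ->
      (In (i, j, k) L -> (i + j + k = n)%nat -> pd i j k G origin = c i j k) /\
      (~ (In (i, j, k) L /\ (i + j + k = n)%nat) -> pd i j k G origin = 0)).
  { induction L as [|[[a b] e] L (G & S1 & B1 & J1)].
    - exists (fun _ => 0); repeat split; auto using smooth_const, bd_const; [intros []|].
      intros _; now rewrite pd_const.
    - assert (Hskip : (In (a, b, e) L \/ (a + b + e)%nat <> n) ->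
        exists G, smooth G /\ (forall m, bd m G) /\
        forall i j k, (i + j + k <= n)%nat ->
        (In (i, j, k) ((a, b, e) :: L) -> (i + j + k = n)%nat -> pd i j k G origin = c i j k) /\
        (~ (In (i, j, k) ((a, b, e) :: L) /\ (i + j + k = n)%nat) -> pd i j k G origin = 0)).
      { intros Hs; exists G; split; [|split]; auto; intros i j k Hn; destruct (J1 i j k Hn) as [J2 J3].
        split.
        - intros [E | Hin] En; [|auto]; injection E as -> -> ->.
          destruct Hs; [auto|contradiction].
        - intros Hno; apply J3; intros [Hin En]; apply Hno; cbn; auto. }
      destruct (excluded_middle_informative (In (a, b, e) L)) as [Hin | Hnin]; [auto|].
      destruct (Nat.eq_dec (a + b + e) n) as [En | En]; [|auto].
      (* The divisor is the derivative of [mono a b e] of multi-index (a, b, e) at the origin. *)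
      set (w := c a b e / (INR (fact a) * (INR (fact b) * INR (fact e)))).
      exists (fun p => G p + w * mono a b e p).
      assert (S2 : smooth (fun p => w * mono a b e p))
        by (apply smooth_mult; auto using smooth_const, smooth_mono).
      split; [apply smooth_plus; auto|split].
      { intros m; apply bd_plus; auto; apply bd_mult; auto using smooth_const, smooth_mono, bd_const, bd_mono. }
      intros i j k Hn; rewrite pd_plus, pd_scal by (auto using smooth_mono).
      rewrite pd_mono0 by lia; destruct (J1 i j k Hn) as [J2 J3].
      assert (Hf : forall r, INR (fact r) <> 0) by apply INR_fact_neq_0.
      split.
      + intros [E | Hin] Eijk.
        * injection E as -> -> ->.
          destruct (Nat.eq_dec i i), (Nat.eq_dec j j), (Nat.eq_dec k k); try contradiction.
          rewrite J3 by tauto; unfold w; field; auto.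
        * rewrite J2 by auto.
          destruct (Nat.eq_dec i a), (Nat.eq_dec j b), (Nat.eq_dec k e); try ring.
          subst; contradiction.
      + intros Hno; rewrite J3 by (intros [Hin Eijk]; apply Hno; cbn; auto).
        destruct (Nat.eq_dec i a), (Nat.eq_dec j b), (Nat.eq_dec k e); try ring.
        exfalso; apply Hno; subst; cbn; auto. }
  destruct (H (list_prod (list_prod (seq 0 (S n)) (seq 0 (S n))) (seq 0 (S n))))
    as (G & S1 & B1 & J1).
  exists G; split; [|split]; auto; intros i j k Hn; destruct (J1 i j k Hn) as [J2 J3].
  destruct (Nat.eq_dec (i + j + k) n) as [E | E]; [|apply J3; tauto].
  apply J2; [|exact E].
  apply in_prod; [apply in_prod|]; apply in_seq; lia.
Qed.

(** * Rescaling, to make the derivatives of lower order small *)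

Definition rescale (lam : R) (p0 p : point) : point :=
  (lam * (pu p - pu p0), lam * (px p - px p0), lam * (pv p - pv p0)).

Lemma map_smooth_rescale lam p0 p : map_smooth_at p (rescale lam p0).
Proof.
  apply map_smooth_at_mk; apply (smooth_at_mult p (fun _ => lam)), smooth_at_minus;
    first [apply smooth_at_const | apply smooth_at_pu | apply smooth_at_px | apply smooth_at_pv].
Qed.

Lemma pdd_rescale d lam p0 f :
  smooth f -> pdd d (fun q => f (rescale lam p0 q)) = fun q => lam * pdd d f (rescale lam p0 q).
Proof.
  intros Hf; fext p.
  rewrite pdd_comp by (auto using map_smooth_rescale).
  assert (E : forall e, pdd d (fun q => lam * (co e q - co e p0)) p =
    if dir_eq_dec d e then lam else 0).
  { intros e; unfold Rminus; rewrite (pdd_scal_fun d lam (fun q => co e q + - co e p0))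
      by (intros r; apply smooth_at_plus; [apply smooth_at_co|apply smooth_at_const]).
    rewrite (pdd_plus_fun d (co e) (fun _ => - co e p0))
      by (intros r; apply smooth_at_co || apply smooth_at_const).
    rewrite pdd_const, pdd_co; destruct (dir_eq_dec d e); ring. }
  change (fun q => pu (rescale lam p0 q)) with (fun q => lam * (co Du q - co Du p0)).
  change (fun q => px (rescale lam p0 q)) with (fun q => lam * (co Dx q - co Dx p0)).
  change (fun q => pv (rescale lam p0 q)) with (fun q => lam * (co Dv q - co Dv p0)).
  rewrite !E; destruct d; cbn; ring.
Qed.

Lemma smooth_rescale lam p0 f : smooth f -> smooth (fun q => f (rescale lam p0 q)).
Proof. intros Hf p; apply smooth_at_comp; [apply map_smooth_rescale|apply Hf]. Qed.

Lemma itd_rescale d n lam p0 f :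
  smooth f ->
  itd d n (fun q => f (rescale lam p0 q)) = fun q => lam ^ n * itd d n f (rescale lam p0 q).
Proof.
  intros Hf; induction n as [|n IH].
  - fext q; cbn; ring.
  - rewrite itd_S, IH, pdd_scal_fun, pdd_rescale
      by (try apply smooth_rescale; apply smooth_itd, Hf).
    fext q; rewrite itd_S; cbn [pow]; ring.
Qed.

Lemma pd_rescale i j k lam p0 f :
  smooth f ->
  pd i j k (fun q => f (rescale lam p0 q)) =
  fun q => lam ^ (i + j + k) * pd i j k f (rescale lam p0 q).
Proof.
  intros Hf; rewrite !pd_itd.
  rewrite itd_rescale, itd_scal_fun, itd_rescale, itd_scal_fun, itd_scal_fun, itd_rescale
    by (repeat first [assumption | apply smooth_rescale | apply smooth_itd
                     | apply (smooth_mult (fun _ => _)); [apply smooth_const|]]).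
  fext q; rewrite !pow_add; ring.
Qed.

Lemma rescale_self lam p0 : rescale lam p0 p0 = origin.
Proof. unfold rescale, origin; now rewrite !Rminus_diag, !Rmult_0_r. Qed.

(* Replacing [G (p)] by [G (lam p) / lam ^ n] keeps the part of degree [n] and makes
   the derivatives of order less than [n] small. *)
Lemma small_homogeneous_jet p0 n (c : table) :
  exists g, smooth g /\
    (forall i j k, (i + j + k <= n)%nat ->
      pd i j k g p0 = if Nat.eq_dec (i + j + k) n then c i j k else 0) /\
    (forall i j k, (i + j + k < n)%nat -> forall p, Rabs (pd i j k g p) <= / 2 ^ n).
Proof.
  destruct (homogeneous_jet n c) as (G & SG & BG & JG).
  destruct (bd_uniform n G (BG n)) as [M HM].
  (* A derivative of order m < n is multiplied by lam^(m - n), which is at most 1 / lam because lam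
     >= 1; the second bound makes M / lam at most 2^-n. *)
  set (lam := Rmax 1 (M * 2 ^ n)).
  assert (L1 : 1 <= lam) by apply Rmax_l.
  assert (L2 : M * 2 ^ n <= lam) by apply Rmax_r.
  assert (Hl : lam ^ n <> 0) by (apply pow_nonzero; lra).
  assert (H2 : 0 < 2 ^ n) by (apply pow_lt; lra).
  exists (fun q => / lam ^ n * G (rescale lam p0 q)).
  split; [|split].
  - apply smooth_mult; [apply smooth_const|apply smooth_rescale, SG].
  - intros i j k Hn; rewrite pd_scal, pd_rescale by (try apply smooth_rescale; exact SG).
    rewrite rescale_self, JG by exact Hn.
    destruct (Nat.eq_dec (i + j + k) n) as [-> | _]; [field; exact Hl|ring].
  - intros i j k Hn p; rewrite pd_scal, pd_rescale by (try apply smooth_rescale; exact SG).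
    assert (HMp := HM i j k (rescale lam p0 p) ltac:(lia)).
    rewrite <- Rmult_assoc, Rabs_mult.
    assert (Hpos : 0 < lam ^ (i + j + k)) by (apply pow_lt; lra).
    assert (Hle : Rabs (/ lam ^ n * lam ^ (i + j + k)) <= / lam).
    { replace n with (i + j + k + S (n - S (i + j + k)))%nat at 1 by lia.
      rewrite pow_add; cbn [pow].
      assert (H1 : 1 <= lam ^ (n - S (i + j + k))) by (apply pow_R1_Rle, L1).
      replace (/ _ * _) with (/ lam * / lam ^ (n - S (i + j + k)))
        by (field; repeat split; lra).
      rewrite Rabs_pos_eq.
      - rewrite <- (Rmult_1_r (/ lam)) at 2; apply Rmult_le_compat_l.
        + left; apply Rinv_0_lt_compat; lra.
        + rewrite <- Rinv_1; apply Rinv_le_contravar; lra.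
      - left; apply Rmult_lt_0_compat; apply Rinv_0_lt_compat; lra. }
    apply Rle_trans with (/ lam * M).
    + apply Rmult_le_compat; auto using Rabs_pos.
    + apply (Rmult_le_reg_l (lam * 2 ^ n)); [apply Rmult_lt_0_compat; lra|].
      replace (lam * 2 ^ n * (/ lam * M)) with (M * 2 ^ n) by (field; lra).
      replace (lam * 2 ^ n * / 2 ^ n) with lam by (field; lra); exact L2.
Qed.

(** ** Rapidly converging sequences of smooth functions *)

(** The estimate starts only after the order of the derivative, as [small_homogeneous_jet] provides;
    the shift m absorbs the derivatives already taken, so that [fast] passes to derived
    sequences. *)
Definition fast (m : nat) (s : nat -> point -> R) : Prop :=
  (forall n, smooth (s n)) /\
  forall i j k n p, (i + j + k + m < n)%nat ->
    Rabs (pd i j k (s (S n)) p - pd i j k (s n) p) <= / 2 ^ n.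

Definition flim (s : nat -> point -> R) (p : point) : R := Lim_seq (fun n => s n p).

Lemma fast_pdd m s d : fast m s -> fast (S m) (fun n => pdd d (s n)).
Proof.
  intros [H1 H2]; split; [intros n; apply smooth_pdd, H1|].
  intros i j k n p Hn; rewrite !pd_pdd by apply H1; apply H2; destruct d; cbn; lia.
Qed.

(** The right-hand side is the exact value of 2^-n + ... + 2^-(n + d - 1), so that the induction on
    d closes. *)
Lemma fast_tail m s n d p :
  fast m s -> (m < n)%nat -> Rabs (s (n + d)%nat p - s n p) <= 2 * / 2 ^ n - 2 * / 2 ^ (n + d).
Proof.
  intros [_ H] Hn; induction d as [|d IH].
  - rewrite Nat.add_0_r, Rminus_diag, Rabs_R0; lra.
  - assert (H' := H O O O (n + d)%nat p ltac:(lia)).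
    change (Rabs (s (S (n + d)) p - s (n + d)%nat p) <= / 2 ^ (n + d)) in H'.
    rewrite Nat.add_succ_r.
    replace (s (S (n + d)) p - s n p) with
      ((s (S (n + d)) p - s (n + d)%nat p) + (s (n + d)%nat p - s n p)) by ring.
    eapply Rle_trans; [apply Rabs_triang|].
    assert (E : 2 * / 2 ^ S (n + d) = / 2 ^ (n + d)).
    { cbn [pow]; field; apply pow_nonzero; lra. }
    rewrite E; revert H' IH; generalize (/ 2 ^ (n + d)) (/ 2 ^ n); intros; lra.
Qed.

Lemma half_pow_small (eps : posreal) : exists N, forall n, (N <= n)%nat -> 2 * / 2 ^ n < eps.
Proof.
  destruct (pow_lt_1_zero (/ 2) ltac:(rewrite Rabs_pos_eq; lra) (eps / 2)) as [N HN].
  { generalize (cond_pos eps); lra. }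
  exists N; intros n Hn; generalize (HN n Hn).
  rewrite pow_inv, Rabs_pos_eq; [lra|].
  left; apply Rinv_0_lt_compat, pow_lt; lra.
Qed.

Lemma fast_is_lim m s p : fast m s -> is_lim_seq (fun n => s n p) (flim s p).
Proof.
  intros Hs; apply Lim_seq_correct', ex_lim_seq_cauchy_corr.
  intros eps.
  assert (He : 0 < eps / 2) by (generalize (cond_pos eps); lra).
  destruct (half_pow_small (mkposreal _ He)) as [N' HN'].
  set (K' := (S m + N')%nat); exists K'; intros a b Ha Hb.
  assert (Hab : forall a, (K' <= a)%nat -> Rabs (s a p - s K' p) < eps / 2).
  { clear a b Ha Hb; intros a Ha; replace a with (K' + (a - K'))%nat by lia.
    eapply Rle_lt_trans; [apply (fast_tail m s K' _ p Hs); unfold K'; lia|].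
    assert (HK : 2 * / 2 ^ K' < eps / 2) by (apply HN'; unfold K'; lia).
    clearbody K'.
    assert (0 < / 2 ^ (K' + (a - K'))) by (apply Rinv_0_lt_compat, pow_lt; lra).
    lra. }
  replace (s a p - s b p) with ((s a p - s K' p) + - (s b p - s K' p)) by ring.
  eapply Rle_lt_trans; [apply Rabs_triang|]; rewrite Rabs_Ropp.
  generalize (Hab a Ha) (Hab b Hb); lra.
Qed.

Lemma fast_error m s n p :
  fast m s -> (m < n)%nat -> Rabs (s n p - flim s p) <= 2 * / 2 ^ n.
Proof.
  intros Hs Hn; rewrite Rabs_minus_sym.
  assert (Hl : is_lim_seq (fun d => Rabs (s (d + n)%nat p - s n p)) (Rabs (flim s p - s n p))).
  { apply (is_lim_seq_abs _ (flim s p - s n p)).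
    apply is_lim_seq_minus'; [|apply is_lim_seq_const].
    apply (is_lim_seq_incr_n (fun d => s d p)), (fast_is_lim m), Hs. }
  refine (is_lim_seq_le _ _ _ _ _ Hl (is_lim_seq_const (2 * / 2 ^ n))).
  intros d; rewrite Nat.add_comm; eapply Rle_trans; [apply (fast_tail m s n d p Hs Hn)|].
  assert (0 < / 2 ^ (n + d)) by (apply Rinv_0_lt_compat, pow_lt; lra); lra.
Qed.

Lemma fast_uniform m s (eps : posreal) :
  fast m s -> exists N, forall n p, (N <= n)%nat -> Rabs (s n p - flim s p) < eps.
Proof.
  intros Hs; destruct (half_pow_small eps) as [N HN].
  exists (S m + N)%nat; intros n p Hn.
  eapply Rle_lt_trans; [apply (fast_error m s n p Hs); lia|apply HN; lia].
Qed.

Lemma flim_continuous m s (p : point) : fast m s -> continuous (flim s) p.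
Proof.
  intros Hs Q [eps HQ].
  assert (He : 0 < eps / 3) by (generalize (cond_pos eps); lra).
  destruct (fast_uniform m s (mkposreal _ He) Hs) as [N HN]; cbn in HN.
  assert (Hc : locally p (fun q => Rabs (s N q - s N p) < eps / 3)).
  { apply (smooth_at_continuous p (s N) (proj1 Hs N p) (fun y => Rabs (y - s N p) < eps / 3)).
    exists (mkposreal _ He); intros y Hy; exact Hy. }
  revert Hc; apply (filter_imp (F := locally p)); intros q Hq; apply HQ.
  change (Rabs (flim s q - flim s p) < eps).
  replace (flim s q - flim s p) with
    (- (s N q - flim s q) + (s N q - s N p) + (s N p - flim s p)) by ring.
  eapply Rle_lt_trans; [apply Rabs_triang|].
  eapply Rle_lt_trans; [apply Rplus_le_compat_r, Rabs_triang|]; rewrite Rabs_Ropp.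
  generalize (HN N q (le_n _)) (HN N p (le_n _)); lra.
Qed.

(** Along a coordinate line both the functions and their derivatives converge uniformly, the latter
    with the shift increased by one. *)
Lemma flim_is_derive m s d p :
  fast m s ->
  is_derive (fun t => flim s (up d p t)) (co d p) (flim (fun n => pdd d (s n)) p).
Proof.
  intros Hs; assert (Hs' := fast_pdd m s d Hs).
  assert (E : forall n t, Derive (fun t0 => s n (up d p t0)) t = pdd d (s n) (up d p t)).
  { intros n t; rewrite pddE, co_up_same; apply Derive_ext; intros t0; now rewrite up_up. }
  assert (Ex : forall n t, ex_derive (fun t0 => s n (up d p t0)) t).
  { intros n t; generalize (smooth_at_ex_derive (up d p t) (s n) d (proj1 Hs n _)).
    rewrite co_up_same; apply ex_derive_ext; intros t0; now rewrite up_up. }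
  generalize (CVU_Derive (fun n t => s n (up d p t)) (fun _ => True) open_true).
  intros H.
  replace (flim (fun n => pdd d (s n)) p) with
    (real (Lim_seq (fun n => Derive (fun t => s n (up d p t)) (co d p)))).
  - apply H; auto.
    + intros a b c _ _ _; exact I.
    + intros eps; destruct (fast_uniform m s eps Hs) as [N HN]; exists N; intros n Hn t _.
      apply (HN n (up d p t) Hn).
    + intros n t _; apply continuity_pt_filterlim.
      apply (continuous_ext (fun t => pdd d (s n) (up d p t))); [intros; symmetry; apply E|].
      apply (continuous_comp (up d p) (pdd d (s n))); [apply continuous_upd|].
      apply smooth_at_continuous, smooth_pdd, Hs.
    + intros eps; destruct (fast_uniform (S m) _ eps Hs') as [N HN]; exists N; intros n Hn t _.
      replace (Lim_seq (fun n0 => Derive (fun t0 => s n0 (up d p t0)) t))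
        with (Lim_seq (fun n0 => pdd d (s n0) (up d p t)))
        by (apply Lim_seq_ext; intros; symmetry; apply E).
      rewrite E; apply (HN n (up d p t) Hn).
  - unfold flim; f_equal; apply Lim_seq_ext; intros n; rewrite E, up_co; reflexivity.
Qed.

Lemma pdd_flim m s d : fast m s -> pdd d (flim s) = flim (fun n => pdd d (s n)).
Proof.
  intros Hs; fext p; apply pdd_eq, (flim_is_derive m), Hs.
Qed.

Lemma flim_smooth m s : fast m s -> smooth (flim s).
Proof.
  intros Hs p; exists (fun _ => True); split; [apply open_true|split; [exact I|]].
  intros n; revert m s Hs; induction n as [|n IH]; intros m s Hs.
  - intros q _; apply (flim_continuous m), Hs.
  - apply Ck_S; split.
    + intros d q _; eexists; apply (flim_is_derive m), Hs.
    + intros d; rewrite (pdd_flim m) by exact Hs; apply (IH (S m)), fast_pdd, Hs.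
Qed.

Lemma itd_flim m s d n : fast m s -> itd d n (flim s) = flim (fun l => itd d n (s l)).
Proof.
  intros Hs; revert m s Hs; induction n as [|n IH]; intros m s Hs; [reflexivity|].
  unfold itd; rewrite Nat.iter_succ_r, (pdd_flim m) by exact Hs.
  fold (itd d n (flim (fun n0 => pdd d (s n0)))).
  rewrite (IH (S m)) by (apply fast_pdd, Hs).
  f_equal; fext l; unfold itd; now rewrite Nat.iter_succ_r.
Qed.

Lemma fast_itd m s d n : fast m s -> fast (n + m) (fun l => itd d n (s l)).
Proof. intros Hs; induction n as [|n IH]; [exact Hs|]; apply (fast_pdd (n + m) _ d IH). Qed.

Lemma pd_flim m s i j k : fast m s -> pd i j k (flim s) = flim (fun l => pd i j k (s l)).
Proof.
  intros Hs; rewrite pd_itd.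
  rewrite (itd_flim m) by exact Hs.
  rewrite (itd_flim (k + m)) by (apply fast_itd, Hs).
  rewrite (itd_flim (j + (k + m))) by (apply fast_itd, fast_itd, Hs); reflexivity.
Qed.

Lemma Borel (p0 : point) (T : table) :
  exists f, smooth f /\ forall i j k, pd i j k f p0 = T i j k.
Proof.
  set (lev := fun n c => proj1_sig (constructive_indefinite_description _
    (small_homogeneous_jet p0 n c))).
  assert (Hlev : forall n c, smooth (lev n c) /\
    (forall i j k, (i + j + k <= n)%nat ->
      pd i j k (lev n c) p0 = if Nat.eq_dec (i + j + k) n then c i j k else 0) /\
    (forall i j k, (i + j + k < n)%nat -> forall p, Rabs (pd i j k (lev n c) p) <= / 2 ^ n)).
  { intros n c; unfold lev; destruct constructive_indefinite_description as [g Hg]; exact Hg. }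
  clearbody lev.
  (* Step m corrects degree m by the residual between T and the jet reached so far, not by T itself,
     since the sine products also contribute in higher orders. *)
  set (s := fix s n := match n with
    | O => fun _ => 0
    | S m => fun p => s m p + lev m (fun i j k => T i j k - pd i j k (s m) p0) p
    end).
  assert (Ss : forall n, smooth (s n)).
  { induction n as [|n IH]; [exact (smooth_const 0)|].
    apply (smooth_plus (s n)); [exact IH|apply Hlev]. }
  assert (Hpd : forall i j k n p, pd i j k (s (S n)) p = pd i j k (s n) p +
    pd i j k (lev n (fun i j k => T i j k - pd i j k (s n) p0)) p).
  { intros i j k n p; change (s (S n)) with
      (fun p => s n p + lev n (fun i j k => T i j k - pd i j k (s n) p0) p).
    rewrite pd_plus; [reflexivity|apply Ss|apply Hlev]. }
  assert (Hf : fast 0 s).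
  { split; [exact Ss|]; intros i j k n p Hn; rewrite Hpd.
    replace (_ + _ - _) with (pd i j k (lev n (fun i j k => T i j k - pd i j k (s n) p0)) p) by ring.
    apply Hlev; lia. }
  assert (HT : forall n i j k, (i + j + k < n)%nat -> pd i j k (s n) p0 = T i j k).
  { induction n as [|n IH]; intros i j k Hn; [lia|]; rewrite Hpd.
    rewrite (proj1 (proj2 (Hlev n _)) i j k) by lia.
    destruct (Nat.eq_dec (i + j + k) n) as [E | E]; [ring|].
    rewrite IH by lia; ring. }
  exists (flim s); split; [apply (flim_smooth 0), Hf|].
  intros i j k; rewrite (pd_flim 0) by exact Hf.
  unfold flim; rewrite (Lim_seq_ext_loc _ (fun _ => T i j k)), Lim_seq_const; [reflexivity|].
  exists (S (i + j + k)); intros n Hn; apply HT; lia.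
Qed.

Definition bor (p0 : point) (T : table) : point -> R :=
  proj1_sig (constructive_indefinite_description _ (Borel p0 T)).

Lemma smooth_bor p0 T : smooth (bor p0 T).
Proof. unfold bor; destruct constructive_indefinite_description as [f [H1 H2]]; exact H1. Qed.

Lemma pd_bor p0 T i j k : pd i j k (bor p0 T) p0 = T i j k.
Proof. unfold bor; destruct constructive_indefinite_description as [f [H1 H2]]; apply H2. Qed.

Lemma bor_val p0 T : bor p0 T p0 = T O O O.
Proof. exact (pd_bor p0 T O O O). Qed.

(** * Total derivatives of rational functions on jets *)

Definition dirv (d : dir) : point :=
  match d with Du => (1, 0, 0) | Dx => (0, 1, 0) | Dv => (0, 0, 1) end.

Definition DD (d : dir) (F : jet -> R) (th : jet) : R :=
  Derive (fun t => F (displace (dirv d) th t)) 0.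

Definition isD (d : dir) (F : jet -> R) (th : jet) (l : R) : Prop :=
  is_derive (fun t => F (displace (dirv d) th t)) 0 l.

Lemma isD_DD d F th l : isD d F th l -> DD d F th = l.
Proof. intros H; apply is_derive_unique, H. Qed.

Lemma displace_0 xi th : displace xi th 0 = th.
Proof.
  destruct th as [[[u x] v] H W h]; unfold displace; cbn; f_equal.
  - unfold pu, px, pv; cbn; f_equal; [f_equal|]; ring.
  - fext i; fext j; fext k; ring.
  - fext i; fext j; fext k; ring.
  - fext i; fext j; fext k; ring.
Qed.

(** Names for the jet coordinates: case analysis on a coordinate becomes possible, and its total
    derivative is found by shifting a multi-index in [devalc]. *)
Inductive crd : Type :=
| cB (d : dir) | cH (i j k : nat) | cW (i j k : nat) | ch (i j k : nat).

Definition evalc (c : crd) (th : jet) : R :=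
  match c with
  | cB d => co d (base th)
  | cH i j k => jH th i j k | cW i j k => jW th i j k | ch i j k => jh th i j k
  end.

Definition devalc (d : dir) (c : crd) (th : jet) : R :=
  match c with
  | cB e => if dir_eq_dec d e then 1 else 0
  | cH i j k => jH th (bi d i) (bj d j) (bk d k)
  | cW i j k => jW th (bi d i) (bj d j) (bk d k)
  | ch i j k => jh th (bi d i) (bj d j) (bk d k)
  end.

Lemma isD_crd d c th : isD d (evalc c) th (devalc d c th).
Proof.
  unfold isD; destruct c as [e|i j k|i j k|i j k]; cbn [evalc devalc displace jH jW jh base].
  - apply is_derive_ext with (f := fun t => co e (base th) + t * co e (dirv d)).
    { intros t; destruct e; reflexivity. }
    replace (if dir_eq_dec d e then 1 else 0) with (co e (dirv d)) by (destruct d, e; reflexivity).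
    auto_derive; [exact I|ring].
  - destruct d; cbn; auto_derive; trivial; ring.
  - destruct d; cbn; auto_derive; trivial; ring.
  - destruct d; cbn; auto_derive; trivial; ring.
Qed.

Lemma isD_const d c th : isD d (fun _ => c) th 0.
Proof. apply (is_derive_const (K := R_AbsRing) c 0). Qed.

Lemma isD_plus d F G th l m :
  isD d F th l -> isD d G th m -> isD d (fun th => F th + G th) th (l + m).
Proof. intros HF HG; apply (is_derive_plus _ _ _ _ _ HF HG). Qed.

Lemma isD_mult d F G th l m :
  isD d F th l -> isD d G th m -> isD d (fun th => F th * G th) th (l * G th + F th * m).
Proof.
  intros HF HG; generalize (is_derive_mult _ _ _ _ _ HF HG Rmult_comm).
  rewrite !displace_0; auto.
Qed.

Lemma isD_inv d F th l :
  isD d F th l -> F th <> 0 -> isD d (fun th => / F th) th (- l / F th ^ 2).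
Proof.
  intros HF H0; assert (H := is_derive_inv _ _ _ HF); cbv beta in H.
  rewrite displace_0 in H; exact (H H0).
Qed.

Lemma isD_div d F G th l m :
  isD d F th l -> isD d G th m -> G th <> 0 ->
  isD d (fun th => F th / G th) th (l * / G th + F th * (- m / G th ^ 2)).
Proof. intros HF HG H0; apply isD_mult; [exact HF|apply isD_inv; assumption]. Qed.

Lemma isD_pow2 d F th l :
  isD d F th l -> isD d (fun th => F th ^ 2) th (2 * F th * l).
Proof.
  intros HF; generalize (isD_mult d F F th l l HF HF).
  replace (l * F th + F th * l) with (2 * F th * l) by ring.
  apply (is_derive_ext (K := R_AbsRing) (V := R_NormedModule)); intros t.
  change (F (displace (dirv d) th t) * F (displace (dirv d) th t) =
    F (displace (dirv d) th t) ^ 2); ring.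
Qed.

Lemma isD_continuous d F th l :
  isD d F th l -> continuous (fun t => F (displace (dirv d) th t)) 0.
Proof. intros H; apply (ex_derive_continuous (fun t => F (displace (dirv d) th t))); exists l; exact H. Qed.

(** ** Polynomials in the jet coordinates *)

Lemma poly_in_mono (S S' : (jet -> R) -> Prop) F :
  (forall G, S G -> S' G) -> poly_in S F -> poly_in S' F.
Proof.
  intros HS; induction 1; [apply poly_const|apply poly_gen; auto|apply poly_add|apply poly_mul];
    assumption.
Qed.

Definition ordc (c : crd) : nat :=
  match c with
  | cB _ => 0%nat
  | cH i j k => i + j + k | cW i j k => i + j + k | ch i j k => i + j + k
  end.

Lemma coordinate_evalc r c : (ordc c <= r)%nat -> coordinate r (evalc c).
Proof.
  destruct c as [[]|i j k|i j k|i j k]; cbn [ordc]; intros H.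
  - apply coord_u. - apply coord_x. - apply coord_v.
  - apply coord_H, H. - apply coord_W, H. - apply coord_h, H.
Qed.

Lemma coordinate_inv r F :
  coordinate r F -> exists c, (ordc c <= r)%nat /\ F = evalc c.
Proof.
  intros []; [exists (cB Du)|exists (cB Dx)|exists (cB Dv)|exists (cH i j k)
             |exists (cW i j k)|exists (ch i j k)]; split; cbn; auto; lia.
Qed.

Lemma jet_poly_crd c : jet_poly (ordc c) (evalc c).
Proof. apply poly_gen, coordinate_evalc; lia. Qed.

Lemma jet_poly_le r r' F : (r <= r')%nat -> jet_poly r F -> jet_poly r' F.
Proof.
  intros Hr; apply poly_in_mono; intros G HG.
  destruct (coordinate_inv r G HG) as (c & Hc & ->); apply coordinate_evalc; lia.
Qed.

Lemma jet_poly_ind (P : (jet -> R) -> Prop) r :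
  (forall c, P (fun _ => c)) -> (forall c, (ordc c <= r)%nat -> P (evalc c)) ->
  (forall F G, jet_poly r F -> jet_poly r G -> P F -> P G -> P (fun th => F th + G th)) ->
  (forall F G, jet_poly r F -> jet_poly r G -> P F -> P G -> P (fun th => F th * G th)) ->
  forall F, jet_poly r F -> P F.
Proof.
  intros H1 H2 H3 H4 F HF; induction HF; auto.
  destruct (coordinate_inv r F H) as (c & Hc & ->); auto.
Qed.

Lemma jet_poly_ex_isD r P d th : jet_poly r P -> exists l, isD d P th l.
Proof.
  intros H; revert P H; apply jet_poly_ind.
  - intros c; eexists; apply isD_const.
  - intros c _; eexists; apply isD_crd.
  - intros F G _ _ [l Hl] [m Hm]; eexists; apply isD_plus; eassumption.
  - intros F G _ _ [l Hl] [m Hm]; eexists; apply isD_mult; eassumption.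
Qed.

(** ** Rational functions regular on [E] minus the zeros of [q] *)

Definition Dom (q : jet -> R) (th : jet) : Prop := in_E th /\ q th <> 0.

Inductive rat (q : jet -> R) : (jet -> R) -> Prop :=
| rat_const c : rat q (fun _ => c)
| rat_crd c : rat q (evalc c)
| rat_plus F G : rat q F -> rat q G -> rat q (fun th => F th + G th)
| rat_mult F G : rat q F -> rat q G -> rat q (fun th => F th * G th)
| rat_inv F : rat q F -> (forall th, Dom q th -> F th <> 0) -> rat q (fun th => / F th)
| rat_ext F G : rat q F -> (forall th, Dom q th -> F th = G th) -> rat q G.

Lemma rat_div q F G :
  rat q F -> rat q G -> (forall th, Dom q th -> G th <> 0) -> rat q (fun th => F th / G th).
Proof. intros; apply rat_mult; [|apply rat_inv]; assumption. Qed.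

Lemma rat_opp q F : rat q F -> rat q (fun th => - F th).
Proof.
  intros H; apply (rat_ext q (fun th => -1 * F th)); [|intros; ring].
  apply (rat_mult q (fun _ => -1)); [apply rat_const|exact H].
Qed.

Lemma rat_minus q F G : rat q F -> rat q G -> rat q (fun th => F th - G th).
Proof. intros; apply rat_plus; [|apply rat_opp]; assumption. Qed.

Lemma rat_pow q F n : rat q F -> rat q (fun th => F th ^ n).
Proof.
  intros H; induction n as [|n IH]; cbn; [apply rat_const|].
  apply (rat_mult q F (fun th => F th ^ n)); assumption.
Qed.

Lemma rat_frac q F :
  rat q F -> exists r P Q, jet_poly r P /\ jet_poly r Q /\
    forall th, Dom q th -> Q th <> 0 /\ F th = P th / Q th.
Proof.
  assert (Hc : forall r c, jet_poly r (fun _ => c)) by (intros; apply poly_const).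
  induction 1 as [c|c|F G _ (r1 & P1 & Q1 & HP1 & HQ1 & H1) _ (r2 & P2 & Q2 & HP2 & HQ2 & H2)
    |F G _ (r1 & P1 & Q1 & HP1 & HQ1 & H1) _ (r2 & P2 & Q2 & HP2 & HQ2 & H2)
    |F _ (r1 & P1 & Q1 & HP1 & HQ1 & H1) H0|F G _ (r1 & P1 & Q1 & HP1 & HQ1 & H1) H0].
  - exists O, (fun _ => c), (fun _ => 1); split; [|split]; auto.
    intros; split; [lra|field].
  - exists (ordc c), (evalc c), (fun _ => 1); split; [|split]; auto using jet_poly_crd.
    intros; split; [lra|field].
  - assert (L1 := Nat.le_max_l r1 r2); assert (L2 := Nat.le_max_r r1 r2).
    exists (Nat.max r1 r2), (fun th => P1 th * Q2 th + P2 th * Q1 th), (fun th => Q1 th * Q2 th).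
    split; [|split].
    + apply poly_add; apply poly_mul; (eapply jet_poly_le; [|eassumption]; lia).
    + apply poly_mul; (eapply jet_poly_le; [|eassumption]; lia).
    + intros th Hth; destruct (H1 th Hth) as [N1 ->], (H2 th Hth) as [N2 ->].
      split; [apply Rmult_neq_0; tauto|field; auto].
  - assert (L1 := Nat.le_max_l r1 r2); assert (L2 := Nat.le_max_r r1 r2).
    exists (Nat.max r1 r2), (fun th => P1 th * P2 th), (fun th => Q1 th * Q2 th).
    split; [|split]; try (apply poly_mul; (eapply jet_poly_le; [|eassumption]; lia)).
    intros th Hth; destruct (H1 th Hth) as [N1 ->], (H2 th Hth) as [N2 ->].
    split; [apply Rmult_neq_0; tauto|field; auto].
  - exists r1, Q1, P1; split; [|split]; auto; intros th Hth.
    destruct (H1 th Hth) as [N1 E1]; generalize (H0 th Hth); rewrite E1; intros HN.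
    assert (P1 th <> 0) by (intros E; apply HN; rewrite E; field; exact N1).
    split; [assumption|field; auto].
  - exists r1, P1, Q1; split; [|split]; auto; intros th Hth.
    rewrite <- H0 by exact Hth; auto.
Qed.

(** The total derivatives are tangent to E: the equations of E are linear and closed under the shift
    of indices, and h > 0 persists for small t. Hence functions that agree only on E have the same
    total derivatives there. *)
Lemma displace_in_E d th :
  in_E th -> locally 0 (fun t => in_E (displace (dirv d) th t)).
Proof.
  intros [H0 Hv].
  assert (Hc := isD_continuous d (evalc (ch 0 0 0)) th _ (isD_crd d _ th)).
  assert (Hl : locally 0 (fun t => 0 < evalc (ch 0 0 0) (displace (dirv d) th t))).
  { apply (Hc (fun y => 0 < y)); rewrite displace_0; apply (open_gt 0); exact H0. }
  revert Hl; apply filter_imp; intros t Ht; split; [exact Ht|].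
  intros i j k; cbn; rewrite !Hv; ring.
Qed.

Section Rational.

Variables (rq : nat) (q : jet -> R).
Hypothesis Hq : jet_poly rq q.

Lemma displace_Dom d th : Dom q th -> locally 0 (fun t => Dom q (displace (dirv d) th t)).
Proof.
  intros [HE H0]; apply filter_and; [apply displace_in_E, HE|].
  destruct (jet_poly_ex_isD rq q d th Hq) as [l Hl].
  apply (continuous_neq0 (fun t => q (displace (dirv d) th t))).
  - apply (isD_continuous d q th l Hl).
  - rewrite displace_0; exact H0.
Qed.

Lemma isD_ext d F G th l :
  (forall th, Dom q th -> F th = G th) -> Dom q th -> isD d F th l -> isD d G th l.
Proof.
  intros HFG Hth; apply is_derive_ext_loc.
  generalize (displace_Dom d th Hth); apply filter_imp; intros t Ht; apply HFG, Ht.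
Qed.

Lemma DD_ext d F G th :
  (forall th, Dom q th -> F th = G th) -> Dom q th -> DD d F th = DD d G th.
Proof.
  intros HFG Hth; apply Derive_ext_loc.
  generalize (displace_Dom d th Hth); apply filter_imp; intros t Ht; apply HFG, Ht.
Qed.

Lemma rat_isD_ex F d :
  rat q F -> exists F', rat q F' /\ forall th, Dom q th -> isD d F th (F' th).
Proof.
  induction 1 as [c|c|F G RF (F' & RF' & HF) RG (G' & RG' & HG)
    |F G RF (F' & RF' & HF) RG (G' & RG' & HG)|F RF (F' & RF' & HF) H0|F G RF (F' & RF' & HF) H0].
  - exists (fun _ => 0); split; [apply rat_const|intros; apply isD_const].
  - exists (devalc d c); split; [|intros; apply isD_crd].
    destruct c as [e|i j k|i j k|i j k]; [apply (rat_const q (if dir_eq_dec d e then 1 else 0))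
      |apply (rat_crd q (cH _ _ _))|apply (rat_crd q (cW _ _ _))|apply (rat_crd q (ch _ _ _))].
  - exists (fun th => F' th + G' th); split; [apply rat_plus; assumption|].
    intros; apply isD_plus; auto.
  - exists (fun th => F' th * G th + F th * G' th); split.
    + apply rat_plus; apply rat_mult; assumption.
    + intros; apply isD_mult; auto.
  - exists (fun th => - F' th / F th ^ 2); split.
    + apply rat_div; [apply rat_opp; assumption|apply rat_pow; assumption|].
      intros; apply pow_nonzero; auto.
    + intros; apply isD_inv; auto.
  - exists F'; split; [assumption|]; intros th Hth; apply (isD_ext d F); auto.
Qed.

Lemma rat_isD F d th : rat q F -> Dom q th -> isD d F th (DD d F th).
Proof.
  intros RF Hth; destruct (rat_isD_ex F d RF) as (F' & _ & H).
  rewrite (isD_DD d F th _ (H th Hth)); auto.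
Qed.

Lemma rat_DD F d : rat q F -> rat q (DD d F).
Proof.
  intros RF; destruct (rat_isD_ex F d RF) as (F' & RF' & H).
  apply (rat_ext q F'); [exact RF'|]; intros th Hth; symmetry; apply isD_DD; auto.
Qed.

Lemma DD_plus d F G th :
  rat q F -> rat q G -> Dom q th -> DD d (fun th => F th + G th) th = DD d F th + DD d G th.
Proof. intros; apply isD_DD, isD_plus; apply rat_isD; assumption. Qed.

Lemma DD_mult d F G th :
  rat q F -> rat q G -> Dom q th ->
  DD d (fun th => F th * G th) th = DD d F th * G th + F th * DD d G th.
Proof. intros; apply isD_DD, isD_mult; apply rat_isD; assumption. Qed.

Lemma DD_inv d F th :
  rat q F -> (forall th, Dom q th -> F th <> 0) -> Dom q th ->
  DD d (fun th => / F th) th = - DD d F th * (/ F th * / F th).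
Proof.
  intros RF H0 Hth; rewrite (isD_DD d _ th _ (isD_inv d F th _ (rat_isD F d th RF Hth) (H0 th Hth))).
  field; auto.
Qed.

Lemma DD_crd d c : DD d (evalc c) = devalc d c.
Proof. fext th; apply isD_DD, isD_crd. Qed.

Lemma DD_const d c : DD d (fun _ => c) = fun _ => 0.
Proof. fext th; apply isD_DD, isD_const. Qed.

(** By induction on the construction of F. On a coordinate both sides raise the same multi-index;
    the other cases are Leibniz and quotient rules, applied through [DD_ext] because those rules
    hold on [Dom q] only. *)
Lemma DD_comm d e F th : rat q F -> Dom q th -> DD d (DD e F) th = DD e (DD d F) th.
Proof.
  intros RF; revert th; induction RF as [c|c|F G RF IHF RG IHG|F G RF IHF RG IHG|F RF IHF H0
    |F G RF IHF HFG]; intros th Hth.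
  - now rewrite !DD_const.
  - rewrite !DD_crd; destruct c as [a|i j k|i j k|i j k]; cbn [devalc].
    + change (DD d (fun _ => if dir_eq_dec e a then 1 else 0) th =
              DD e (fun _ => if dir_eq_dec d a then 1 else 0) th).
      now rewrite !DD_const.
    + change (DD d (evalc (cH (bi e i) (bj e j) (bk e k))) th =
              DD e (evalc (cH (bi d i) (bj d j) (bk d k))) th).
      rewrite !DD_crd; destruct d, e; reflexivity.
    + change (DD d (evalc (cW (bi e i) (bj e j) (bk e k))) th =
              DD e (evalc (cW (bi d i) (bj d j) (bk d k))) th).
      rewrite !DD_crd; destruct d, e; reflexivity.
    + change (DD d (evalc (ch (bi e i) (bj e j) (bk e k))) th =
              DD e (evalc (ch (bi d i) (bj d j) (bk d k))) th).
      rewrite !DD_crd; destruct d, e; reflexivity.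
  - rewrite (DD_ext d (DD e (fun th => F th + G th)) (fun th => DD e F th + DD e G th) th),
      (DD_ext e (DD d (fun th => F th + G th)) (fun th => DD d F th + DD d G th) th)
      by (exact Hth || (intros; apply DD_plus; assumption)).
    rewrite !DD_plus by (try apply rat_DD; assumption).
    rewrite IHF, IHG by exact Hth; reflexivity.
  - rewrite (DD_ext d (DD e (fun th => F th * G th)) (fun th => DD e F th * G th + F th * DD e G th) th),
      (DD_ext e (DD d (fun th => F th * G th)) (fun th => DD d F th * G th + F th * DD d G th) th)
      by (exact Hth || (intros; apply DD_mult; assumption)).
    rewrite !DD_plus by (try apply rat_mult; try apply rat_DD; assumption).
    rewrite !DD_mult by (try apply rat_DD; assumption).
    rewrite IHF, IHG by exact Hth; ring.
  - assert (RI : rat q (fun th => / F th)) by (apply rat_inv; assumption).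
    assert (RII : rat q (fun th => / F th * / F th)) by (apply rat_mult; assumption).
    assert (E : forall a, forall th, Dom q th -> DD a (fun th => / F th) th =
      -1 * (DD a F th * (/ F th * / F th))).
    { intros a th' Hth'; rewrite DD_inv by assumption; ring. }
    rewrite (DD_ext d _ _ th (E e) Hth), (DD_ext e _ _ th (E d) Hth).
    rewrite !(DD_mult _ (fun _ => -1)), !DD_const
      by (try assumption; try apply rat_const; apply rat_mult; try assumption; apply rat_DD, RF).
    rewrite !(DD_mult _ (DD _ F)) by (try assumption; apply rat_DD, RF).
    rewrite !(DD_mult _ (fun th => / F th)) by assumption.
    rewrite !DD_inv by assumption.
    rewrite IHF by exact Hth; ring.
  - assert (E : forall a, forall th, Dom q th -> DD a G th = DD a F th).
    { intros a th' Hth'; symmetry; apply DD_ext; assumption. }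
    rewrite (DD_ext d _ _ th (E e) Hth), (DD_ext e _ _ th (E d) Hth); auto.
Qed.

(** ** Rational functions along sections *)

(** Here h_v vanishes near p and not merely to infinite order at p, so that the jets at neighbouring
    points lie in E as well. *)
Definition ksec (s : fields) (p : point) : Prop :=
  smooth_at p (fH s) /\ smooth_at p (fW s) /\ smooth_at p (fh s) /\
  0 < fh s p /\ locally p (fun r => pd_v (fh s) r = 0).

Lemma ksec_loc s p : ksec s p -> locally p (fun r => ksec s r).
Proof.
  intros (S1 & S2 & S3 & H0 & Hv).
  assert (Hp : locally p (fun r => 0 < fh s r)).
  { apply (smooth_at_continuous p (fh s) S3 (fun y => 0 < y)), (open_gt 0), H0. }
  apply locally_locally in Hv.
  generalize (filter_and _ _ (smooth_at_loc _ _ S1) (filter_and _ _ (smooth_at_loc _ _ S2)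
    (filter_and _ _ (smooth_at_loc _ _ S3) (filter_and _ _ Hp Hv)))).
  apply filter_imp; intros r (A1 & A2 & A3 & A4 & A5); repeat split; assumption.
Qed.

Lemma ksec_in_E s p : ksec s p -> in_E (jet_of s p).
Proof.
  intros (S1 & S2 & S3 & H0 & Hv); split; [exact H0|]; intros i j k; cbn.
  rewrite pd_Sv.
  transitivity (pd i j k (fun _ => 0) p); [|now rewrite pd_const].
  apply (agr_pd (i + j + k)); [apply agr_loc, Hv|lia].
Qed.

Lemma crd_section s c p :
  ksec s p -> smooth_at p (fun r => evalc c (jet_of s r)) /\
  forall d, pdd d (fun r => evalc c (jet_of s r)) p = devalc d c (jet_of s p).
Proof.
  intros (S1 & S2 & S3 & _ & _); destruct c as [e|i j k|i j k|i j k]; cbn [evalc devalc jet_of jH jW jh base].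
  - split; [apply smooth_at_co|]; intros d; change (pdd d (co e) p = if dir_eq_dec d e then 1 else 0).
    now rewrite pdd_co.
  - split; [apply (smooth_at_pd p i j k (fH s) S1)|intros d; apply (pdd_pd d i j k (fH s) p S1)].
  - split; [apply (smooth_at_pd p i j k (fW s) S2)|intros d; apply (pdd_pd d i j k (fW s) p S2)].
  - split; [apply (smooth_at_pd p i j k (fh s) S3)|intros d; apply (pdd_pd d i j k (fh s) p S3)].
Qed.

Lemma jet_poly_section r P s p :
  jet_poly r P -> ksec s p -> smooth_at p (fun x => P (jet_of s x)).
Proof.
  intros HP Hs; revert P HP; apply jet_poly_ind.
  - intros c; apply smooth_at_const.
  - intros c _; apply crd_section, Hs.
  - intros F G _ _ HF HG; apply (smooth_at_plus p _ _ HF HG).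
  - intros F G _ _ HF HG; apply (smooth_at_mult p _ _ HF HG).
Qed.

Lemma Dom_section s p :
  ksec s p -> q (jet_of s p) <> 0 -> locally p (fun r => ksec s r /\ Dom q (jet_of s r)).
Proof.
  intros Hs H0.
  assert (Hc := smooth_at_continuous _ _ (jet_poly_section rq q s p Hq Hs)).
  generalize (filter_and _ _ (ksec_loc s p Hs)
    (continuous_neq0 (fun r => q (jet_of s r)) p Hc H0)).
  apply filter_imp; intros r [H1 H2]; split; [exact H1|split; [apply ksec_in_E, H1|exact H2]].
Qed.

(** The defining property of total derivatives, D_d F along the jet of s being the partial
    derivative of F along s. It carries statements about jets over to calculus on R^3. *)
Lemma rat_section s F p :
  rat q F -> ksec s p -> q (jet_of s p) <> 0 ->
  smooth_at p (fun r => F (jet_of s r)) /\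
  forall d, pdd d (fun r => F (jet_of s r)) p = DD d F (jet_of s p).
Proof.
  intros RF Hs H0; assert (Hth : Dom q (jet_of s p)) by (split; [apply ksec_in_E, Hs|exact H0]).
  induction RF as [c|c|F G RF [SF EF] RG [SG EG]|F G RF [SF EF] RG [SG EG]|F RF [SF EF] HN
    |F G RF [SF EF] HFG].
  - split; [apply smooth_at_const|]; intros d; now rewrite DD_const, pdd_const.
    split; [apply crd_section, Hs|]; intros d; rewrite DD_crd; apply crd_section, Hs.
  - split; [apply (smooth_at_plus p _ _ SF SG)|]; intros d.
    rewrite DD_plus, <- EF, <- EG by assumption; apply (pdd_plus p _ _ d SF SG).
  - split; [apply (smooth_at_mult p _ _ SF SG)|]; intros d.
    rewrite DD_mult, <- EF, <- EG by assumption; apply (pdd_mult p _ _ d SF SG).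
  - split; [apply (smooth_at_inv p _ SF), HN, Hth|]; intros d.
    rewrite DD_inv, <- EF by assumption.
    rewrite (pdd_inv p (fun r => F (jet_of s r)) d SF (HN _ Hth)).
    field; apply HN, Hth.
  - assert (Hl : locally p (fun r => F (jet_of s r) = G (jet_of s r))).
    { generalize (Dom_section s p Hs H0); apply filter_imp; intros r [_ Hr]; apply HFG, Hr. }
    split; [apply (smooth_at_ext p _ _ Hl SF)|]; intros d.
    rewrite <- (DD_ext d F G _ HFG Hth), <- EF.
    symmetry; apply (pdd_ext_loc d _ _ p Hl).
Qed.

End Rational.

(** * The jet coordinates in terms of the invariants and a cross-section *)

Definition Is : list (jet -> R) := I1 :: J1 :: J2 :: nil.
Definition Ns : list hfield := nabla1 :: nabla2 :: nabla3 :: nil.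

Definition n1v (th : jet) : R := W_v th / W_vv th.
Definition n2x (th : jet) : R := 2 / W_v th.
Definition n2v (th : jet) : R :=
  (h_x th * W_v th - 2 * var_h th * W_xv th) / (var_h th * W_v th * W_vv th).
Definition n3u (th : jet) : R := 1 / W_v th * - W_vv th.
Definition n3x (th : jet) : R := 1 / W_v th * H_vv th.
Definition n3v (th : jet) : R := 1 / W_v th * (W_uv th - H_xv th).

Lemma apply1 F th : apply nabla1 F th = n1v th * DD Dv F th.
Proof.
  change (apply nabla1 F th) with (0 * DD Du F th + 0 * DD Dx F th + n1v th * DD Dv F th); ring.
Qed.

Lemma apply2 F th : apply nabla2 F th = n2x th * DD Dx F th + n2v th * DD Dv F th.
Proof.
  change (apply nabla2 F th) with (0 * DD Du F th + n2x th * DD Dx F th + n2v th * DD Dv F th); ring.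
Qed.

Lemma apply3 F th :
  apply nabla3 F th = n3u th * DD Du F th + n3x th * DD Dx F th + n3v th * DD Dv F th.
Proof. reflexivity. Qed.

Definition det3 (a b c d e f g h i : R) : R :=
  a * (e * i - f * h) - b * (d * i - f * g) + c * (d * h - e * g).

Definition Delta (th : jet) : R :=
  det3 (apply nabla1 I1 th) (apply nabla2 I1 th) (apply nabla3 I1 th)
       (apply nabla1 J1 th) (apply nabla2 J1 th) (apply nabla3 J1 th)
       (apply nabla1 J2 th) (apply nabla2 J2 th) (apply nabla3 J2 th).

Lemma iter_I1 : iterated Is Ns 0 I1. Proof. apply iterated_0; cbn; auto. Qed.
Lemma iter_J1 : iterated Is Ns 0 J1. Proof. apply iterated_0; cbn; auto. Qed.
Lemma iter_J2 : iterated Is Ns 0 J2. Proof. apply iterated_0; cbn; auto. Qed.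
Lemma iter_1 n F : iterated Is Ns n F -> iterated Is Ns (S n) (apply nabla1 F).
Proof. apply iterated_S; cbn; auto. Qed.
Lemma iter_2 n F : iterated Is Ns n F -> iterated Is Ns (S n) (apply nabla2 F).
Proof. apply iterated_S; cbn; auto. Qed.
Lemma iter_3 n F : iterated Is Ns n F -> iterated Is Ns (S n) (apply nabla3 F).
Proof. apply iterated_S; cbn; auto. Qed.

(** ** Regularity of the iterated derivatives *)

Section Regular.

Variables (rq : nat) (q : jet -> R).
Hypothesis Hq : jet_poly rq q.
Hypothesis Hreg : forall th, Dom q th -> W_v th <> 0 /\ W_vv th <> 0.

Lemma Dom_h th : Dom q th -> var_h th <> 0.
Proof. intros [[H _] _]; apply Rgt_not_eq, H. Qed.

Lemma rat_W_v : rat q W_v. Proof. exact (rat_crd q (cW 0 0 1)). Qed.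
Lemma rat_W_vv : rat q W_vv. Proof. exact (rat_crd q (cW 0 0 2)). Qed.
Lemma rat_W_xv : rat q W_xv. Proof. exact (rat_crd q (cW 0 1 1)). Qed.
Lemma rat_W_uv : rat q W_uv. Proof. exact (rat_crd q (cW 1 0 1)). Qed.
Lemma rat_W : rat q var_W. Proof. exact (rat_crd q (cW 0 0 0)). Qed.
Lemma rat_H : rat q var_H. Proof. exact (rat_crd q (cH 0 0 0)). Qed.
Lemma rat_H_vv : rat q H_vv. Proof. exact (rat_crd q (cH 0 0 2)). Qed.
Lemma rat_H_xv : rat q H_xv. Proof. exact (rat_crd q (cH 0 1 1)). Qed.
Lemma rat_h : rat q var_h. Proof. exact (rat_crd q (ch 0 0 0)). Qed.
Lemma rat_h_x : rat q h_x. Proof. exact (rat_crd q (ch 0 1 0)). Qed.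

Ltac rat_tac :=
  repeat first
    [ exact rat_W_v | exact rat_W_vv | exact rat_W_xv | exact rat_W_uv | exact rat_W
    | exact rat_H | exact rat_H_vv | exact rat_H_xv | exact rat_h | exact rat_h_x
    | apply rat_const
    | apply rat_div | apply rat_minus | apply rat_plus | apply rat_mult | apply rat_opp
    | apply rat_pow ].

Ltac nz_tac :=
  intros th Hth; destruct (Hreg th Hth) as [N1 N2]; assert (N3 := Dom_h th Hth);
  repeat first [assumption | apply pow_nonzero | apply Rmult_neq_0].

Lemma rat_n1v : rat q n1v. Proof. unfold n1v; rat_tac; nz_tac. Qed.
Lemma rat_n2x : rat q n2x. Proof. unfold n2x; rat_tac; nz_tac. Qed.
Lemma rat_n2v : rat q n2v. Proof. unfold n2v; rat_tac; nz_tac. Qed.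
Lemma rat_n3u : rat q n3u. Proof. unfold n3u; rat_tac; nz_tac. Qed.
Lemma rat_n3x : rat q n3x. Proof. unfold n3x; rat_tac; nz_tac. Qed.
Lemma rat_n3v : rat q n3v. Proof. unfold n3v; rat_tac; nz_tac. Qed.
Lemma rat_I1 : rat q I1. Proof. unfold I1; rat_tac; nz_tac. Qed.
Lemma rat_J1 : rat q J1. Proof. unfold J1; rat_tac; nz_tac. Qed.
Lemma rat_J2 : rat q J2. Proof. unfold J2; rat_tac; nz_tac. Qed.

Lemma rat_apply X F : In X Ns -> rat q F -> rat q (apply X F).
Proof.
  intros HX HF; assert (R := fun d => rat_DD rq q Hq F d HF).
  destruct HX as [<- | [<- | [<- | []]]].
  - apply (rat_ext q (fun th => n1v th * DD Dv F th)); [|intros; symmetry; apply apply1].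
    apply rat_mult; [apply rat_n1v|apply R].
  - apply (rat_ext q (fun th => n2x th * DD Dx F th + n2v th * DD Dv F th));
      [|intros; symmetry; apply apply2].
    apply rat_plus; apply rat_mult; first [apply rat_n2x|apply rat_n2v|apply R].
  - apply (rat_ext q (fun th => n3u th * DD Du F th + n3x th * DD Dx F th + n3v th * DD Dv F th));
      [|intros; symmetry; apply apply3].
    apply rat_plus; [apply rat_plus|]; apply rat_mult;
      first [apply rat_n3u|apply rat_n3x|apply rat_n3v|apply R].
Qed.

Lemma rat_iterated n F : iterated Is Ns n F -> rat q F.
Proof.
  induction 1 as [F HF|n X F HX HF IH]; [|apply rat_apply; assumption].
  destruct HF as [<- | [<- | [<- | []]]]; [apply rat_I1|apply rat_J1|apply rat_J2].
Qed.

Lemma rat_Delta : rat q Delta.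
Proof.
  unfold Delta, det3.
  repeat first
    [ eapply rat_iterated; first [apply iter_1 | apply iter_2 | apply iter_3];
        first [exact iter_I1 | exact iter_J1 | exact iter_J2]
    | apply rat_minus | apply rat_plus | apply rat_mult ].
Qed.

Lemma DD_apply1 d J th :
  rat q J -> Dom q th ->
  DD d (apply nabla1 J) th = DD d n1v th * DD Dv J th + n1v th * DD d (DD Dv J) th.
Proof.
  intros RJ Hth; assert (R := fun d => rat_DD rq q Hq J d RJ).
  rewrite (DD_ext rq q Hq d _ _ th (fun th _ => apply1 J th) Hth).
  apply (DD_mult rq q Hq); auto; apply rat_n1v.
Qed.

Lemma DD_apply2 d J th :
  rat q J -> Dom q th ->
  DD d (apply nabla2 J) th =
    DD d n2x th * DD Dx J th + n2x th * DD d (DD Dx J) th +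
    (DD d n2v th * DD Dv J th + n2v th * DD d (DD Dv J) th).
Proof.
  intros RJ Hth; assert (R := fun d => rat_DD rq q Hq J d RJ).
  pose proof rat_n2x as R1; pose proof rat_n2v as R2.
  rewrite (DD_ext rq q Hq d _ _ th (fun th _ => apply2 J th) Hth).
  rewrite (DD_plus rq q Hq) by (try apply rat_mult; auto).
  rewrite !(DD_mult rq q Hq) by auto; reflexivity.
Qed.

Lemma DD_apply3 d J th :
  rat q J -> Dom q th ->
  DD d (apply nabla3 J) th =
    DD d n3u th * DD Du J th + n3u th * DD d (DD Du J) th +
    (DD d n3x th * DD Dx J th + n3x th * DD d (DD Dx J) th) +
    (DD d n3v th * DD Dv J th + n3v th * DD d (DD Dv J) th).
Proof.
  intros RJ Hth; assert (R := fun d => rat_DD rq q Hq J d RJ).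
  pose proof rat_n3u as R1; pose proof rat_n3x as R2; pose proof rat_n3v as R3.
  rewrite (DD_ext rq q Hq d _ _ th (fun th _ => apply3 J th) Hth).
  rewrite !(DD_plus rq q Hq) by (try apply rat_plus; try apply rat_mult; auto).
  rewrite !(DD_mult rq q Hq) by auto; reflexivity.
Qed.

(** The second derivatives of J cancel by [DD_comm]. As nabla_1 is a multiple of D_v, the D_u and
    D_x components contain only D_v of the coefficients of nabla_3. *)
Lemma comm13 J th :
  rat q J -> Dom q th ->
  apply nabla1 (apply nabla3 J) th - apply nabla3 (apply nabla1 J) th =
    n1v th * DD Dv n3u th * DD Du J th + n1v th * DD Dv n3x th * DD Dx J th +
    (n1v th * DD Dv n3v th - apply nabla3 n1v th) * DD Dv J th.
Proof.
  intros RJ Hth.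
  rewrite (apply1 (apply nabla3 J)), (apply3 (apply nabla1 J)), (apply3 n1v).
  rewrite !DD_apply1, DD_apply3 by assumption.
  rewrite (DD_comm rq q Hq Dv Du J), (DD_comm rq q Hq Dv Dx J) by assumption; ring.
Qed.

Lemma comm23 J th :
  rat q J -> Dom q th ->
  apply nabla2 (apply nabla3 J) th - apply nabla3 (apply nabla2 J) th =
    (n2x th * DD Dx n3u th + n2v th * DD Dv n3u th) * DD Du J th +
    (n2x th * DD Dx n3x th + n2v th * DD Dv n3x th - apply nabla3 n2x th) * DD Dx J th +
    (n2x th * DD Dx n3v th + n2v th * DD Dv n3v th - apply nabla3 n2v th) * DD Dv J th.
Proof.
  intros RJ Hth.
  rewrite (apply2 (apply nabla3 J)), (apply3 (apply nabla2 J)), (apply3 n2x), (apply3 n2v).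
  rewrite !DD_apply2, !DD_apply3 by assumption.
  rewrite (DD_comm rq q Hq Dv Du J), (DD_comm rq q Hq Dv Dx J), (DD_comm rq q Hq Dx Du J)
    by assumption; ring.
Qed.

(** W_uv cancels and H does not occur. This gives an expression for H_xv independent of the one
    obtained from J1, where H is present. *)
Lemma nabla3_I1 th :
  Dom q th ->
  apply nabla3 I1 th =
    (H_vv th * (2 * W_xv th * var_h th - W_v th * h_x th) + W_vv th * W_v th * jh th 1 0 0
     - 2 * H_xv th * W_vv th * var_h th) / var_h th ^ 2.
Proof.
  intros Hth; destruct (Hreg th Hth) as [N1 N2]; assert (N3 := Dom_h th Hth).
  rewrite apply3.
  assert (E : forall d, DD d I1 th =
    2 * W_v th * devalc d (cW 0 0 1) th * / var_h th +
    W_v th ^ 2 * (- devalc d (ch 0 0 0) th / var_h th ^ 2)).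
  { intros d; apply isD_DD, isD_div; [apply isD_pow2|apply (isD_crd d (ch 0 0 0))|exact N3].
    apply (isD_crd d (cW 0 0 1)). }
  rewrite !E; unfold n3u, n3x, n3v; cbn [devalc bi bj bk].
  change (jh th 0 0 1) with (jh th 0 0 1); destruct Hth as [[_ Hv] _]; rewrite Hv.
  change (jW th 1 0 1) with (W_uv th); change (jW th 0 1 1) with (W_xv th).
  change (jW th 0 0 2) with (W_vv th); change (jh th 0 1 0) with (h_x th).
  field; auto.
Qed.

End Regular.

(** ** The ring generated by the cross-section coordinates and the invariants *)

(* The coordinates that the pseudogroup can normalise, see [reach]. *)
Definition isZ (c : crd) : Prop :=
  match c with
  | cB _ => True
  | cW _ _ 0 | cW _ _ 1 | cW 0 0 2 => True
  | cH _ 0 0 | cH _ 0 1 | cH _ 0 2 => True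
  | _ => False
  end.

(** The index N bounds the number of invariant derivations applied; it is recorded because the
    denominators in [lie_tresse_generated] must have bounded length. *)
Inductive kgen (N : nat) : (jet -> R) -> Prop :=
| kgen_Z c : isZ c -> kgen N (evalc c)
| kgen_inv n F : (n <= N)%nat -> iterated Is Ns n F -> kgen N F
| kgen_W_v : kgen N (fun th => / W_v th)
| kgen_W_vv : kgen N (fun th => / W_vv th)
| kgen_I1 : kgen N (fun th => / I1 th)
| kgen_Delta : kgen N (fun th => / Delta th).

Section Generic.

Variables (rq : nat) (q : jet -> R).
Hypothesis Hq : jet_poly rq q.
Hypothesis Hgen : forall th, Dom q th -> W_v th <> 0 /\ W_vv th <> 0 /\ Delta th <> 0.

Let Hreg : forall th, Dom q th -> W_v th <> 0 /\ W_vv th <> 0.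
Proof. intros th Hth; destruct (Hgen th Hth) as (? & ? & ?); auto. Qed.

Lemma I1_neq0 th : Dom q th -> I1 th <> 0.
Proof.
  intros Hth; destruct (Hreg th Hth) as [N1 _]; assert (N3 := Dom_h q th Hth).
  unfold I1; apply Rmult_neq_0;
    [apply pow_nonzero, N1|apply Rinv_neq_0_compat, N3].
Qed.

(** Equality is asked only on [Dom q], where the inverses among the generators are genuine. *)
Definition kpoly (N : nat) (F : jet -> R) : Prop :=
  exists G, poly_in (kgen N) G /\ forall th, Dom q th -> F th = G th.

Definition kin (F : jet -> R) : Prop := exists N, kpoly N F.

Lemma kgen_le N M F : (N <= M)%nat -> kgen N F -> kgen M F.
Proof.
  intros HNM []; [apply kgen_Z; auto|eapply kgen_inv; [|eassumption]; lia|apply kgen_W_v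
    |apply kgen_W_vv|apply kgen_I1|apply kgen_Delta].
Qed.

Lemma kpoly_le N M F : (N <= M)%nat -> kpoly N F -> kpoly M F.
Proof.
  intros H (G & HG & E); exists G; split; [|exact E].
  revert HG; apply poly_in_mono; intros K; apply kgen_le, H.
Qed.

Lemma kin_const c : kin (fun _ => c).
Proof. exists O, (fun _ => c); split; [apply poly_const|auto]. Qed.

Lemma kin_plus F G : kin F -> kin G -> kin (fun th => F th + G th).
Proof.
  intros (N & F' & HF & EF) (M & G' & HG & EG).
  exists (Nat.max N M), (fun th => F' th + G' th); split.
  - apply poly_add; [apply (poly_in_mono (kgen N))|apply (poly_in_mono (kgen M))]; auto;
      intros K; apply kgen_le; lia.
  - intros th Hth; rewrite EF, EG by exact Hth; reflexivity.
Qed.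

Lemma kin_mult F G : kin F -> kin G -> kin (fun th => F th * G th).
Proof.
  intros (N & F' & HF & EF) (M & G' & HG & EG).
  exists (Nat.max N M), (fun th => F' th * G' th); split.
  - apply poly_mul; [apply (poly_in_mono (kgen N))|apply (poly_in_mono (kgen M))]; auto;
      intros K; apply kgen_le; lia.
  - intros th Hth; rewrite EF, EG by exact Hth; reflexivity.
Qed.

Lemma kin_ext F G : kin F -> (forall th, Dom q th -> F th = G th) -> kin G.
Proof.
  intros (N & F' & HF & EF) H; exists N, F'; split; [exact HF|].
  intros th Hth; rewrite <- H by exact Hth; auto.
Qed.

Lemma kin_opp F : kin F -> kin (fun th => - F th).
Proof.
  intros HF; apply (kin_ext (fun th => -1 * F th)); [|intros; ring].
  apply (kin_mult (fun _ => -1)); [apply kin_const|exact HF].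
Qed.

Lemma kin_minus F G : kin F -> kin G -> kin (fun th => F th - G th).
Proof. intros; apply kin_plus; [|apply kin_opp]; assumption. Qed.

Lemma kin_div F G : kin F -> kin (fun th => / G th) -> kin (fun th => F th / G th).
Proof. intros; apply kin_mult; assumption. Qed.

Lemma kin_pow F n : kin F -> kin (fun th => F th ^ n).
Proof.
  intros H; induction n as [|n IH]; cbn; [apply kin_const|].
  apply (kin_mult F (fun th => F th ^ n)); assumption.
Qed.

Lemma kin_gen N F : kgen N F -> kin F.
Proof. intros H; exists N, F; split; [apply poly_gen, H|auto]. Qed.

Lemma kin_Z c : isZ c -> kin (evalc c).
Proof. intros H; apply (kin_gen 0), kgen_Z, H. Qed.

Lemma kin_iter n F : iterated Is Ns n F -> kin F.
Proof. intros H; apply (kin_gen n), (kgen_inv n n F (le_n n) H). Qed.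

Lemma kin_iW_v : kin (fun th => / W_v th). Proof. apply (kin_gen 0), kgen_W_v. Qed.
Lemma kin_iW_vv : kin (fun th => / W_vv th). Proof. apply (kin_gen 0), kgen_W_vv. Qed.
Lemma kin_iI1 : kin (fun th => / I1 th). Proof. apply (kin_gen 0), kgen_I1. Qed.
Lemma kin_iDelta : kin (fun th => / Delta th). Proof. apply (kin_gen 0), kgen_Delta. Qed.

Lemma kgen_rat N F : kgen N F -> rat q F.
Proof.
  intros [c _|n G _ HG| | | |].
  - apply rat_crd.
  - apply (rat_iterated rq q Hq Hreg n), HG.
  - apply rat_inv; [apply rat_W_v|intros th Hth; apply (Hreg th Hth)].
  - apply rat_inv; [apply rat_W_vv|intros th Hth; apply (Hreg th Hth)].
  - apply rat_inv; [apply (rat_I1 q Hreg)|intros th Hth; apply (I1_neq0 th Hth)].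
  - apply rat_inv; [apply (rat_Delta rq q Hq Hreg)|intros th Hth; apply (Hgen th Hth)].
Qed.

Lemma kin_rat F : kin F -> rat q F.
Proof.
  intros (N & G & HG & E); apply (rat_ext q G); [|intros; symmetry; auto].
  clear E; induction HG; [apply rat_const|eapply kgen_rat; eassumption|apply rat_plus|apply rat_mult];
    assumption.
Qed.

(** Closed under the ring operations by the Leibniz rule. Closure under differentiation can thus be
    established one function and one direction at a time, before it holds for the whole ring. *)
Definition kinD (d : dir) (F : jet -> R) : Prop := kin F /\ kin (DD d F).

Lemma kinD_const d c : kinD d (fun _ => c).
Proof. split; [apply kin_const|]; rewrite DD_const; apply kin_const. Qed.

Lemma kinD_plus d F G : kinD d F -> kinD d G -> kinD d (fun th => F th + G th).
Proof.
  intros [F1 F2] [G1 G2]; split; [apply kin_plus; assumption|].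
  apply (kin_ext (fun th => DD d F th + DD d G th)); [apply kin_plus; assumption|].
  intros th Hth; symmetry; apply (DD_plus rq q Hq); try exact Hth; apply kin_rat; assumption.
Qed.

Lemma kinD_mult d F G : kinD d F -> kinD d G -> kinD d (fun th => F th * G th).
Proof.
  intros [F1 F2] [G1 G2]; split; [apply kin_mult; assumption|].
  apply (kin_ext (fun th => DD d F th * G th + F th * DD d G th)).
  - apply kin_plus; apply kin_mult; assumption.
  - intros th Hth; symmetry; apply (DD_mult rq q Hq); try exact Hth; apply kin_rat; assumption.
Qed.

Lemma kinD_ext d F G : kinD d F -> (forall th, Dom q th -> F th = G th) -> kinD d G.
Proof.
  intros [F1 F2] H; split; [apply (kin_ext F); assumption|].
  apply (kin_ext (DD d F)); [assumption|]; intros th Hth; apply (DD_ext rq q Hq); assumption.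
Qed.

Lemma kinD_opp d F : kinD d F -> kinD d (fun th => - F th).
Proof.
  intros HF; apply (kinD_ext d (fun th => -1 * F th)); [|intros; ring].
  apply (kinD_mult d (fun _ => -1)); [apply kinD_const|exact HF].
Qed.

Lemma kinD_minus d F G : kinD d F -> kinD d G -> kinD d (fun th => F th - G th).
Proof. intros; apply kinD_plus; [|apply kinD_opp]; assumption. Qed.

Lemma kinD_inv d F :
  kinD d F -> kin (fun th => / F th) -> (forall th, Dom q th -> F th <> 0) ->
  kinD d (fun th => / F th).
Proof.
  intros [F1 F2] HI H0; split; [exact HI|].
  apply (kin_ext (fun th => - DD d F th * (/ F th * / F th))).
  - apply kin_mult; [apply kin_opp, F2|apply kin_mult; exact HI].
  - intros th Hth; symmetry; apply (DD_inv rq q Hq); try assumption; apply kin_rat, F1.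
Qed.

Lemma kinD_div d F G :
  kinD d F -> kinD d (fun th => / G th) -> kinD d (fun th => F th / G th).
Proof. intros; apply kinD_mult; assumption. Qed.

Lemma kinD_pow d F n : kinD d F -> kinD d (fun th => F th ^ n).
Proof.
  intros H; induction n as [|n IH]; cbn; [apply kinD_const|].
  apply (kinD_mult d F (fun th => F th ^ n)); assumption.
Qed.

Lemma kinD_crd d c : kin (evalc c) -> kin (devalc d c) -> kinD d (evalc c).
Proof. intros H1 H2; split; [exact H1|rewrite DD_crd; exact H2]. Qed.

Lemma kin_W_v : kin W_v. Proof. exact (kin_Z (cW 0 0 1) I). Qed.
Lemma kin_W_vv : kin W_vv. Proof. exact (kin_Z (cW 0 0 2) I). Qed.
Lemma kin_W_xv : kin W_xv. Proof. exact (kin_Z (cW 0 1 1) I). Qed.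
Lemma kin_W_uv : kin W_uv. Proof. exact (kin_Z (cW 1 0 1) I). Qed.
Lemma kin_W : kin var_W. Proof. exact (kin_Z (cW 0 0 0) I). Qed.
Lemma kin_H : kin var_H. Proof. exact (kin_Z (cH 0 0 0) I). Qed.
Lemma kin_H_vv : kin H_vv. Proof. exact (kin_Z (cH 0 0 2) I). Qed.
Lemma kin_I1 : kin I1. Proof. exact (kin_iter 0 I1 iter_I1). Qed.
Lemma kin_J1 : kin J1. Proof. exact (kin_iter 0 J1 iter_J1). Qed.
Lemma kin_J2 : kin J2. Proof. exact (kin_iter 0 J2 iter_J2). Qed.

Ltac nzr th Hth :=
  destruct (Hreg th Hth) as [N1 N2]; assert (N3 := Dom_h q th Hth);
  assert (N4 := I1_neq0 th Hth).

Ltac nz th Hth := intros th Hth; nzr th Hth.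

Lemma kin_h : kin var_h.
Proof.
  apply (kin_ext (fun th => W_v th ^ 2 / I1 th)).
  - apply kin_div; [apply kin_pow, kin_W_v|apply kin_iI1].
  - nz th Hth; unfold I1; field; auto.
Qed.

Lemma kin_ih : kin (fun th => / var_h th).
Proof.
  apply (kin_ext (fun th => I1 th * (/ W_v th) ^ 2)).
  - apply kin_mult; [apply kin_I1|apply kin_pow, kin_iW_v].
  - nz th Hth; unfold I1; field; auto.
Qed.

Lemma h_x_eq th : Dom q th ->
  (4 * H_vv th * var_h th ^ 2 + 2 * (W_xv th - var_W th * W_vv th) * var_h th
   - J2 th * var_h th ^ 2) / W_v th = h_x th.
Proof. intros Hth; nzr th Hth; unfold J2; field; auto. Qed.

Lemma H_xv_eq th : Dom q th ->
  (J1 th * var_h th - var_H th * W_vv th ^ 2 - H_vv th ^ 2 * var_h th) / W_vv th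
   + H_vv th * var_W th + W_uv th = H_xv th.
Proof. intros Hth; nzr th Hth; unfold J1; field; auto. Qed.

Ltac kin_tac :=
  repeat first
    [ exact kin_W_v | exact kin_W_vv | exact kin_W_xv | exact kin_W_uv | exact kin_W | exact kin_H
    | exact kin_H_vv | exact kin_h | exact kin_ih | exact kin_I1 | exact kin_J1 | exact kin_J2
    | exact kin_iW_v | exact kin_iW_vv | exact kin_iI1 | exact kin_iDelta
    | assumption
    | apply kin_const
    | apply kin_div | apply kin_minus | apply kin_plus | apply kin_mult | apply kin_opp
    | apply kin_pow ].

Lemma kin_h_x : kin h_x.
Proof. refine (kin_ext _ _ _ h_x_eq); kin_tac. Qed.

Lemma kin_H_xv : kin H_xv.
Proof. refine (kin_ext _ _ _ H_xv_eq); kin_tac. Qed.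

Lemma kin_n2x : kin n2x. Proof. unfold n2x; kin_tac. Qed.
Lemma kin_n2v : kin n2v.
Proof.
  pose proof kin_h_x as Hh_x.
  apply (kin_ext (fun th => (h_x th * W_v th - 2 * var_h th * W_xv th) *
    (/ var_h th * (/ W_v th * / W_vv th)))).
  - kin_tac.
  - nz th Hth; unfold n2v; field; auto.
Qed.
Lemma kin_n3u : kin n3u. Proof. unfold n3u; kin_tac. Qed.
Lemma kin_n3x : kin n3x. Proof. unfold n3x; kin_tac. Qed.
Lemma kin_n3v : kin n3v. Proof. pose proof kin_H_xv; unfold n3v; kin_tac. Qed.

(* The frame nabla_1, nabla_2, nabla_3 is triangular with respect to D_v, D_x, D_u. *)
Lemma kin_DD_frame F :
  kin (apply nabla1 F) -> kin (apply nabla2 F) -> kin (apply nabla3 F) ->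
  forall d, kin (DD d F).
Proof.
  intros K1 K2 K3.
  assert (Kv : kin (DD Dv F)).
  { apply (kin_ext (fun th => W_vv th / W_v th * apply nabla1 F th)); [kin_tac|].
    nz th Hth; rewrite apply1; unfold n1v; field; auto. }
  assert (Kx : kin (DD Dx F)).
  { pose proof kin_n2v as H2v.
    apply (kin_ext (fun th => W_v th / 2 * (apply nabla2 F th - n2v th * DD Dv F th))).
    - apply kin_mult; [|kin_tac].
      apply (kin_ext (fun th => W_v th * / 2)); [|auto]; kin_tac.
    - nz th Hth; rewrite apply2; unfold n2x; field; auto. }
  assert (Ku : kin (DD Du F)).
  { pose proof kin_n3x; pose proof kin_n3v.
    apply (kin_ext (fun th => W_v th / W_vv th *
      (n3x th * DD Dx F th + n3v th * DD Dv F th - apply nabla3 F th))); [kin_tac|].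
    nz th Hth; rewrite apply3; unfold n3u; field; auto. }
  intros []; assumption.
Qed.

(** The three invariant derivatives of F are again generators, and the frame expresses D_d through
    them. *)
Lemma kinD_iter d n F : iterated Is Ns n F -> kinD d F.
Proof.
  intros H; split; [apply (kin_iter n F H)|]; revert d; apply kin_DD_frame.
  - exact (kin_iter _ _ (iter_1 n F H)).
  - exact (kin_iter _ _ (iter_2 n F H)).
  - exact (kin_iter _ _ (iter_3 n F H)).
Qed.

(* Cramer's rule for the components in the frame of a commutator. *)
Lemma kin_components (L : (jet -> R) -> jet -> R) (bu bx bv : jet -> R) :
  (forall n J, iterated Is Ns n J -> kin (L J)) ->
  (forall J th, rat q J -> Dom q th ->
    L J th = bu th * DD Du J th + bx th * DD Dx J th + bv th * DD Dv J th) ->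
  kin bu /\ kin bx.
Proof.
  intros HL EL.
  (* The components of the field in the frame, by back substitution: D_u occurs only in nabla_3, and
     D_x otherwise only in nabla_2. *)
  assert (EI : forall th, Dom q th -> forall J, rat q J -> L J th =
    (bv th - (bx th - bu th / n3u th * n3x th) / n2x th * n2v th - bu th / n3u th * n3v th)
      / n1v th * apply nabla1 J th +
    (bx th - bu th / n3u th * n3x th) / n2x th * apply nabla2 J th +
    bu th / n3u th * apply nabla3 J th).
  { nz th Hth; intros J RJ; rewrite EL, apply1, apply2, apply3 by assumption.
    assert (n1v th <> 0) by (unfold n1v; apply Rmult_neq_0;
      [|apply Rinv_neq_0_compat]; assumption).
    assert (n2x th <> 0) by (unfold n2x; apply Rmult_neq_0;
      [lra|apply Rinv_neq_0_compat; assumption]).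
    assert (n3u th <> 0) by (unfold n3u; apply Rmult_neq_0;
      [apply Rmult_neq_0; [lra|apply Rinv_neq_0_compat; assumption]
      |apply Ropp_neq_0_compat; assumption]).
    field; auto. }
  assert (RI1 := rat_I1 q Hreg); assert (RJ1 := rat_J1 q Hreg); assert (RJ2 := rat_J2 q Hreg).
  pose proof (HL _ _ iter_I1) as L1; pose proof (HL _ _ iter_J1) as L2;
    pose proof (HL _ _ iter_J2) as L3.
  pose proof (kin_iter _ _ (iter_1 _ _ iter_I1)); pose proof (kin_iter _ _ (iter_2 _ _ iter_I1));
    pose proof (kin_iter _ _ (iter_3 _ _ iter_I1)); pose proof (kin_iter _ _ (iter_1 _ _ iter_J1));
    pose proof (kin_iter _ _ (iter_2 _ _ iter_J1)); pose proof (kin_iter _ _ (iter_3 _ _ iter_J1));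
    pose proof (kin_iter _ _ (iter_1 _ _ iter_J2)); pose proof (kin_iter _ _ (iter_2 _ _ iter_J2));
    pose proof (kin_iter _ _ (iter_3 _ _ iter_J2)).
  assert (C3 : kin (fun th => bu th / n3u th)).
  { apply (kin_ext (fun th =>
      det3 (apply nabla1 I1 th) (apply nabla2 I1 th) (L I1 th)
           (apply nabla1 J1 th) (apply nabla2 J1 th) (L J1 th)
           (apply nabla1 J2 th) (apply nabla2 J2 th) (L J2 th) / Delta th)).
    - unfold det3; kin_tac.
    - intros th Hth; assert (ND := proj2 (proj2 (Hgen th Hth))).
      apply (Rmult_eq_reg_r (Delta th)); [|exact ND].
      unfold Rdiv at 1; rewrite Rmult_assoc, Rinv_l, Rmult_1_r by exact ND.
      rewrite (EI th Hth I1), (EI th Hth J1), (EI th Hth J2) by assumption.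
      unfold Delta, det3; ring. }
  assert (C2 : kin (fun th => (bx th - bu th / n3u th * n3x th) / n2x th)).
  { apply (kin_ext (fun th =>
      det3 (apply nabla1 I1 th) (L I1 th) (apply nabla3 I1 th)
           (apply nabla1 J1 th) (L J1 th) (apply nabla3 J1 th)
           (apply nabla1 J2 th) (L J2 th) (apply nabla3 J2 th) / Delta th)).
    - unfold det3; kin_tac.
    - intros th Hth; assert (ND := proj2 (proj2 (Hgen th Hth))).
      apply (Rmult_eq_reg_r (Delta th)); [|exact ND].
      unfold Rdiv at 1; rewrite Rmult_assoc, Rinv_l, Rmult_1_r by exact ND.
      rewrite (EI th Hth I1), (EI th Hth J1), (EI th Hth J2) by assumption.
      unfold Delta, det3; ring. }
  pose proof kin_n3u; pose proof kin_n3x; pose proof kin_n2x; split.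
  - apply (kin_ext (fun th => bu th / n3u th * n3u th)); [apply kin_mult; assumption|].
    nz th Hth; unfold n3u; field; auto.
  - apply (kin_ext (fun th => (bx th - bu th / n3u th * n3x th) / n2x th * n2x th
      + bu th / n3u th * n3x th)).
    + apply kin_plus; apply kin_mult; assumption.
    + nz th Hth; unfold n3u, n3x, n2x; field; auto.
Qed.

Lemma kinD_W_v d : kinD d W_v.
Proof.
  destruct d; [exact (kinD_crd Du (cW 0 0 1) kin_W_v kin_W_uv)|exact (kinD_crd Dx (cW 0 0 1) kin_W_v kin_W_xv)
    |exact (kinD_crd Dv (cW 0 0 1) kin_W_v kin_W_vv)].
Qed.

Lemma kinD_iW_v d : kinD d (fun th => / W_v th).
Proof. apply kinD_inv; [apply kinD_W_v|apply kin_iW_v|intros th Hth; apply (Hreg th Hth)]. Qed.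

Lemma kinD_h d : kinD d var_h.
Proof.
  apply (kinD_ext d (fun th => W_v th ^ 2 / I1 th)).
  - apply kinD_div; [apply kinD_pow, kinD_W_v|].
    apply kinD_inv; [apply (kinD_iter d 0), iter_I1|apply kin_iI1|intros th Hth; apply (I1_neq0 th Hth)].
  - nz th Hth; unfold I1; field; auto.
Qed.

(** The coefficients of nabla_3 are - W_vv / W_v and H_vv / W_v, so this is where W_vvv and H_vvv
    enter the ring. *)
Lemma kin_comm13 : kin (DD Dv n3u) /\ kin (DD Dv n3x).
Proof.
  destruct (kin_components
    (fun J th => apply nabla1 (apply nabla3 J) th - apply nabla3 (apply nabla1 J) th)
    (fun th => n1v th * DD Dv n3u th) (fun th => n1v th * DD Dv n3x th)
    (fun th => n1v th * DD Dv n3v th - apply nabla3 n1v th)) as [Ku Kx].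
  - intros n J HJ; apply kin_minus.
    + exact (kin_iter _ _ (iter_1 _ _ (iter_3 _ _ HJ))).
    + exact (kin_iter _ _ (iter_3 _ _ (iter_1 _ _ HJ))).
  - intros J th RJ Hth; apply (comm13 rq q Hq Hreg J th RJ Hth).
  - split.
    + apply (kin_ext (fun th => W_vv th / W_v th * (n1v th * DD Dv n3u th))); [kin_tac|].
      nz th Hth; unfold n1v; field; auto.
    + apply (kin_ext (fun th => W_vv th / W_v th * (n1v th * DD Dv n3x th))); [kin_tac|].
      nz th Hth; unfold n1v; field; auto.
Qed.

(** The source of W_xvv and H_xvv. The extra term in the D_x component, nabla_3 of 2 / W_v, involves
    only first derivatives of W_v, which are known. *)
Lemma kin_comm23 : kin (DD Dx n3u) /\ kin (DD Dx n3x).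
Proof.
  destruct kin_comm13 as [Hu Hx].
  destruct (kin_components
    (fun J th => apply nabla2 (apply nabla3 J) th - apply nabla3 (apply nabla2 J) th)
    (fun th => n2x th * DD Dx n3u th + n2v th * DD Dv n3u th)
    (fun th => n2x th * DD Dx n3x th + n2v th * DD Dv n3x th - apply nabla3 n2x th)
    (fun th => n2x th * DD Dx n3v th + n2v th * DD Dv n3v th - apply nabla3 n2v th)) as [Ku Kx].
  - intros n J HJ; apply kin_minus.
    + exact (kin_iter _ _ (iter_2 _ _ (iter_3 _ _ HJ))).
    + exact (kin_iter _ _ (iter_3 _ _ (iter_2 _ _ HJ))).
  - intros J th RJ Hth; apply (comm23 rq q Hq Hreg J th RJ Hth).
  - pose proof kin_n2v; pose proof kin_n3u; pose proof kin_n3x; pose proof kin_n3v.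
    assert (K2 : forall d, kin (DD d n2x)).
    { intros d; apply (kinD_div d (fun _ => 2) W_v); [apply kinD_const|apply kinD_iW_v]. }
    assert (K3 : kin (apply nabla3 n2x)).
    { apply (kin_ext (fun th => n3u th * DD Du n2x th + n3x th * DD Dx n2x th + n3v th * DD Dv n2x th));
        [|intros; symmetry; apply apply3].
      pose proof (K2 Du); pose proof (K2 Dx); pose proof (K2 Dv).
      repeat first [assumption | apply kin_plus | apply kin_mult]. }
    assert (K4 : kin (fun th => W_v th * / 2)) by kin_tac.
    split.
    + apply (kin_ext (fun th => W_v th * / 2 *
        (n2x th * DD Dx n3u th + n2v th * DD Dv n3u th - n2v th * DD Dv n3u th))).
      * apply kin_mult; [exact K4|]; apply (kin_minus _ _ Ku); apply kin_mult; assumption.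
      * nz th Hth; unfold n2x; field; auto.
    + apply (kin_ext (fun th => W_v th * / 2 *
        (n2x th * DD Dx n3x th + n2v th * DD Dv n3x th - apply nabla3 n2x th + apply nabla3 n2x th
         - n2v th * DD Dv n3x th))).
      * apply kin_mult; [exact K4|]; apply kin_minus; [apply (kin_plus _ _ Kx K3)|].
        apply kin_mult; assumption.
      * nz th Hth; unfold n2x; field; auto.
Qed.

Lemma kinD_xv_W_vv d : d <> Du -> kinD d W_vv.
Proof.
  intros Hd; apply (kinD_ext d (fun th => - (n3u th * W_v th))).
  - apply kinD_opp, kinD_mult; [split; [apply kin_n3u|]|apply kinD_W_v].
    destruct d; [contradiction|apply kin_comm23|apply kin_comm13].
  - nz th Hth; unfold n3u; field; auto.
Qed.

Lemma kinD_xv_H_vv d : d <> Du -> kinD d H_vv.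
Proof.
  intros Hd; apply (kinD_ext d (fun th => n3x th * W_v th)).
  - apply kinD_mult; [split; [apply kin_n3x|]|apply kinD_W_v].
    destruct d; [contradiction|apply kin_comm23|apply kin_comm13].
  - nz th Hth; unfold n3x; field; auto.
Qed.

Lemma kinD_iW_vv d : kinD d W_vv -> kinD d (fun th => / W_vv th).
Proof. intros H; apply kinD_inv; [exact H|apply kin_iW_vv|intros th Hth; apply (Hreg th Hth)]. Qed.

(** * Closure of the ring under D_u, D_x and D_v in turn *)

Ltac kinD_tac :=
  repeat first
    [ assumption | apply kinD_W_v | apply kinD_iW_v | apply kinD_h | apply kinD_const
    | apply (kinD_iter _ _ _ iter_I1) | apply (kinD_iter _ _ _ iter_J1)
    | apply (kinD_iter _ _ _ iter_J2)
    | apply kinD_div | apply kinD_minus | apply kinD_plus | apply kinD_mult | apply kinD_opp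
    | apply kinD_pow ].

(** The J1 equation solved for W_uv and differentiated in v: D_v H = H_v belongs to Z, and D_v H_xv
    = D_x H_vv is known from the commutators. *)
Lemma kin_W_uvv : kin (evalc (cW 1 0 2)).
Proof.
  assert (E1 : kinD Dv W_vv) by (apply kinD_xv_W_vv; discriminate).
  assert (E2 : kinD Dv H_vv) by (apply kinD_xv_H_vv; discriminate).
  assert (E3 := kinD_iW_vv Dv E1).
  assert (E4 : kinD Dv var_H) by exact (kinD_crd Dv (cH 0 0 0) kin_H (kin_Z (cH 0 0 1) I)).
  assert (E5 : kinD Dv var_W) by exact (kinD_crd Dv (cW 0 0 0) kin_W kin_W_v).
  assert (E6 : kinD Dv H_xv).
  { apply (kinD_crd Dv (cH 0 1 1) kin_H_xv); change (kin (devalc Dx (cH 0 0 2))).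
    rewrite <- DD_crd; apply kinD_xv_H_vv; discriminate. }
  assert (E : kinD Dv W_uv).
  { apply (kinD_ext Dv (fun th => H_xv th - H_vv th * var_W th -
      (J1 th * var_h th - var_H th * W_vv th ^ 2 - H_vv th ^ 2 * var_h th) / W_vv th)).
    - kinD_tac.
    - intros th Hth; rewrite <- (H_xv_eq th Hth); ring. }
  destruct E as [_ E]; change (kin (devalc Dv (cW 1 0 1))); rewrite <- DD_crd; exact E.
Qed.

(** It suffices to treat Z and W_vv: the derivatives of invariants are covered by the frame, and
    those of the adjoined inverses by the quotient rule. *)
Lemma kinD_poly d :
  (forall c, isZ c -> kin (devalc d c)) -> kinD d W_vv ->
  forall F, kin F -> kin (DD d F).
Proof.
  intros HZ HW.
  assert (HI : kinD d (fun th => / I1 th)).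
  { apply kinD_inv; [apply (kinD_iter d 0), iter_I1|apply kin_iI1|intros th Hth; apply (I1_neq0 th Hth)]. }
  assert (HDl : kinD d Delta).
  { unfold Delta, det3.
    repeat first
    [ eapply kinD_iter; first [apply iter_1 | apply iter_2 | apply iter_3];
        first [exact iter_I1 | exact iter_J1 | exact iter_J2]
    | apply kinD_minus | apply kinD_plus | apply kinD_mult ]. }
  intros F (N & G & HG & E).
  assert (HK : kinD d G).
  { clear E; induction HG as [c|G HG|G K _ IH1 _ IH2|G K _ IH1 _ IH2].
    - apply kinD_const.
    - destruct HG as [c Hc|n G _ HG| | | |].
      + apply kinD_crd; [apply kin_Z, Hc|apply HZ, Hc].
      + apply (kinD_iter d n G HG).
      + apply kinD_iW_v.
      + apply kinD_iW_vv, HW.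
      + exact HI.
      + apply kinD_inv; [exact HDl|apply kin_iDelta|intros th Hth; apply (Hgen th Hth)].
    - apply kinD_plus; assumption.
    - apply kinD_mult; assumption. }
  apply (kinD_ext d G F HK); intros th Hth; symmetry; apply E, Hth.
Qed.

Lemma kin_Z_base d e : kin (devalc d (cB e)).
Proof. apply (kin_const (if dir_eq_dec d e then 1 else 0)). Qed.

(** All families in Z are closed under D_u except the single coordinate W_vv. *)
Lemma kin_Du F : kin F -> kin (DD Du F).
Proof.
  apply kinD_poly.
  - intros [e|i [|j] [|[|[|k]]]|[|i] [|j] [|[|[|k]]]|i j k] Hc; try contradiction;
      try apply kin_Z_base;
      first [exact kin_W_uvv
            | exact (kin_Z (cH (S i) 0 0) I) | exact (kin_Z (cH (S i) 0 1) I)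
            | exact (kin_Z (cH (S i) 0 2) I)
            | exact (kin_Z (cW 1 0 0) I) | exact (kin_Z (cW 1 0 1) I)
            | exact (kin_Z (cW 1 (S j) 0) I) | exact (kin_Z (cW 1 (S j) 1) I)
            | exact (kin_Z (cW (S (S i)) 0 0) I) | exact (kin_Z (cW (S (S i)) 0 1) I)
            | exact (kin_Z (cW (S (S i)) (S j) 0) I) | exact (kin_Z (cW (S (S i)) (S j) 1) I)].
  - exact (kinD_crd Du (cW 0 0 2) kin_W_vv kin_W_uvv).
Qed.

Lemma kin_h_u : kin (evalc (ch 1 0 0)).
Proof. change (kin (devalc Du (ch 0 0 0))); rewrite <- DD_crd; apply kin_Du, kin_h. Qed.

(** H_xv is taken from nabla_3 I1 rather than from J1: the latter contains H, whose x-derivative is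
    not yet known. The term h_u is admissible because D_u preserves the ring. *)
Lemma kinD_x_H_xv : kinD Dx H_xv.
Proof.
  assert (E1 : kinD Dx W_vv) by (apply kinD_xv_W_vv; discriminate).
  assert (E2 : kinD Dx H_vv) by (apply kinD_xv_H_vv; discriminate).
  assert (E3 := kinD_iW_vv Dx E1).
  assert (E4 : kinD Dx W_xv) by exact (kinD_crd Dx (cW 0 1 1) kin_W_xv (kin_Z (cW 0 2 1) I)).
  assert (E5 : kinD Dx var_W) by exact (kinD_crd Dx (cW 0 0 0) kin_W (kin_Z (cW 0 1 0) I)).
  assert (E6 : kinD Dx h_x).
  { refine (kinD_ext Dx _ _ _ h_x_eq); kinD_tac. }
  assert (E7 : kinD Dx (evalc (ch 1 0 0))).
  { apply (kinD_crd Dx (ch 1 0 0) kin_h_u); change (kin (devalc Du (ch 0 1 0))).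
    rewrite <- DD_crd; apply kin_Du, kin_h_x. }
  assert (E8 : kinD Dx (fun th => / var_h th)).
  { apply kinD_inv; [apply kinD_h|apply kin_ih|intros th Hth; apply (Dom_h q th Hth)]. }
  assert (E9 := kinD_iter Dx _ _ (iter_3 _ _ iter_I1)).
  apply (kinD_ext Dx (fun th =>
    (H_vv th * (2 * W_xv th * var_h th - W_v th * h_x th)
     + W_vv th * W_v th * evalc (ch 1 0 0) th - apply nabla3 I1 th * var_h th ^ 2)
    * (/ 2 * (/ var_h th * / W_vv th)))).
  - kinD_tac.
  - nz th Hth; rewrite (nabla3_I1 q Hreg th Hth); cbn [evalc]; field; auto.
Qed.

(** With D_x H_xv at hand, the J1 equation is now solved for H and differentiated in x. *)
Lemma kin_H_x : kin (evalc (cH 0 1 0)).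
Proof.
  assert (E1 : kinD Dx W_vv) by (apply kinD_xv_W_vv; discriminate).
  assert (E2 : kinD Dx H_vv) by (apply kinD_xv_H_vv; discriminate).
  assert (E3 := kinD_iW_vv Dx E1).
  assert (E4 : kinD Dx W_uv) by exact (kinD_crd Dx (cW 1 0 1) kin_W_uv (kin_Z (cW 1 1 1) I)).
  assert (E5 : kinD Dx var_W) by exact (kinD_crd Dx (cW 0 0 0) kin_W (kin_Z (cW 0 1 0) I)).
  assert (E6 := kinD_x_H_xv).
  assert (E : kinD Dx var_H).
  { apply (kinD_ext Dx (fun th =>
      (J1 th * var_h th - H_vv th ^ 2 * var_h th - (H_xv th - H_vv th * var_W th - W_uv th) * W_vv th)
      * (/ W_vv th * / W_vv th))).
    - kinD_tac.
    - nz th Hth; unfold J1; field; auto. }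
  destruct E as [_ E]; change (kin (devalc Dx (cH 0 0 0))); rewrite <- DD_crd; exact E.
Qed.

Lemma kin_H_u k i : kin (evalc (cH 0 1 k)) -> kin (evalc (cH i 1 k)).
Proof.
  intros H; induction i as [|i IH]; [exact H|].
  change (kin (devalc Du (cH i 1 k))); rewrite <- DD_crd; apply kin_Du, IH.
Qed.

(** Besides W_vv, what leaves Z are the coordinates of H along the curve; their x-derivatives are
    u-derivatives of H_x, H_xv, H_xvv. *)
Lemma kin_Dx F : kin F -> kin (DD Dx F).
Proof.
  assert (E1 : kinD Dx W_vv) by (apply kinD_xv_W_vv; discriminate).
  assert (E2 : kinD Dx H_vv) by (apply kinD_xv_H_vv; discriminate).
  assert (E3 : kin (evalc (cH 0 1 2))).
  { change (kin (devalc Dx (cH 0 0 2))); rewrite <- DD_crd; apply E2. }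
  assert (E4 : kin (evalc (cW 0 1 2))).
  { change (kin (devalc Dx (cW 0 0 2))); rewrite <- DD_crd; apply E1. }
  apply kinD_poly; [|exact E1].
  intros [e|i [|j] [|[|[|k]]]|[|i] [|j] [|[|[|k]]]|i j k] Hc; try contradiction;
    try apply kin_Z_base;
    first [exact E4 | exact (kin_H_u 0 i kin_H_x) | exact (kin_H_u 1 i kin_H_xv)
          | exact (kin_H_u 2 i E3)
          | exact (kin_Z (cW 0 1 0) I) | exact (kin_Z (cW 0 1 1) I)
          | exact (kin_Z (cW 0 (S (S j)) 0) I) | exact (kin_Z (cW 0 (S (S j)) 1) I)
          | exact (kin_Z (cW (S i) 1 0) I) | exact (kin_Z (cW (S i) 1 1) I)
          | exact (kin_Z (cW (S i) (S (S j)) 0) I) | exact (kin_Z (cW (S i) (S (S j)) 1) I)].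
Qed.

Lemma kin_ux (f : nat -> nat -> crd) :
  (forall i j, devalc Du (f i j) = evalc (f (S i) j)) ->
  (forall i j, devalc Dx (f i j) = evalc (f i (S j))) ->
  kin (evalc (f 0%nat 0%nat)) -> forall i j, kin (evalc (f i j)).
Proof.
  intros Hu Hx H0.
  assert (H1 : forall j, kin (evalc (f 0%nat j))).
  { induction j as [|j IH]; [exact H0|]; rewrite <- Hx, <- DD_crd; apply kin_Dx, IH. }
  intros i j; induction i as [|i IH]; [apply H1|]; rewrite <- Hu, <- DD_crd; apply kin_Du, IH.
Qed.

(** The derivatives of W_v over the surface lead to those of W_vv, which D_u and D_x, already known
    to preserve the ring, produce from W_vv; likewise those of H_vvv. *)
Lemma kin_Dv F : kin F -> kin (DD Dv F).
Proof.
  assert (E1 : kinD Dv W_vv) by (apply kinD_xv_W_vv; discriminate).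
  assert (E2 : kinD Dv H_vv) by (apply kinD_xv_H_vv; discriminate).
  assert (E3 : kin (evalc (cW 0 0 3))).
  { change (kin (devalc Dv (cW 0 0 2))); rewrite <- DD_crd; apply E1. }
  assert (E4 : kin (evalc (cH 0 0 3))).
  { change (kin (devalc Dv (cH 0 0 2))); rewrite <- DD_crd; apply E2. }
  assert (KW : forall i j, kin (evalc (cW i j 2))).
  { apply (kin_ux (fun i j => cW i j 2)); [reflexivity|reflexivity|exact kin_W_vv]. }
  assert (KH : forall i j, kin (evalc (cH i j 3))).
  { apply (kin_ux (fun i j => cH i j 3)); [reflexivity|reflexivity|exact E4]. }
  apply kinD_poly; [|exact E1].
  intros [e|i [|j] [|[|[|k]]]|[|i] [|j] [|[|[|k]]]|i j k] Hc; try contradiction;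
    try apply kin_Z_base;
    first [exact E3 | exact (KH i 0%nat)
          | exact (kin_Z (cH i 0 1) I) | exact (kin_Z (cH i 0 2) I)
          | exact (KW 0%nat 0%nat) | exact (KW 0%nat (S j)) | exact (KW (S i) 0%nat)
          | exact (KW (S i) (S j))
          | exact (kin_Z (cW 0 0 1) I) | exact (kin_Z (cW 0 (S j) 1) I)
          | exact (kin_Z (cW (S i) 0 1) I) | exact (kin_Z (cW (S i) (S j) 1) I)].
Qed.

Lemma kin_uxv (f : nat -> nat -> nat -> crd) :
  (forall i j k, devalc Du (f i j k) = evalc (f (S i) j k)) ->
  (forall i j k, devalc Dx (f i j k) = evalc (f i (S j) k)) ->
  (forall i j k, devalc Dv (f i j k) = evalc (f i j (S k))) ->
  kin (evalc (f 0%nat 0%nat 0%nat)) -> forall i j k, kin (evalc (f i j k)).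
Proof.
  intros Hu Hx Hv H0 i j k.
  apply (kin_ux (fun i j => f i j k)); auto; clear i j.
  induction k as [|k IH]; [exact H0|]; rewrite <- Hv, <- DD_crd; apply kin_Dv, IH.
Qed.

Lemma kin_crd c : kin (evalc c).
Proof.
  destruct c as [e|i j k|i j k|i j k].
  - apply kin_Z; exact I.
  - apply (kin_uxv cH); try reflexivity; exact kin_H.
  - apply (kin_uxv cW); try reflexivity; exact kin_W.
  - apply (kin_uxv ch); try reflexivity; exact kin_h.
Qed.

End Generic.

(** * Invariance *)

Lemma point_eq (a b c a' b' c' : R) : a = a' -> b = b' -> c = c' -> (a, b, c) = (a', b', c').
Proof. intros -> -> ->; reflexivity. Qed.

(** Smoothness and the value of the derivative in one judgement, so that [isP_tac] can synthesise l
    from the shape of f. *)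
Definition isP (d : dir) (f : point -> R) (p : point) (l : R) : Prop :=
  smooth_at p f /\ pdd d f p = l.

Lemma isP_self d f p : smooth_at p f -> isP d f p (pdd d f p).
Proof. split; [assumption|reflexivity]. Qed.

Lemma isP_const d c p : isP d (fun _ => c) p 0.
Proof. split; [apply smooth_at_const|now rewrite pdd_const]. Qed.

Lemma isP_plus d f g p l m :
  isP d f p l -> isP d g p m -> isP d (fun q => f q + g q) p (l + m).
Proof.
  intros [F <-] [G <-]; split; [apply smooth_at_plus; assumption|apply pdd_plus; assumption].
Qed.

Lemma isP_mult d f g p l m :
  isP d f p l -> isP d g p m -> isP d (fun q => f q * g q) p (l * g p + f p * m).
Proof.
  intros [F <-] [G <-]; split; [apply smooth_at_mult; assumption|apply pdd_mult; assumption].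
Qed.

Lemma isP_pow2 d f p l : isP d f p l -> isP d (fun q => f q ^ 2) p (2 * f p * l).
Proof.
  intros H; destruct (isP_mult d f f p l l H H) as [S E].
  replace (fun q => f q ^ 2) with (fun q => f q * f q)
    by (fext q; ring).
  split; [exact S|rewrite E; ring].
Qed.

Lemma isP_comp d f phi p l m n :
  map_smooth_at p phi -> smooth_at (phi p) f ->
  pdd d (fun q => pu (phi q)) p = l -> pdd d (fun q => px (phi q)) p = m ->
  pdd d (fun q => pv (phi q)) p = n ->
  isP d (fun q => f (phi q)) p (pd_u f (phi p) * l + pd_x f (phi p) * m + pd_v f (phi p) * n).
Proof.
  intros H1 H2 <- <- <-; split; [apply smooth_at_comp; assumption|apply pdd_comp; assumption].
Qed.

Lemma isP_eq d f g p l m :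
  locally p (fun q => f q = g q) -> isP d g p l -> l = m -> pdd d f p = m.
Proof. intros H [_ E] <-; rewrite <- E; apply pdd_ext_loc, H. Qed.

(** * Transformation of the low order jet coordinates *)

Section Pair.

Variable phi : point -> point.

Definition Cf (q : point) : R := pu (phi q).
Definition Af (q : point) : R := px (phi q).
Definition Vf (q : point) : R := pv (phi q).

(* The equations characterising the local diffeomorphisms of the pseudogroup. *)
Definition frame_eqs (q : point) : Prop :=
  pd_x Cf q = 0 /\ pd_v Cf q = 0 /\ pd_v Af q = 0 /\ pd_v Vf q * pd_u Cf q = 1 /\
  pd_x Af q <> 0.

(** The coefficients of du^2, du dx and dx^2 in the pulled back metric when C_x = C_v = A_v = 0;
    that of du dv is V_v C_u = 1. *)
Definition pullback (s : fields) : fields := mkFields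
  (fun q => pd_u Cf q * (pd_u Vf q + fH s (phi q) * pd_u Cf q + fW s (phi q) * pd_u Af q)
            + fh s (phi q) * pd_u Af q ^ 2)
  (fun q => pd_u Cf q * (pd_x Vf q + fW s (phi q) * pd_x Af q)
            + 2 * fh s (phi q) * pd_u Af q * pd_x Af q)
  (fun q => fh s (phi q) * pd_x Af q ^ 2).

(** Only the target section is given; the source is its pull-back by construction. *)
Definition kpair (s' : fields) (p : point) : Prop :=
  map_smooth_at p phi /\ locally p frame_eqs /\ ksec s' (phi p).

Lemma kpair_loc s' p : kpair s' p -> locally p (kpair s').
Proof.
  intros (H1 & H2 & H3).
  assert (H4 : locally p (fun q => ksec s' (phi q)))
    by exact (map_smooth_continuous p phi H1 _ (ksec_loc _ _ H3)).
  apply locally_locally in H2.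
  generalize (filter_and _ _ (map_smooth_at_loc p phi H1) (filter_and _ _ H2 H4)).
  apply filter_imp; intros q (A & B & D); split; auto.
Qed.

Section At.

Variables (s' : fields).
Notation s := (pullback s').

Lemma smooth_Cf p : kpair s' p -> smooth_at p Cf. Proof. intros (H & _); exact (H Du). Qed.
Lemma smooth_Af p : kpair s' p -> smooth_at p Af. Proof. intros (H & _); exact (H Dx). Qed.
Lemma smooth_Vf p : kpair s' p -> smooth_at p Vf. Proof. intros (H & _); exact (H Dv). Qed.

Lemma kpair_frame p : kpair s' p -> frame_eqs p.
Proof. intros (_ & H & _); apply (locally_singleton p frame_eqs H). Qed.

(** As [kpair] is an open condition, an identity valid at every such point may be differentiated;
    the formulas for higher coordinates are obtained in this way from the lower ones. *)
Lemma kpair_eq (f g : point -> R) d p l m :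
  (forall q, kpair s' q -> f q = g q) -> kpair s' p -> isP d g p l -> l = m -> pdd d f p = m.
Proof.
  intros H Hp; apply isP_eq.
  generalize (kpair_loc s' p Hp); apply filter_imp; exact H.
Qed.

Lemma C_x p : kpair s' p -> pd_x Cf p = 0. Proof. intros H; apply kpair_frame, H. Qed.
Lemma C_v p : kpair s' p -> pd_v Cf p = 0. Proof. intros H; apply kpair_frame, H. Qed.
Lemma A_v p : kpair s' p -> pd_v Af p = 0. Proof. intros H; apply kpair_frame, H. Qed.
Lemma V_v p : kpair s' p -> pd_v Vf p * pd_u Cf p = 1. Proof. intros H; apply kpair_frame, H. Qed.
Lemma A_x p : kpair s' p -> pd_x Af p <> 0. Proof. intros H; apply kpair_frame, H. Qed.

Lemma C_u_neq0 p : kpair s' p -> pd_u Cf p <> 0.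
Proof. intros H E; generalize (V_v p H); rewrite E; lra. Qed.

Lemma pdd_zero (f : point -> R) d p :
  (forall q, kpair s' q -> f q = 0) -> kpair s' p -> pdd d f p = 0.
Proof. intros H Hp; apply (kpair_eq f (fun _ => 0) d p 0 0 H Hp); [apply isP_const|reflexivity]. Qed.

Lemma C_ux p : kpair s' p -> pdd Dx (pd_u Cf) p = 0.
Proof.
  intros H; eapply eq_trans; [exact (pdd_comm Dx Du p Cf (smooth_Cf p H))|].
  apply (pdd_zero (pd_x Cf)); [apply C_x|exact H].
Qed.

Lemma C_uv p : kpair s' p -> pdd Dv (pd_u Cf) p = 0.
Proof.
  intros H; eapply eq_trans; [exact (pdd_comm Dv Du p Cf (smooth_Cf p H))|].
  apply (pdd_zero (pd_v Cf)); [apply C_v|exact H].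
Qed.

Lemma C_uux p : kpair s' p -> pdd Dx (pd_u (pd_u Cf)) p = 0.
Proof.
  intros H; eapply eq_trans; [exact (pdd_comm Dx Du p (pd_u Cf) (smooth_at_pdd p Du _ (smooth_Cf p H)))|].
  apply (pdd_zero (pd_x (pd_u Cf))); [apply C_ux|exact H].
Qed.

Lemma C_uuv p : kpair s' p -> pdd Dv (pd_u (pd_u Cf)) p = 0.
Proof.
  intros H; eapply eq_trans; [exact (pdd_comm Dv Du p (pd_u Cf) (smooth_at_pdd p Du _ (smooth_Cf p H)))|].
  apply (pdd_zero (pd_v (pd_u Cf))); [apply C_uv|exact H].
Qed.

Lemma A_dv d p : kpair s' p -> pdd Dv (pdd d Af) p = 0.
Proof.
  intros H; eapply eq_trans; [exact (pdd_comm Dv d p Af (smooth_Af p H))|].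
  apply (pdd_zero (pd_v Af)); [apply A_v|exact H].
Qed.

Lemma A_xv p : kpair s' p -> pdd Dv (pd_x Af) p = 0. Proof. exact (A_dv Dx p). Qed.
Lemma A_uv p : kpair s' p -> pdd Dv (pd_u Af) p = 0. Proof. exact (A_dv Du p). Qed.

Lemma V_dv d p : kpair s' p ->
  pdd d (pd_v Vf) p * pd_u Cf p + pd_v Vf p * pdd d (pd_u Cf) p = 0.
Proof.
  intros H.
  assert (S1 : smooth_at p (pd_v Vf)) by exact (smooth_at_pdd p Dv _ (smooth_Vf p H)).
  assert (S2 : smooth_at p (pd_u Cf)) by exact (smooth_at_pdd p Du _ (smooth_Cf p H)).
  rewrite <- (pdd_mult p _ _ d S1 S2).
  apply (kpair_eq _ (fun _ => 1) d p 0 0); [intros q Hq; apply V_v, Hq|exact H|apply isP_const|reflexivity].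
Qed.

Lemma V_xv p : kpair s' p -> pdd Dv (pd_x Vf) p = 0.
Proof.
  intros H; eapply eq_trans; [exact (pdd_comm Dv Dx p Vf (smooth_Vf p H))|].
  generalize (V_dv Dx p H).
  rewrite (C_ux p H), Rmult_0_r, Rplus_0_r; intros E.
  apply Rmult_integral in E; destruct E as [E | E]; [exact E|destruct (C_u_neq0 p H E)].
Qed.

Lemma V_vx p : kpair s' p -> pdd Dx (pd_v Vf) p = 0.
Proof. intros H; eapply eq_trans; [exact (pdd_comm Dx Dv p Vf (smooth_Vf p H))|]; apply V_xv, H. Qed.

Lemma V_vv p : kpair s' p -> pdd Dv (pd_v Vf) p = 0.
Proof.
  intros H; generalize (V_dv Dv p H); rewrite (C_uv p H), Rmult_0_r, Rplus_0_r; intros E.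
  apply Rmult_integral in E; destruct E as [E | E]; [exact E|destruct (C_u_neq0 p H E)].
Qed.

Lemma V_uv p : kpair s' p -> pdd Dv (pd_u Vf) p * pd_u Cf p = - (pd_v Vf p * pd_u (pd_u Cf) p).
Proof.
  intros H; assert (E : pdd Dv (pd_u Vf) p = pdd Du (pd_v Vf) p)
    by exact (pdd_comm Dv Du p Vf (smooth_Vf p H)).
  rewrite E; generalize (V_dv Du p H); cbn [pdd]; lra.
Qed.

Lemma isP_comp_v f p : kpair s' p -> smooth_at (phi p) f ->
  isP Dv (fun q => f (phi q)) p (pd_v f (phi p) * pd_v Vf p).
Proof.
  intros H Hf; destruct (isP_comp Dv f phi p 0 0 (pd_v Vf p) (proj1 H) Hf (C_v p H) (A_v p H) eq_refl)
    as [S E]; split; [exact S|rewrite E; ring].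
Qed.

Lemma isP_comp_x f p : kpair s' p -> smooth_at (phi p) f ->
  isP Dx (fun q => f (phi q)) p (pd_x f (phi p) * pd_x Af p + pd_v f (phi p) * pd_x Vf p).
Proof.
  intros H Hf; destruct (isP_comp Dx f phi p 0 (pd_x Af p) (pd_x Vf p) (proj1 H) Hf (C_x p H)
    eq_refl eq_refl) as [S E]; split; [exact S|rewrite E; ring].
Qed.

Lemma isP_comp_u f p : kpair s' p -> smooth_at (phi p) f ->
  isP Du (fun q => f (phi q)) p
    (pd_u f (phi p) * pd_u Cf p + pd_x f (phi p) * pd_u Af p + pd_v f (phi p) * pd_u Vf p).
Proof. intros H Hf; apply (isP_comp Du f phi p); try reflexivity; [apply H|exact Hf]. Qed.

Lemma smooth_fH p : kpair s' p -> smooth_at (phi p) (fH s'). Proof. intros (_ & _ & H); apply H. Qed.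
Lemma smooth_fW p : kpair s' p -> smooth_at (phi p) (fW s'). Proof. intros (_ & _ & H); apply H. Qed.
Lemma smooth_fh p : kpair s' p -> smooth_at (phi p) (fh s'). Proof. intros (_ & _ & H); apply H. Qed.
Lemma fh_v p : kpair s' p -> pd_v (fh s') (phi p) = 0.
Proof.
  intros (_ & _ & (_ & _ & _ & _ & H)); apply (locally_singleton _ (fun r => pd_v (fh s') r = 0) H).
Qed.

Ltac sm H :=
  match goal with
  | |- smooth_at _ Cf => apply (smooth_Cf _ H)
  | |- smooth_at _ Af => apply (smooth_Af _ H)
  | |- smooth_at _ Vf => apply (smooth_Vf _ H)
  | |- smooth_at _ (fH s') => apply (smooth_fH _ H)
  | |- smooth_at _ (fW s') => apply (smooth_fW _ H)
  | |- smooth_at _ (fh s') => apply (smooth_fh _ H)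
  | |- smooth_at ?p (pd_u ?f) => apply (smooth_at_pdd p Du f); sm H
  | |- smooth_at ?p (pd_x ?f) => apply (smooth_at_pdd p Dx f); sm H
  | |- smooth_at ?p (pd_v ?f) => apply (smooth_at_pdd p Dv f); sm H
  end.

Ltac isP_tac H :=
  lazymatch goal with
  | |- isP _ (fun _ => ?c) _ _ => apply isP_const
  | |- isP _ (fun q => @?a q + @?b q) _ _ => eapply isP_plus; isP_tac H
  | |- isP _ (fun q => @?a q * @?b q) _ _ => eapply isP_mult; isP_tac H
  | |- isP _ (fun q => @?a q ^ 2) _ _ => eapply isP_pow2; isP_tac H
  | |- isP Dv (fun q => ?f (phi q)) _ _ => apply (isP_comp_v f _ H); sm H
  | |- isP Dx (fun q => ?f (phi q)) _ _ => apply (isP_comp_x f _ H); sm H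
  | |- isP Du (fun q => ?f (phi q)) _ _ => apply (isP_comp_u f _ H); sm H
  | |- isP _ ?f _ _ => apply isP_self; sm H
  end.

Lemma pullback_h_v p : kpair s' p -> pd_v (fh s) p = 0.
Proof.
  intros H; eapply (kpair_eq _ (fun q => fh s' (phi q) * pd_x Af q ^ 2) Dv p _ 0
    (fun q _ => eq_refl) H); [isP_tac H|].
  rewrite (fh_v p H), (A_xv p H); ring.
Qed.

Lemma pullback_h_x p : kpair s' p -> pd_x (fh s) p =
  pd_x (fh s') (phi p) * pd_x Af p ^ 3 + 2 * fh s' (phi p) * pd_x Af p * pd_x (pd_x Af) p.
Proof.
  intros H; eapply (kpair_eq _ (fun q => fh s' (phi q) * pd_x Af q ^ 2) Dx p _ _
    (fun q _ => eq_refl) H); [isP_tac H|].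
  rewrite (fh_v p H); cbn [pdd]; ring.
Qed.

Lemma pullback_W_v p : kpair s' p -> pd_v (fW s) p = pd_x Af p * pd_v (fW s') (phi p).
Proof.
  intros H; eapply (kpair_eq _ (fun q => pd_u Cf q * (pd_x Vf q + fW s' (phi q) * pd_x Af q)
            + 2 * fh s' (phi q) * pd_u Af q * pd_x Af q) Dv p _ _
    (fun q _ => eq_refl) H); [isP_tac H|].
  rewrite (fh_v p H), (C_uv p H), (V_xv p H), (A_xv p H), (A_uv p H).
  (* Regrouped to exhibit the product V_v C_u, which equals 1. *)
  transitivity (pd_v Vf p * pd_u Cf p * (pd_x Af p * pd_v (fW s') (phi p))); [ring|].
  rewrite (V_v p H); ring.
Qed.

Lemma pullback_W_vv p : kpair s' p ->
  pd_v (pd_v (fW s)) p = pd_x Af p * (pd_v (pd_v (fW s')) (phi p) * pd_v Vf p).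
Proof.
  intros H; eapply (kpair_eq _ (fun q => pd_x Af q * pd_v (fW s') (phi q)) Dv p _ _ pullback_W_v H);
    [isP_tac H|].
  rewrite (A_xv p H); ring.
Qed.

Lemma pullback_W_xv p : kpair s' p ->
  pd_x (pd_v (fW s)) p = pd_x (pd_x Af) p * pd_v (fW s') (phi p) +
    pd_x Af p * (pd_x (pd_v (fW s')) (phi p) * pd_x Af p + pd_v (pd_v (fW s')) (phi p) * pd_x Vf p).
Proof.
  intros H; eapply (kpair_eq _ (fun q => pd_x Af q * pd_v (fW s') (phi q)) Dx p _ _ pullback_W_v H);
    [isP_tac H|]; reflexivity.
Qed.

Lemma pullback_W_uv p : kpair s' p ->
  pd_u (pd_v (fW s)) p = pd_u (pd_x Af) p * pd_v (fW s') (phi p) +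
    pd_x Af p * (pd_u (pd_v (fW s')) (phi p) * pd_u Cf p + pd_x (pd_v (fW s')) (phi p) * pd_u Af p
      + pd_v (pd_v (fW s')) (phi p) * pd_u Vf p).
Proof.
  intros H; eapply (kpair_eq _ (fun q => pd_x Af q * pd_v (fW s') (phi q)) Du p _ _ pullback_W_v H);
    [isP_tac H|]; reflexivity.
Qed.

(** The first term stems from C_u V_uv = - V_v C_uu, the u-derivative of V_v C_u = 1. *)
Lemma pullback_H_v p : kpair s' p ->
  pd_v (fH s) p = -1 * (pd_v Vf p * pd_u (pd_u Cf) p) + pd_u Cf p * pd_v (fH s') (phi p)
    + pd_v (fW s') (phi p) * pd_u Af p.
Proof.
  intros H; eapply (kpair_eq _ (fun q => pd_u Cf q * (pd_u Vf q + fH s' (phi q) * pd_u Cf q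
    + fW s' (phi q) * pd_u Af q) + fh s' (phi q) * pd_u Af q ^ 2) Dv p _ _
    (fun q _ => eq_refl) H); [isP_tac H|].
  rewrite (fh_v p H), (C_uv p H), (A_uv p H).
  transitivity (pdd Dv (pd_u Vf) p * pd_u Cf p + pd_v Vf p * pd_u Cf p *
    (pd_u Cf p * pd_v (fH s') (phi p) + pd_v (fW s') (phi p) * pd_u Af p)); [ring|].
  rewrite (V_uv p H), (V_v p H); ring.
Qed.

Lemma pullback_H_vv p : kpair s' p ->
  pd_v (pd_v (fH s)) p = pd_v (pd_v (fH s')) (phi p) +
    pd_v (pd_v (fW s')) (phi p) * pd_v Vf p * pd_u Af p.
Proof.
  intros H; eapply (kpair_eq _ (fun q => -1 * (pd_v Vf q * pd_u (pd_u Cf) q)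
    + pd_u Cf q * pd_v (fH s') (phi q) + pd_v (fW s') (phi q) * pd_u Af q) Dv p _ _ pullback_H_v H);
    [isP_tac H|].
  rewrite (C_uv p H), (C_uuv p H), (V_vv p H), (A_uv p H).
  transitivity (pd_v Vf p * pd_u Cf p * pd_v (pd_v (fH s')) (phi p) +
    pd_v (pd_v (fW s')) (phi p) * pd_v Vf p * pd_u Af p); [ring|].
  rewrite (V_v p H); ring.
Qed.

Lemma pullback_H_xv p : kpair s' p ->
  pd_x (pd_v (fH s)) p =
    pd_u Cf p * (pd_x (pd_v (fH s')) (phi p) * pd_x Af p + pd_v (pd_v (fH s')) (phi p) * pd_x Vf p) +
    (pd_x (pd_v (fW s')) (phi p) * pd_x Af p + pd_v (pd_v (fW s')) (phi p) * pd_x Vf p) * pd_u Af p +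
    pd_v (fW s') (phi p) * pd_u (pd_x Af) p.
Proof.
  intros H; eapply (kpair_eq _ (fun q => -1 * (pd_v Vf q * pd_u (pd_u Cf) q)
    + pd_u Cf q * pd_v (fH s') (phi q) + pd_v (fW s') (phi q) * pd_u Af q) Dx p _ _ pullback_H_v H);
    [isP_tac H|].
  assert (E : pdd Dx (pd_u Af) p = pd_u (pd_x Af) p) by exact (pdd_comm Dx Du p Af (smooth_Af p H)).
  rewrite (C_ux p H), (C_uux p H), (V_vx p H), E; ring.
Qed.

Lemma ksec_pullback p : kpair s' p -> ksec s p.
Proof.
  intros H.
  assert (Hc : forall f, smooth_at (phi p) f -> smooth_at p (fun q => f (phi q)))
    by (intros f; apply smooth_at_comp, H).
  split; [|split; [|split; [|split]]].
  1-3: cbn [pullback fH fW fh]; repeat first [apply smooth_at_plus | apply smooth_at_pow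
    | apply smooth_at_mult | apply smooth_at_const | apply Hc | sm H].
  - cbn; apply Rmult_lt_0_compat; [apply H|].
    generalize (A_x p H); intros HA; nra.
  - generalize (kpair_loc s' p H); apply filter_imp; apply pullback_h_v.
Qed.

Lemma reg_pullback p : kpair s' p ->
  W_v (jet_of s p) <> 0 -> W_vv (jet_of s p) <> 0 ->
  W_v (jet_of s' (phi p)) <> 0 /\ W_vv (jet_of s' (phi p)) <> 0.
Proof.
  intros H; change (pd_v (fW s) p <> 0 -> pd_v (pd_v (fW s)) p <> 0 ->
    pd_v (fW s') (phi p) <> 0 /\ pd_v (pd_v (fW s')) (phi p) <> 0).
  rewrite (pullback_W_v p H), (pullback_W_vv p H); intros H1 H2; split; intros E; rewrite E in *; lra.
Qed.

Lemma jets_pullback p (th := jet_of s p) (th' := jet_of s' (phi p))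
  (au := pd_u Af p) (ax := pd_x Af p) (axx := pd_x (pd_x Af) p) (aux := pd_u (pd_x Af) p)
  (cu := pd_u Cf p) (vu := pd_u Vf p) (vx := pd_x Vf p) (vv := pd_v Vf p) :
  kpair s' p ->
  (var_h th = var_h th' * ax ^ 2 /\
   var_W th = cu * (vx + var_W th' * ax) + 2 * var_h th' * au * ax /\
   var_H th = cu * (vu + var_H th' * cu + var_W th' * au) + var_h th' * au ^ 2) /\
  (h_x th = h_x th' * ax ^ 3 + 2 * var_h th' * ax * axx /\
   W_v th = ax * W_v th' /\ W_vv th = ax * (W_vv th' * vv) /\
   W_xv th = axx * W_v th' + ax * (W_xv th' * ax + W_vv th' * vx) /\
   W_uv th = aux * W_v th' + ax * (W_uv th' * cu + W_xv th' * au + W_vv th' * vu)) /\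
  (H_vv th = H_vv th' + W_vv th' * vv * au /\
   H_xv th = cu * (H_xv th' * ax + H_vv th' * vx) + (W_xv th' * ax + W_vv th' * vx) * au
     + W_v th' * aux).
Proof.
  intros H; split; [|split].
  - repeat split; reflexivity.
  - exact (conj (pullback_h_x p H) (conj (pullback_W_v p H) (conj (pullback_W_vv p H) (conj (pullback_W_xv p H) (pullback_W_uv p H))))).
  - exact (conj (pullback_H_vv p H) (pullback_H_xv p H)).
Qed.

(** V_v is eliminated in favour of / C_u, so that the remaining identities hold for independent
    quantities and [field] decides them. *)
Ltac use_jets p H :=
  let N := fresh "N" in let NC := fresh "NC" in let NA := fresh "NA" in let Nh := fresh "Nh" in
  let EV := fresh "EV" in
  assert (NC := C_u_neq0 p H); assert (NA := A_x p H); assert (EV := V_v p H);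
  assert (EV' : pd_v Vf p = / pd_u Cf p) by
    (apply (Rmult_eq_reg_r (pd_u Cf p)); [rewrite EV, Rinv_l; auto|exact NC]);
  clear EV;
  assert (Nh : var_h (jet_of s' (phi p)) <> 0) by (apply Rgt_not_eq; apply H);
  destruct (jets_pullback p H) as
    ((Eh & EW & EH) & (Ehx & EWv & EWvv & EWxv & EWuv) & (EHvv & EHxv));
  rewrite EV' in *; clear EV'.

Lemma invariant_I1 p : kpair s' p -> I1 (jet_of s p) = I1 (jet_of s' (phi p)).
Proof. intros H; use_jets p H; unfold I1; rewrite Eh, EWv; field; auto. Qed.

Lemma invariant_J1 p : kpair s' p -> J1 (jet_of s p) = J1 (jet_of s' (phi p)).
Proof.
  intros H; use_jets p H; unfold J1; rewrite Eh, EH, EW, EHvv, EHxv, EWuv, EWvv; field; auto.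
Qed.

Lemma invariant_J2 p : kpair s' p -> J2 (jet_of s p) = J2 (jet_of s' (phi p)).
Proof.
  intros H; use_jets p H; unfold J2; rewrite Eh, EW, EHvv, EWxv, EWvv, EWv, Ehx; field; auto.
Qed.

Lemma tangent_map_pair p xi : kpair s' p ->
  tangent_map phi p xi =
  (pd_u Cf p * pu xi, pd_u Af p * pu xi + pd_x Af p * px xi,
   pd_u Vf p * pu xi + pd_x Vf p * px xi + pd_v Vf p * pv xi).
Proof.
  intros H; unfold tangent_map, differential; fold Cf Af Vf.
  rewrite (C_x p H), (C_v p H), (A_v p H); apply point_eq; ring.
Qed.

Lemma invariant_nabla X p : kpair s' p -> In X Ns ->
  W_v (jet_of s p) <> 0 -> W_vv (jet_of s p) <> 0 ->
  tangent_map phi p (X (jet_of s p)) = X (jet_of s' (phi p)).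
Proof.
  intros H HX N1 N2; destruct (reg_pullback p H N1 N2) as [N1' N2']; clear N1 N2.
  rewrite (tangent_map_pair p _ H); use_jets p H.
  destruct HX as [<- | [<- | [<- | []]]]; unfold nabla1, nabla2, nabla3, pu, px, pv; cbn [fst snd];
    apply point_eq; rewrite ?Eh, ?EHvv, ?EHxv, ?EWuv, ?EWxv, ?EWvv, ?EWv, ?Ehx;
    field; auto.
Qed.

End At.

End Pair.

(** * Invariance of the iterated derivatives *)

Definition qreg (th : jet) : R := W_v th * W_vv th.

Lemma jet_poly_qreg : jet_poly 2 qreg.
Proof.
  apply poly_mul; [apply (jet_poly_le 1); [lia|]; exact (jet_poly_crd (cW 0 0 1))
    |exact (jet_poly_crd (cW 0 0 2))].
Qed.

Lemma qreg_neq0 th : qreg th <> 0 <-> W_v th <> 0 /\ W_vv th <> 0.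
Proof.
  unfold qreg; split; [|intros [H1 H2]; apply Rmult_neq_0; tauto].
  intros H; split; intros E; apply H; rewrite E; ring.
Qed.

Lemma Dom_qreg th : Dom qreg th -> W_v th <> 0 /\ W_vv th <> 0.
Proof. intros [_ H]; apply qreg_neq0, H. Qed.

(** By induction F takes equal values along the two sections at corresponding points near p, so the
    chain rule relates its total derivatives at both jets, and [invariant_nabla] matches the
    coefficients of X. *)
Lemma invariant_iterated n F : iterated Is Ns n F ->
  forall phi s' p, kpair phi s' p -> qreg (jet_of (pullback phi s') p) <> 0 ->
  F (jet_of (pullback phi s') p) = F (jet_of s' (phi p)).
Proof.
  induction 1 as [F HF|n X F HX HF IH]; intros phi s' p H Hr.
  - destruct HF as [<- | [<- | [<- | []]]];
      [apply invariant_I1|apply invariant_J1|apply invariant_J2]; exact H.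
  - assert (RF := rat_iterated 2 qreg jet_poly_qreg Dom_qreg n F HF).
    destruct (proj1 (qreg_neq0 _) Hr) as [N1 N2].
    assert (Hr' : qreg (jet_of s' (phi p)) <> 0)
      by (apply qreg_neq0, (reg_pullback phi s' p H N1 N2)).
    assert (Hs := ksec_pullback phi s' p H); assert (Hs' := proj2 (proj2 H)).
    destruct (rat_section 2 qreg jet_poly_qreg _ F p RF Hs Hr) as [_ D].
    destruct (rat_section 2 qreg jet_poly_qreg _ F (phi p) RF Hs' Hr') as [S' D'].
    assert (Hl : locally p (fun r => F (jet_of (pullback phi s') r) = F (jet_of s' (phi r)))).
    { generalize (filter_and _ _ (kpair_loc phi s' p H) (Dom_section 2 qreg jet_poly_qreg _ p Hs Hr)).
      apply filter_imp; intros r (K1 & _ & K2); apply IH; [exact K1|apply K2]. }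
    assert (E : forall d, DD d F (jet_of (pullback phi s') p) =
      DD Du F (jet_of s' (phi p)) * pdd d (fun q => pu (phi q)) p +
      DD Dx F (jet_of s' (phi p)) * pdd d (fun q => px (phi q)) p +
      DD Dv F (jet_of s' (phi p)) * pdd d (fun q => pv (phi q)) p).
    { intros d; rewrite <- D, <- !D'.
      eapply eq_trans; [exact (pdd_ext_loc d _ _ p Hl)|].
      apply (pdd_comp p phi (fun r => F (jet_of s' r)) d (proj1 H) S'). }
    assert (T := invariant_nabla phi s' X p H HX N1 N2).
    unfold apply at 2; rewrite <- T; unfold apply.
    change D_u with (DD Du); change D_x with (DD Dx); change D_v with (DD Dv).
    rewrite !E; unfold tangent_map, differential; cbn [pu px pv fst snd pdd]; ring.
Qed.

(** ** From prolonged diffeomorphisms to pairs of sections with [h_v = 0] *)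

(** The components of phi are constant along the relevant coordinate lines inside U. The remaining
    equation V_v C_u = 1 is extracted from the metric in [metric_pullback]. *)
Lemma frame_eqs_in_G U phi p : in_G U phi -> U p ->
  (forall q, U q -> pd_x (Cf phi) q = 0 /\ pd_v (Cf phi) q = 0 /\ pd_v (Af phi) q = 0 /\
    pd_x (Af phi) q <> 0).
Proof.
  intros (HU & _ & _ & _ & c & a & b & HG) _ [[u x] v] Hq.
  assert (Hx : locally x (fun t => U (u, t, v))) by exact (locally_up Dx (u, x, v) U (HU _ Hq)).
  assert (Hv : locally v (fun t => U (u, x, t))) by exact (locally_up Dv (u, x, v) U (HU _ Hq)).
  destruct (HG u x v Hq) as (_ & HA & _).
  split; [|split; [|split]].
  - transitivity (Derive (fun _ : R => c u) x); [|apply Derive_const].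
    apply Derive_ext_loc; revert Hx; apply filter_imp; intros t Ht.
    unfold Cf, pu, px, pv; cbn [fst snd]; destruct (HG u t v Ht) as (_ & _ & ->); reflexivity.
  - transitivity (Derive (fun _ : R => c u) v); [|apply Derive_const].
    apply Derive_ext_loc; revert Hv; apply filter_imp; intros t Ht.
    unfold Cf, pu, px, pv; cbn [fst snd]; destruct (HG u x t Ht) as (_ & _ & ->); reflexivity.
  - transitivity (Derive (fun _ : R => a u x) v); [|apply Derive_const].
    apply Derive_ext_loc; revert Hv; apply filter_imp; intros t Ht.
    unfold Af, pu, px, pv; cbn [fst snd]; destruct (HG u x t Ht) as (_ & _ & ->); reflexivity.
  - intros E; apply HA; rewrite <- E.
    apply Derive_ext_loc; revert Hx; apply filter_imp; intros t Ht.
    unfold Af, pu, px, pv; cbn [fst snd]; destruct (HG u t v Ht) as (_ & _ & ->); reflexivity.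
Qed.

Lemma metric_pullback phi s s' q :
  pd_x (Cf phi) q = 0 -> pd_v (Cf phi) q = 0 -> pd_v (Af phi) q = 0 ->
  (forall xi, metric s q xi = metric s' (phi q) (tangent_map phi q xi)) ->
  pd_v (Vf phi) q * pd_u (Cf phi) q = 1 /\ fH s q = fH (pullback phi s') q /\
  fW s q = fW (pullback phi s') q /\ fh s q = fh (pullback phi s') q.
Proof.
  intros Cx Cv Av H.
  (* In turn these vectors give h, then H, then W once h and H are known, and finally V_v C_u = 1
     against the equation for H. *)
  assert (E1 := H (0, 1, 0)); assert (E2 := H (1, 0, 0)); assert (E3 := H (1, 1, 0));
    assert (E4 := H (1, 0, 1)); clear H; revert E1 E2 E3 E4.
  unfold metric, tangent_map, differential, pullback; fold (Cf phi) (Af phi) (Vf phi).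
  rewrite Cx, Cv, Av; cbn [fH fW fh]; unfold pu, px, pv; cbn [fst snd]; intros.
  repeat split; lra.
Qed.

Lemma sim_pullback n phi s1 s2 p :
  map_smooth_at p phi ->
  sim n (phi p) (fH s1) (fH s2) -> sim n (phi p) (fW s1) (fW s2) -> sim n (phi p) (fh s1) (fh s2) ->
  sim n p (fH (pullback phi s1)) (fH (pullback phi s2)) /\
  sim n p (fW (pullback phi s1)) (fW (pullback phi s2)) /\
  sim n p (fh (pullback phi s1)) (fh (pullback phi s2)).
Proof.
  intros Hphi SH SW Sh.
  assert (Hc : forall f g, sim n (phi p) f g -> sim n p (fun q => f (phi q)) (fun q => g (phi q))).
  { intros f g; apply sim_comp; intros d; apply sim_refl, Hphi. }
  assert (Hp : forall d e, sim n p (pdd d (fun q => co e (phi q))) (pdd d (fun q => co e (phi q)))).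
  { intros d e; apply sim_refl, smooth_at_pdd, Hphi. }
  assert (Cu := Hp Du Du); assert (Au := Hp Du Dx); assert (Ax := Hp Dx Dx);
    assert (Vu := Hp Du Dv); assert (Vx := Hp Dx Dv).
  cbn [pdd co] in Cu, Au, Ax, Vu, Vx.
  split; [|split]; cbn [pullback fH fW fh]; unfold Cf, Af, Vf.
  - apply sim_plus; [|apply sim_mult; [apply Hc, Sh|apply sim_pow, Au]].
    apply sim_mult; [exact Cu|].
    repeat first [apply sim_plus | apply sim_mult]; auto.
  - apply sim_plus; [apply sim_mult; [exact Cu|]|]; repeat first [apply sim_plus | apply sim_mult];
      auto using sim_const.
  - apply sim_mult; [apply Hc, Sh|apply sim_pow, Ax].
Qed.

Lemma jet_of_ext s1 s2 p :
  (forall n, sim n p (fH s1) (fH s2)) -> (forall n, sim n p (fW s1) (fW s2)) ->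
  (forall n, sim n p (fh s1) (fh s2)) -> jet_of s1 p = jet_of s2 p.
Proof.
  intros H1 H2 H3; unfold jet_of; f_equal; fext i; fext j; fext k;
    (eapply agr_pd; [|apply le_n]); [apply H1|apply H2|apply H3].
Qed.

(* The h of the target section is replaced by its restriction to a surface v = const:
   since [th'] lies in [E] the jet does not change, and h_v vanishes identically. *)
Lemma prolonged_kpair phi th th' :
  in_E th -> in_E th' -> prolonged phi th th' ->
  exists s', kpair phi s' (base th) /\ th = jet_of (pullback phi s') (base th) /\
    th' = jet_of s' (phi (base th)).
Proof.
  intros HE HE' (U & V & s & s' & HG & HUp & HV & HUV & (SH & SW & Sh & Hpos) &
    (SH' & SW' & Sh' & Hpos') & Hm & Eth & Eth').
  set (p := base th) in *.
  assert (HU : open U) by apply HG.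
  assert (Hphi : map_smooth_at p phi).
  { intros d; apply (smooth_on_at U); [exact HU| |exact HUp].
    destruct HG as (_ & G1 & G2 & G3 & _); destruct d; assumption. }
  assert (HVp := HUV p HUp).
  assert (smH : smooth_at (phi p) (fH s')) by (apply (smooth_on_at V); assumption).
  assert (smW : smooth_at (phi p) (fW s')) by (apply (smooth_on_at V); assumption).
  assert (smh : smooth_at (phi p) (fh s')) by (apply (smooth_on_at V); assumption).
  set (s1 := mkFields (fH s') (fW s') (fun q => fh s' (frzX (pv (phi p)) q))).
  (* All v-derivatives of h vanish at this one point because th' lies in E, so freezing v does not
     change its Taylor series. *)
  assert (Sim : forall n, sim n (phi p) (fh s') (fh s1)).
  { intros n; split; [exact smh|]; assert (Sf := smooth_at_frzX (phi p) (fh s') smh).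
    split; [exact Sf|]; apply pd_agr; [exact smh|exact Sf|]; intros i j k _.
    change (fh s1) with (fun q => fh s' (frzX (pv (phi p)) q)).
    destruct k as [|k].
    - rewrite pd_frzX, frzX_self; reflexivity.
    - rewrite pd_frzX_v; destruct HE' as [_ HE']; specialize (HE' i j k).
      rewrite Eth' in HE'; exact HE'. }
  assert (Hframe := frame_eqs_in_G U phi p HG HUp).
  assert (Hpull : forall q, U q -> pd_v (Vf phi) q * pd_u (Cf phi) q = 1 /\
    fH s q = fH (pullback phi s') q /\ fW s q = fW (pullback phi s') q /\
    fh s q = fh (pullback phi s') q).
  { intros q Hq; destruct (Hframe q Hq) as (F1 & F2 & F3 & _).
    apply metric_pullback; auto. }
  assert (Eq : forall n, sim n p (fH s) (fH (pullback phi s1)) /\ sim n p (fW s) (fW (pullback phi s1))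
    /\ sim n p (fh s) (fh (pullback phi s1))).
  { intros n; destruct (sim_pullback n phi s' s1 p Hphi (sim_refl n _ _ smH) (sim_refl n _ _ smW)
      (Sim n)) as (A1 & A2 & A3).
    split; [|split]; (eapply sim_trans; [apply sim_loc|eassumption]);
      try (apply (smooth_on_at U); assumption);
      apply filter_imp with (2 := HU p HUp); intros q Hq; apply (Hpull q Hq). }
  exists s1; split; [split; [exact Hphi|split]|split].
  - apply filter_imp with (2 := HU p HUp); intros q Hq.
    destruct (Hframe q Hq) as (F1 & F2 & F3 & F4), (Hpull q Hq) as (F5 & _); repeat split; assumption.
  - split; [exact smH|split; [exact smW|split; [apply (Sim O)|split]]].
    + change (0 < fh s' (frzX (pv (phi p)) (phi p))); rewrite frzX_self; apply Hpos', HVp.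
    + apply filter_forall; intros q; exact (f_equal (fun f => f q) (pd_v_frzX (pv (phi p)) (fh s'))).
  - rewrite Eth at 1; apply jet_of_ext; intros n; apply Eq.
  - rewrite Eth'; apply jet_of_ext; intros n; [apply sim_refl, smH|apply sim_refl, smW|apply Sim].
Qed.

Lemma invariant_orbit n F th th' :
  iterated Is Ns n F -> in_E th -> in_E th' -> same_orbit th th' -> qreg th <> 0 -> F th = F th'.
Proof.
  intros HF HE HE' [phi Hp] Hr.
  destruct (prolonged_kpair phi th th' HE HE' Hp) as (s' & K & E & E').
  rewrite E in Hr; rewrite E, E' at 1; apply (invariant_iterated n); [exact HF|exact K|exact Hr].
Qed.

(** * Reaching the cross-section *)

(** The fixed point equation governs derivatives; the values at the base point are initial
    conditions and are inserted separately. *)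
Definition set0 (c : R) (T : table) : table := fun i j k =>
  match i, j, k with O, O, O => c | _, _, _ => T i j k end.

Section Reach.

Variables (th' zt : jet).
Hypothesis HE' : in_E th'.
Hypothesis Hr' : qreg th' <> 0.
Hypothesis Hrz : qreg zt <> 0.

Notation p0 := (base zt).
Notation q0 := (base th').
Notation x0 := (px (base zt)).
Notation v0 := (pv (base zt)).

Definition tgtH : point -> R := bor q0 (jH th').
Definition tgtW : point -> R := bor q0 (jW th').
Definition tgth (q : point) : R := bor q0 (jh th') (frzX (pv q0) q).
(** A section with jet th' at its base point; h is frozen in v so that h_v vanishes identically. *)
Definition tgt : fields := mkFields tgtH tgtW tgth.

Definition fX (f : point -> R) (q : point) : R := f (frzX v0 q).
Definition fU (f : point -> R) (q : point) : R := f (frzU x0 v0 q).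

(** Functions carrying the jet of zt; only their restrictions belonging to Z are imposed on the
    pull-back. *)
Definition preW : point -> R := bor p0 (jW zt).
Definition preH : point -> R := bor p0 (jH zt).

(** The values of A_x and C_u at the base point, forced by the transformation rules: W_v is
    multiplied by A_x and W_vv by A_x / C_u. *)
Definition slopeA : R := W_v zt / W_v th'.
Definition slopeC : R := slopeA * W_vv th' / W_vv zt.

(* [C, P, A, B] are the unknown functions, [P] standing for [C'].  They solve,
   to infinite order at [p0], the equations stating that the pull-back of [tgt]
   under [(C, A, v / C' + B)] has the prescribed [W, W_v] on [v = v0] and
   [H, H_v, H_vv] on [x = x0, v = v0]. *)
Section Tables.

Variable T : nat -> table.

Definition Cf0 : point -> R := bor p0 (set0 (pu q0) (T 0%nat)).
Definition Pf0 : point -> R := bor p0 (set0 slopeC (T 1%nat)).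
Definition Af0 : point -> R := bor p0 (set0 (px q0) (T 2%nat)).
Definition Bf0 : point -> R := bor p0 (set0 (pv q0 - v0 / slopeC) (T 3%nat)).

Definition CC : point -> R := fU Cf0.
Definition PP : point -> R := fU Pf0.
Definition AA : point -> R := fX Af0.
Definition BB : point -> R := fX Bf0.

(** The transformation on the surface v = v0, with P in the place of C'. *)
Definition psi (q : point) : point := (CC q, AA q, v0 / PP q + BB q).

(** [Fau] solves the rule for H_vv for A_u, [Fpu] the rule for H_v for P_u = C_uu, and [Fax] the
    rule for W_v for A_x, the last on the whole surface and the others on the curve. *)
Definition Fau (q : point) : R :=
  PP q * (fU (pd_v (pd_v preH)) q - pd_v (pd_v tgtH) (psi q)) / pd_v (pd_v tgtW) (psi q).
Definition Fpu (q : point) : R :=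
  PP q * (PP q * pd_v tgtH (psi q) + pd_v tgtW (psi q) * Fau q - fU (pd_v preH) q).
Definition Fax (q : point) : R := fX (pd_v preW) q / pd_v tgtW (psi q).

Definition mkU (f : point -> R) : table := fun i _ _ =>
  match i with S i => pd i 0 0 f p0 | O => 0 end.
(** Taylor coefficients of a function of (u, x) whose x-derivative is g on the surface and whose
    u-derivative is f on the curve. Entries of order n + 1 use derivatives of order n, whence the
    contraction. *)
Definition mkX (g f : point -> R) : table := fun i j _ =>
  match j with S j => pd i j 0 g p0 | O => match i with S i => pd i 0 0 f p0 | O => 0 end end.

(** A recomputed from its own equations. The equation for B_x contains A_u on the surface, and
    differentiating A itself would lose the order to be gained; A2 depends on one order less of the
    tables, and coincides with A at the fixed point. *)
Definition A2 : point -> R := fX (bor p0 (set0 (px q0) (mkX Fax Fau))).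

(** The rules for H on the curve and for W on the surface, solved for B_u and B_x; at v = v0 one has
    V_u = - v0 P_u / P^2 + B_u. *)
Definition Fbu (q : point) : R :=
  (fU preH q + v0 * Fpu q / PP q - PP q ^ 2 * tgtH (psi q) - PP q * tgtW (psi q) * Fau q
   - tgth (psi q) * Fau q ^ 2) / PP q.
Definition Fbx (q : point) : R :=
  (fX preW q - 2 * tgth (psi q) * pd_u A2 q * Fax q) / PP q - tgtW (psi q) * Fax q.

Definition Phi (m : nat) : table :=
  match m with
  | 0%nat => mkU PP | 1%nat => mkU Fpu | 2%nat => mkX Fax Fau | _ => mkX Fbx Fbu
  end.

End Tables.

Lemma nz_all : W_v th' <> 0 /\ W_vv th' <> 0 /\ W_v zt <> 0 /\ W_vv zt <> 0.
Proof. apply qreg_neq0 in Hr', Hrz; tauto. Qed.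

Lemma slopeC_neq0 : slopeC <> 0.
Proof.
  destruct nz_all as (N1 & N2 & N3 & N4); unfold slopeC, slopeA, Rdiv.
  repeat apply Rmult_neq_0; auto using Rinv_neq_0_compat.
Qed.

Lemma slopeA_neq0 : slopeA <> 0.
Proof.
  destruct nz_all as (N1 & N2 & N3 & N4); unfold slopeA, Rdiv.
  repeat apply Rmult_neq_0; auto using Rinv_neq_0_compat.
Qed.

Lemma fU_p0 f : fU f p0 = f p0. Proof. unfold fU; now rewrite frzU_self. Qed.
Lemma fX_p0 f : fX f p0 = f p0. Proof. unfold fX; now rewrite frzX_self. Qed.

Lemma PP_p0 T : PP T p0 = slopeC. Proof. unfold PP; rewrite fU_p0; unfold Pf0; now rewrite bor_val. Qed.
Lemma CC_p0 T : CC T p0 = pu q0. Proof. unfold CC; rewrite fU_p0; unfold Cf0; now rewrite bor_val. Qed.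
Lemma AA_p0 T : AA T p0 = px q0. Proof. unfold AA; rewrite fX_p0; unfold Af0; now rewrite bor_val. Qed.
Lemma BB_p0 T : BB T p0 = pv q0 - v0 / slopeC.
Proof. unfold BB; rewrite fX_p0; unfold Bf0; now rewrite bor_val. Qed.

Lemma psi_p0 T : psi T p0 = q0.
Proof.
  unfold psi; rewrite PP_p0, CC_p0, AA_p0, BB_p0; destruct q0 as [[a b] c].
  apply point_eq; unfold pu, px, pv; cbn; ring.
Qed.

Lemma tgtW_v_q0 : pd_v tgtW q0 = W_v th'. Proof. exact (pd_bor q0 (jW th') 0 0 1). Qed.
Lemma tgtW_vv_q0 : pd_v (pd_v tgtW) q0 = W_vv th'. Proof. exact (pd_bor q0 (jW th') 0 0 2). Qed.

Lemma smooth_tgth : smooth tgth.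
Proof.
  intros p; apply (smooth_at_comp p (frzX (pv q0))); [apply map_smooth_frzX|apply smooth_bor].
Qed.

Lemma smooth_fX f : smooth f -> smooth (fX f).
Proof. intros H p; apply (smooth_at_comp p (frzX v0)); [apply map_smooth_frzX|apply H]. Qed.

Lemma smooth_fU f : smooth f -> smooth (fU f).
Proof. intros H p; apply (smooth_at_comp p (frzU x0 v0)); [apply map_smooth_frzU|apply H]. Qed.

Lemma sim_fX n f g : sim n p0 f g -> sim n p0 (fX f) (fX g).
Proof.
  intros H; apply (sim_comp n p0 (frzX v0) (frzX v0) f g);
    [intros d; apply sim_refl, (map_smooth_frzX v0 p0 d)|].
  rewrite frzX_self; exact H.
Qed.

Lemma sim_fU n f g : sim n p0 f g -> sim n p0 (fU f) (fU g).
Proof.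
  intros H; apply (sim_comp n p0 (frzU x0 v0) (frzU x0 v0) f g);
    [intros d; apply sim_refl, (map_smooth_frzU x0 v0 p0 d)|].
  rewrite frzU_self; exact H.
Qed.

Lemma sim_bor n c S S' :
  (forall i j k, (i + j + k <= n)%nat -> S i j k = S' i j k) ->
  sim n p0 (bor p0 (set0 c S)) (bor p0 (set0 c S')).
Proof.
  intros H; assert (B1 := smooth_bor p0 (set0 c S) p0); assert (B2 := smooth_bor p0 (set0 c S') p0).
  split; [exact B1|split; [exact B2|]]; apply pd_agr; auto.
  intros i j k Hn; rewrite !pd_bor; unfold set0.
  destruct i, j, k; auto.
Qed.

(** * Contractivity of the operator on tables *)

Section Contract.

Variables (n : nat) (T T' : nat -> table).
Hypothesis HT : tabeq (S n) T T'.

Lemma sim_CC : sim n p0 (CC T) (CC T').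
Proof. apply sim_fU, sim_bor; intros; apply HT; lia. Qed.
Lemma sim_PP : sim n p0 (PP T) (PP T').
Proof. apply sim_fU, sim_bor; intros; apply HT; lia. Qed.
Lemma sim_AA : sim n p0 (AA T) (AA T').
Proof. apply sim_fX, sim_bor; intros; apply HT; lia. Qed.
Lemma sim_BB : sim n p0 (BB T) (BB T').
Proof. apply sim_fX, sim_bor; intros; apply HT; lia. Qed.

Lemma PP_neq0 : PP T p0 <> 0. Proof. rewrite PP_p0; apply slopeC_neq0. Qed.

Lemma sim_psi f : smooth f -> sim n p0 (fun q => f (psi T q)) (fun q => f (psi T' q)).
Proof.
  intros Hf; apply (sim_comp n p0 (psi T) (psi T') f f); [|apply sim_refl, Hf].
  intros []; [apply sim_CC|apply sim_AA|].
  apply (sim_plus n p0 (fun q => v0 / PP T q) (fun q => v0 / PP T' q)); [|apply sim_BB].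
  apply sim_div; [apply sim_const|apply sim_PP|apply PP_neq0].
Qed.

Lemma smooth_tgtH : smooth tgtH. Proof. apply smooth_bor. Qed.
Lemma smooth_tgtW : smooth tgtW. Proof. apply smooth_bor. Qed.
Lemma smooth_preW : smooth preW. Proof. apply smooth_bor. Qed.
Lemma smooth_preH : smooth preH. Proof. apply smooth_bor. Qed.
Lemma smooth_pd_v f : smooth f -> smooth (pd_v f). Proof. exact (smooth_pdd Dv f). Qed.

Lemma tgtW_vv_psi : pd_v (pd_v tgtW) (psi T p0) <> 0.
Proof. rewrite psi_p0, tgtW_vv_q0; apply nz_all. Qed.

Lemma tgtW_v_psi : pd_v tgtW (psi T p0) <> 0.
Proof. rewrite psi_p0, tgtW_v_q0; apply nz_all. Qed.

Lemma sim_Fau : sim n p0 (Fau T) (Fau T').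
Proof.
  apply sim_div; [|apply sim_psi, smooth_pd_v, smooth_pd_v, smooth_tgtW|apply tgtW_vv_psi].
  apply sim_mult; [apply sim_PP|apply sim_minus].
  - apply sim_refl, smooth_fU, smooth_pd_v, smooth_pd_v, smooth_preH.
  - apply sim_psi, smooth_pd_v, smooth_pd_v, smooth_tgtH.
Qed.

Lemma sim_Fpu : sim n p0 (Fpu T) (Fpu T').
Proof.
  apply sim_mult; [apply sim_PP|apply sim_minus].
  - apply sim_plus; apply sim_mult; first [apply sim_PP | apply sim_Fau | apply sim_psi, smooth_pd_v];
      first [apply smooth_tgtH | apply smooth_tgtW].
  - apply sim_refl, smooth_fU, smooth_pd_v, smooth_preH.
Qed.

Lemma sim_Fax : sim n p0 (Fax T) (Fax T').
Proof.
  apply sim_div; [|apply sim_psi, smooth_pd_v, smooth_tgtW|apply tgtW_v_psi].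
  apply sim_refl, smooth_fX, smooth_pd_v, smooth_preW.
Qed.

Lemma mkX_eq g g' f f' : sim n p0 g g' -> sim n p0 f f' ->
  forall i j k, (i + j + k <= S n)%nat -> mkX g f i j k = mkX g' f' i j k.
Proof.
  intros (_ & _ & Hg) (_ & _ & Hf) i j k Hn; destruct j as [|j]; cbn.
  - destruct i as [|i]; [reflexivity|]; apply (agr_pd n); [exact Hf|lia].
  - apply (agr_pd n); [exact Hg|lia].
Qed.

Lemma sim_A2_u : sim n p0 (pd_u (A2 T)) (pd_u (A2 T')).
Proof.
  apply (sim_pdd n p0 _ _ Du), sim_fX, sim_bor, mkX_eq; [apply sim_Fax|apply sim_Fau].
Qed.

Lemma sim_Fbu : sim n p0 (Fbu T) (Fbu T').
Proof.
  pose proof sim_PP; pose proof sim_Fpu; pose proof sim_Fau.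
  pose proof (sim_psi tgtH smooth_tgtH); pose proof (sim_psi tgtW smooth_tgtW); pose proof (sim_psi tgth smooth_tgth).
  assert (sim n p0 (fU preH) (fU preH)) by (apply sim_refl, smooth_fU, smooth_preH).
  unfold Fbu; sim_tac PP_neq0.
Qed.

Lemma sim_Fbx : sim n p0 (Fbx T) (Fbx T').
Proof.
  pose proof sim_PP; pose proof sim_Fax; pose proof sim_A2_u.
  pose proof (sim_psi tgtW smooth_tgtW); pose proof (sim_psi tgth smooth_tgth).
  assert (sim n p0 (fX preW) (fX preW)) by (apply sim_refl, smooth_fX, smooth_preW).
  unfold Fbx; sim_tac PP_neq0.
Qed.

Lemma mkU_eq f f' : sim n p0 f f' ->
  forall i j k, (i + j + k <= S n)%nat -> mkU f i j k = mkU f' i j k.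
Proof.
  intros (_ & _ & Hf) i j k Hn; destruct i as [|i]; [reflexivity|].
  apply (agr_pd n); [exact Hf|lia].
Qed.

End Contract.

Lemma Phi_contractive n T T' : tabeq n T T' -> tabeq (S n) (Phi T) (Phi T').
Proof.
  intros HT m i j k Hn; destruct n as [|n].
  (* In order zero all entries of [Phi] are 0 whatever T is, the base values being supplied by
     [set0]. *)
  - destruct i, j, k; try lia; destruct m as [|[|[|m]]]; reflexivity.
  - destruct m as [|[|[|m]]]; cbn [Phi].
    + apply (mkU_eq n); [apply sim_PP, HT|lia].
    + apply (mkU_eq n); [apply sim_Fpu, HT|lia].
    + apply (mkX_eq n); [apply sim_Fax, HT|apply sim_Fau, HT|lia].
    + apply (mkX_eq n); [apply sim_Fbx, HT|apply sim_Fbu, HT|lia].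
Qed.

(** * The transformation defined by the fixed point *)

Section Solution.

Variable T : nat -> table.
Hypothesis HT : forall m i j k, T m i j k = Phi T m i j k.

Notation C := (CC T).
Notation P := (PP T).
Notation A := (AA T).
Notation B := (BB T).

Lemma refl_tab n : tabeq (S n) T T. Proof. intros m i j k _; reflexivity. Qed.

Lemma smooth_Fau : smooth_at p0 (Fau T). Proof. apply (sim_Fau 0 T T (refl_tab 0)). Qed.
Lemma smooth_Fpu : smooth_at p0 (Fpu T). Proof. apply (sim_Fpu 0 T T (refl_tab 0)). Qed.
Lemma smooth_Fax : smooth_at p0 (Fax T). Proof. apply (sim_Fax 0 T T (refl_tab 0)). Qed.
Lemma smooth_Fbu : smooth_at p0 (Fbu T). Proof. apply (sim_Fbu 0 T T (refl_tab 0)). Qed.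
Lemma smooth_Fbx : smooth_at p0 (Fbx T). Proof. apply (sim_Fbx 0 T T (refl_tab 0)). Qed.

Lemma smooth_CC : smooth C. Proof. apply smooth_fU, smooth_bor. Qed.
Lemma smooth_PP : smooth P. Proof. apply smooth_fU, smooth_bor. Qed.
Lemma smooth_AA : smooth A. Proof. apply smooth_fX, smooth_bor. Qed.
Lemma smooth_BB : smooth B. Proof. apply smooth_fX, smooth_bor. Qed.

Lemma pd_set0 c S i j k : (0 < i + j + k)%nat -> pd i j k (bor p0 (set0 c S)) p0 = S i j k.
Proof. intros H; rewrite pd_bor; destruct i, j, k; cbn; try reflexivity; lia. Qed.

Lemma pd_pdd_bor d c S i j k :
  pd i j k (pdd d (bor p0 (set0 c S))) p0 = S (bi d i) (bj d j) (bk d k).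
Proof.
  rewrite (pd_pdd d i j k _ p0 (smooth_bor _ _ p0)); apply pd_set0; destruct d; cbn; lia.
Qed.

(** Entry 0 of the fixed point equation. Like its companions below it equates Taylor series at the
    base point, not functions. *)
Lemma sol_C n : sim n p0 (pd_u C) P.
Proof.
  apply (sim_frzU n p0 (pd_u (Cf0 T)) P); [exact (smooth_pdd Du _ (smooth_bor _ _) p0)
    |apply smooth_PP|].
  intros i _; eapply eq_trans; [exact (pd_pdd_bor Du _ (T 0%nat) i 0 0)|].
  rewrite HT; reflexivity.
Qed.

Lemma sol_P n : sim n p0 (pd_u P) (fU (Fpu T)).
Proof.
  apply (sim_frzU n p0 (pd_u (Pf0 T)) (Fpu T)); [exact (smooth_pdd Du _ (smooth_bor _ _) p0)
    |apply smooth_Fpu|].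
  intros i _; eapply eq_trans; [exact (pd_pdd_bor Du _ (T 1%nat) i 0 0)|].
  rewrite HT; reflexivity.
Qed.

Lemma sol_A_x n : sim n p0 (pd_x A) (Fax T).
Proof.
  apply (sim_frzX n p0 (pd_x (Af0 T)) (Fax T)); [exact (smooth_pdd Dx _ (smooth_bor _ _) p0)
    |apply smooth_Fax|].
  intros i j _; eapply eq_trans; [exact (pd_pdd_bor Dx _ (T 2%nat) i j 0)|].
  rewrite HT; reflexivity.
Qed.

Lemma sol_A_u n : sim n p0 (fU (pd_u A)) (fU (Fau T)).
Proof.
  apply (sim_frzU n p0 (pd_u (Af0 T)) (Fau T)); [exact (smooth_pdd Du _ (smooth_bor _ _) p0)
    |apply smooth_Fau|].
  intros i _; eapply eq_trans; [exact (pd_pdd_bor Du _ (T 2%nat) i 0 0)|].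
  rewrite HT; reflexivity.
Qed.

Lemma A2_eq : A2 T = A.
Proof.
  unfold A2, AA, Af0; replace (mkX (Fax T) (Fau T)) with (T 2%nat); [reflexivity|].
  fext i; fext j; fext k; apply HT.
Qed.

Lemma sol_B_x n : sim n p0 (pd_x B) (Fbx T).
Proof.
  apply (sim_frzX n p0 (pd_x (Bf0 T)) (Fbx T)); [exact (smooth_pdd Dx _ (smooth_bor _ _) p0)
    |apply smooth_Fbx|].
  intros i j _; eapply eq_trans; [exact (pd_pdd_bor Dx _ (T 3%nat) i j 0)|].
  rewrite HT; reflexivity.
Qed.

Lemma sol_B_u n : sim n p0 (fU (pd_u B)) (fU (Fbu T)).
Proof.
  apply (sim_frzU n p0 (pd_u (Bf0 T)) (Fbu T)); [exact (smooth_pdd Du _ (smooth_bor _ _) p0)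
    |apply smooth_Fbu|].
  intros i _; eapply eq_trans; [exact (pd_pdd_bor Du _ (T 3%nat) i 0 0)|].
  rewrite HT; reflexivity.
Qed.

(** Built with C_u rather than P, so that it belongs to the pseudogroup exactly and not merely to
    infinite order at the base point. *)
Definition phi (q : point) : point := (C q, A q, pv q / pd_u C q + B q).

Lemma C_u_p0 : pd_u C p0 = slopeC.
Proof. rewrite (sim_val _ _ _ _ (sol_C 0)); apply PP_p0. Qed.

Lemma A_x_p0 : pd_x A p0 = slopeA.
Proof.
  rewrite (sim_val _ _ _ _ (sol_A_x 0)); unfold Fax; rewrite psi_p0, tgtW_v_q0, fX_p0.
  unfold slopeA; f_equal; exact (pd_bor p0 (jW zt) 0 0 1).
Qed.

Lemma phi_p0 : phi p0 = q0.
Proof.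
  unfold phi; rewrite C_u_p0, CC_p0, AA_p0, BB_p0; destruct q0 as [[a b] c].
  apply point_eq; unfold pu, px, pv; cbn; ring.
Qed.

Definition good (q : point) : Prop := pd_u C q <> 0 /\ pd_x A q <> 0 /\ 0 < tgth (phi q).

Lemma map_smooth_phi q : pd_u C q <> 0 -> map_smooth_at q phi.
Proof.
  intros H; apply map_smooth_at_mk; [apply smooth_CC|apply smooth_AA|].
  apply (smooth_at_plus q (fun q => pv q / pd_u C q)); [|apply smooth_BB].
  apply smooth_at_div; [apply smooth_at_pv|exact (smooth_pdd Du C smooth_CC q)|exact H].
Qed.

Lemma good_open : open good.
Proof.
  intros q (G1 & G2 & G3); apply filter_and; [|apply filter_and].
  - apply continuous_neq0; [apply smooth_at_continuous, (smooth_pdd Du C smooth_CC)|exact G1].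
  - apply continuous_neq0; [apply smooth_at_continuous, (smooth_pdd Dx A smooth_AA)|exact G2].
  - apply (smooth_at_continuous q (fun r => tgth (phi r))
      (smooth_at_comp q phi tgth (map_smooth_phi q G1) (smooth_tgth _)) (fun y => 0 < y)), (open_gt 0), G3.
Qed.

Lemma good_frame q : good q -> frame_eqs phi q.
Proof.
  intros (G1 & G2 & _); destruct q as [[u x] v]; repeat split.
  - apply (Derive_const (C (u, x, v))).
  - apply (Derive_const (C (u, x, v))).
  - apply (Derive_const (A (u, x, v))).
  - apply (Rmult_eq_reg_r (/ pd_u C (u, x, v))); [|apply Rinv_neq_0_compat, G1].
    change (pd_u (Cf phi) (u, x, v)) with (pd_u C (u, x, v)).
    rewrite Rmult_assoc, Rinv_r, Rmult_1_r, Rmult_1_l by exact G1.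
    apply is_derive_unique.
    apply (is_derive_ext (fun t => t * / pd_u C (u, x, v) + B (u, x, v))); [reflexivity|].
    auto_derive; [exact I|ring].
  - exact G2.
Qed.

Lemma good_kpair q : good q -> kpair phi tgt q.
Proof.
  intros G; split; [apply map_smooth_phi, G|split].
  - apply filter_imp with (2 := good_open q G); apply good_frame.
  - split; [apply smooth_tgtH|split; [apply smooth_tgtW|split; [apply smooth_tgth|split; [apply G|]]]].
    apply filter_forall; intros r.
    exact (f_equal (fun f => f r) (pd_v_frzX (pv q0) (bor q0 (jh th')))).
Qed.

Lemma tgth_q0 : tgth q0 = jh th' 0 0 0.
Proof. unfold tgth; rewrite frzX_self; apply bor_val. Qed.

Lemma good_p0 : good p0.
Proof.
  split; [rewrite C_u_p0; apply slopeC_neq0|split; [rewrite A_x_p0; apply slopeA_neq0|]].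
  rewrite phi_p0, tgth_q0; apply HE'.
Qed.

Lemma jet_tgt : jet_of tgt q0 = th'.
Proof.
  destruct HE' as [_ Hv]; revert Hv.
  assert (E1 : (fun i j k => pd i j k tgtH q0) = jH th')
    by (fext i; fext j; fext k; apply pd_bor).
  assert (E2 : (fun i j k => pd i j k tgtW q0) = jW th')
    by (fext i; fext j; fext k; apply pd_bor).
  intros Hv; assert (E3 : (fun i j k => pd i j k tgth q0) = jh th').
  { fext i; fext j.
    fext k.
    unfold tgth; destruct k as [|k].
    - rewrite pd_frzX, frzX_self; apply pd_bor.
    - rewrite pd_frzX_v; symmetry; apply Hv. }
  unfold jet_of; cbn [tgt fH fW fh]; rewrite E1, E2, E3; destruct th'; reflexivity.
Qed.

Lemma metric_eq q xi : good q ->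
  metric (pullback phi tgt) q xi = metric tgt (phi q) (tangent_map phi q xi).
Proof.
  intros G; assert (K := good_kpair q G).
  rewrite (tangent_map_pair phi tgt q xi K).
  assert (NC := C_u_neq0 phi tgt q K).
  assert (EV : pd_v (Vf phi) q = / pd_u (Cf phi) q).
  { apply (Rmult_eq_reg_r (pd_u (Cf phi) q)); [|exact NC].
    rewrite (V_v phi tgt q K), Rinv_l; auto. }
  unfold metric, pullback; cbn [fH fW fh]; rewrite EV.
  generalize (tgtH (phi q)), (tgtW (phi q)), (tgth (phi q)); intros; cbn [tgt fH fW fh].
  destruct xi as [[a b] c]; unfold pu, px, pv; cbn [fst snd]; field; exact NC.
Qed.

Lemma phi_prolonged : prolonged phi (jet_of (pullback phi tgt) p0) th'.
Proof.
  assert (Ks : forall q, good q -> ksec (pullback phi tgt) q)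
    by (intros q G; apply ksec_pullback, good_kpair, G).
  assert (Km : forall q, good q -> map_smooth_at q phi)
    by (intros q G; apply map_smooth_phi, G).
  exists good, (fun r => 0 < tgth r), (pullback phi tgt), tgt.
  split; [|split; [|split; [|split; [|split; [|split; [|split; [|split]]]]]]].
  - split; [exact good_open|split; [|split; [|split]]].
    + apply (smooth_at_on good _ good_open); intros q G; apply (Km q G Du).
    + apply (smooth_at_on good _ good_open); intros q G; apply (Km q G Dx).
    + apply (smooth_at_on good _ good_open); intros q G; apply (Km q G Dv).
    + exists (fun u => C (u, 0, 0)), (fun u x => A (u, x, 0)), (fun u x => B (u, x, 0)).
      intros u x v (G1 & G2 & _); split; [exact G1|split; [exact G2|reflexivity]].
  - exact good_p0.
  - intros r Hr; apply (smooth_at_continuous r tgth (smooth_tgth r) (fun y => 0 < y)), (open_gt 0), Hr.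
  - intros q G; apply G.
  - split; [|split; [|split]]; try (apply (smooth_at_on good _ good_open); intros q G; apply (Ks q G)).
    intros q G; apply (Ks q G).
  - assert (Ho : open (fun r => 0 < tgth r)).
    { intros r Hr; apply (smooth_at_continuous r tgth (smooth_tgth r) (fun y => 0 < y)), (open_gt 0), Hr. }
    split; [|split; [|split]]; try (apply (smooth_at_on _ _ Ho); intros q _).
    + apply smooth_tgtH. + apply smooth_tgtW. + apply smooth_tgth. + auto.
  - intros q xi G; apply metric_eq, G.
  - reflexivity.
  - cbn [base jet_of]; rewrite phi_p0, jet_tgt; reflexivity.
Qed.

(** ** The pulled back section has the prescribed coordinates *)

Notation s := (pullback phi tgt).

Lemma pd_x_V q : pd_x (Vf phi) q = pd_x B q.
Proof.
  destruct q as [[u x] v]; unfold pd_x at 1.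
  transitivity (Derive (fun t => v / pd_u C (u, x, v) + B (u, t, v)) x); [reflexivity|].
  rewrite Derive_plus; [rewrite Derive_const; apply Rplus_0_l|apply @ex_derive_const|].
  exact (smooth_at_ex_derive (u, x, v) B Dx (smooth_BB _)).
Qed.

Lemma pd_u_V q : pd_u C q <> 0 ->
  pd_u (Vf phi) q = - (pv q * pd_u (pd_u C) q) / pd_u C q ^ 2 + pd_u B q.
Proof.
  intros H.
  assert (S1 : smooth_at q (fun r => / pd_u C r))
    by exact (smooth_at_inv q _ (smooth_pdd Du C smooth_CC q) H).
  assert (S2 : smooth_at q (fun r => pv r * / pd_u C r))
    by (apply smooth_at_mult; [apply smooth_at_pv|exact S1]).
  assert (E := pdd_plus q _ B Du S2 (smooth_BB q)).
  rewrite (pdd_mult q pv _ Du (smooth_at_pv q) S1) in E.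
  rewrite (pdd_inv q (pd_u C) Du (smooth_pdd Du C smooth_CC q) H) in E.
  assert (E0 : pdd Du pv q = 0) by exact (f_equal (fun f => f q) (pdd_co Du Dv)).
  rewrite E0 in E; eapply eq_trans; [exact E|]; cbn [pdd]; field; exact H.
Qed.

(** On v = v0 the maps phi and psi differ only by C_u against P, which have the same Taylor
    series. *)
Lemma sim_phi_fX n f : smooth f -> sim n p0 (fX (fun q => f (phi q))) (fun q => f (psi T q)).
Proof.
  intros Hf; apply (sim_comp n p0 (fun q => phi (frzX v0 q)) (psi T)).
  - intros []; [apply (sim_refl n p0 C), smooth_CC|apply (sim_refl n p0 A), smooth_AA|].
    apply (sim_plus n p0 (fun q => v0 / pd_u C q) (fun q => v0 / P q) B B).
    + apply sim_div; [apply sim_const|apply sol_C|rewrite C_u_p0; apply slopeC_neq0].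
    + apply sim_refl, smooth_BB.
  - apply sim_refl, Hf.
Qed.

Lemma sim_phi_fU n f : smooth f -> sim n p0 (fU (fun q => f (phi q))) (fU (fun q => f (psi T q))).
Proof. intros Hf; exact (sim_fU n _ _ (sim_phi_fX n f Hf)). Qed.

Lemma near_P : locally p0 (fun q => P q <> 0).
Proof.
  apply continuous_neq0; [apply smooth_at_continuous, smooth_PP|rewrite PP_p0; apply slopeC_neq0].
Qed.

Lemma near_psi f : smooth f -> f q0 <> 0 -> locally p0 (fun q => f (psi T q) <> 0).
Proof.
  intros Hf H; apply (continuous_neq0 (fun q => f (psi T q))).
  - apply smooth_at_continuous, (sim_psi 0 T T (refl_tab 0) f Hf).
  - rewrite psi_p0; exact H.
Qed.

Lemma locally_fU (Q : point -> Prop) : locally p0 Q -> locally p0 (fun q => Q (frzU x0 v0 q)).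
Proof.
  intros H; apply (map_smooth_continuous p0 (frzU x0 v0) (map_smooth_frzU x0 v0 p0)).
  rewrite frzU_self; exact H.
Qed.

Lemma c_u_p0_neq0 : pd_u C p0 <> 0. Proof. rewrite C_u_p0; apply slopeC_neq0. Qed.

(** Replacing C_u, A_x, B_x by P, [Fax], [Fbx] changes nothing to any order, and after the
    replacement the rule for W is an algebraic identity. *)
Lemma fX_W n : sim n p0 (fX (fW s)) (fX preW).
Proof.
  assert (S1 := sol_C n); assert (S2 := sol_A_x n); assert (S3 := sol_B_x n).
  assert (S4 := sim_phi_fX n tgtW smooth_tgtW); assert (S5 := sim_phi_fX n tgth smooth_tgth).
  assert (S6 : sim n p0 (pd_u A) (pd_u A)) by apply sim_refl, (smooth_pdd Du A smooth_AA).
  assert (E : sim n p0 (fX (fW s)) (fun q => P q * (Fbx T q + tgtW (psi T q) * Fax T q)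
    + 2 * tgth (psi T q) * pd_u A q * Fax T q)).
  { replace (fX (fW s)) with (fun q => pd_u C q * (pd_x B q + fX (fun q => tgtW (phi q)) q * pd_x A q)
      + 2 * fX (fun q => tgth (phi q)) q * pd_u A q * pd_x A q).
    - sim_tac c_u_p0_neq0.
    - fext q; unfold fX; cbn [pullback fW].
      rewrite pd_x_V; reflexivity. }
  apply (sim_trans _ _ _ _ _ E), sim_loc; [apply E|].
  (* Here the recomputed A becomes A again, so that its u-derivative cancels the one in the rule for
     W. *)
  generalize near_P; apply filter_imp; intros q HP; unfold Fbx; rewrite A2_eq; field; exact HP.
Qed.

Lemma loc_pair (f g : point -> R) : (forall q, kpair phi tgt q -> f q = g q) ->
  locally p0 (fun q => f q = g q).
Proof.
  intros H; generalize (kpair_loc phi tgt p0 (good_kpair p0 good_p0)); apply filter_imp; exact H.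
Qed.

Lemma ksec_s : ksec s p0. Proof. apply ksec_pullback, good_kpair, good_p0. Qed.

Lemma fX_W_v n : sim n p0 (fX (pd_v (fW s))) (fX (pd_v preW)).
Proof.
  assert (S2 := sol_A_x n); assert (S4 := sim_phi_fX n (pd_v tgtW) (smooth_pd_v _ smooth_tgtW)).
  assert (S0 : smooth_at p0 (pd_v (fW s))) by (apply (smooth_at_pdd p0 Dv), ksec_s).
  apply (sim_trans _ _ _ _ _ (sim_fX n _ _ (sim_loc n p0 _ _ S0 (loc_pair _ _ (pullback_W_v phi tgt))))).
  assert (E := sim_mult n p0 _ _ _ _ S2 S4).
  apply (sim_trans _ _ _ _ _ E), sim_loc; [apply E|].
  generalize (near_psi (pd_v tgtW) (smooth_pd_v _ smooth_tgtW) ltac:(rewrite tgtW_v_q0; apply nz_all)).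
  apply filter_imp; intros q Hq; unfold Fax; field; exact Hq.
Qed.

Lemma V_v_eq q : kpair phi tgt q -> pd_v (Vf phi) q = / pd_u C q.
Proof.
  intros K; apply (Rmult_eq_reg_r (pd_u C q)); [|exact (C_u_neq0 phi tgt q K)].
  eapply eq_trans; [exact (V_v phi tgt q K)|]; rewrite Rinv_l; [reflexivity|].
  exact (C_u_neq0 phi tgt q K).
Qed.

(** The one coordinate of Z met by an initial condition, the choice of [slopeC], instead of a
    differential equation. *)
Lemma W_vv_eq : pd_v (pd_v (fW s)) p0 = W_vv zt.
Proof.
  assert (K := good_kpair p0 good_p0).
  rewrite (pullback_W_vv phi tgt p0 K), (V_v_eq p0 K), C_u_p0, phi_p0.
  change (pd_x (Af phi) p0) with (pd_x A p0); cbn [tgt fW]; rewrite A_x_p0, tgtW_vv_q0.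
  unfold slopeC; destruct nz_all as (N1 & N2 & N3 & N4); assert (N5 := slopeA_neq0); field; auto.
Qed.

Lemma sim_Cuu n : sim n p0 (pd_u (pd_u C)) (fU (Fpu T)).
Proof. apply (sim_trans _ _ _ (pd_u P)); [exact (sim_pdd n p0 _ _ Du (sol_C (S n)))|apply sol_P]. Qed.

(** Everything is restricted to the curve, as [Fau] and [Fbu] describe A_u and B_u only there; C_uu
    is replaced by [Fpu]. *)
Lemma fU_H n : sim n p0 (fU (fH s)) (fU preH).
Proof.
  assert (S1 := sol_C n); assert (S2 := sol_A_u n); assert (S3 := sol_B_u n); assert (S7 := sim_Cuu n).
  assert (S4 := sim_phi_fU n tgtW smooth_tgtW); assert (S5 := sim_phi_fU n tgth smooth_tgth);
    assert (S6 := sim_phi_fU n tgtH smooth_tgtH).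
  assert (NC := c_u_p0_neq0).
  set (g := fun q => P q * (- (v0 * fU (Fpu T) q) / P q ^ 2 + fU (Fbu T) q
     + fU (fun q => tgtH (psi T q)) q * P q + fU (fun q => tgtW (psi T q)) q * fU (Fau T) q)
     + fU (fun q => tgth (psi T q)) q * fU (Fau T) q ^ 2).
  assert (E : sim n p0 (fun q => pd_u C q * (- (v0 * pd_u (pd_u C) q) / pd_u C q ^ 2 + fU (pd_u B) q
     + fU (fun q => tgtH (phi q)) q * pd_u C q + fU (fun q => tgtW (phi q)) q * fU (pd_u A) q)
     + fU (fun q => tgth (phi q)) q * fU (pd_u A) q ^ 2) g).
  { unfold g; sim_tac c_u_p0_neq0. }
  assert (E0 : sim n p0 (fU (fH s)) g).
  { apply sim_sym; apply sim_sym in E; apply (sim_trans _ _ _ _ _ E), sim_loc; [apply E|].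
    assert (HC : locally p0 (fun q => pd_u C q <> 0)).
    { apply continuous_neq0; [apply smooth_at_continuous, (smooth_pdd Du C smooth_CC)|exact NC]. }
    generalize (locally_fU _ HC); apply filter_imp; intros q Hq.
    change (fU (fH s) q) with (fH s (frzU x0 v0 q)); cbn [pullback fH].
    rewrite (pd_u_V _ Hq); reflexivity. }
  apply (sim_trans _ _ _ _ _ E0), sim_loc; [apply E0|].
  generalize near_P; apply filter_imp; intros q HP; unfold g, fU, Fbu.
  change (PP T (frzU x0 v0 q)) with (P q); change (fU preH (frzU x0 v0 q)) with (preH (frzU x0 v0 q)).
  field; exact HP.
Qed.

Lemma fU_H_v n : sim n p0 (fU (pd_v (fH s))) (fU (pd_v preH)).
Proof.
  assert (S1 := sol_C n); assert (S2 := sol_A_u n); assert (S7 := sim_Cuu n).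
  assert (S4 := sim_phi_fU n (pd_v tgtW) (smooth_pd_v _ smooth_tgtW)); assert (S6 := sim_phi_fU n (pd_v tgtH) (smooth_pd_v _ smooth_tgtH)).
  assert (S0 : smooth_at p0 (pd_v (fH s))) by (apply (smooth_at_pdd p0 Dv), ksec_s).
  assert (E : sim n p0 (fun q => -1 * (/ pd_u C q * pd_u (pd_u C) q)
      + pd_u C q * fU (fun q => pd_v tgtH (phi q)) q + fU (fun q => pd_v tgtW (phi q)) q * fU (pd_u A) q)
    (fun q => -1 * (/ P q * fU (Fpu T) q)
      + P q * fU (fun q => pd_v tgtH (psi T q)) q + fU (fun q => pd_v tgtW (psi T q)) q * fU (Fau T) q)).
  { sim_tac c_u_p0_neq0. }
  assert (E1 : sim n p0 (fU (pd_v (fH s))) (fun q => -1 * (/ pd_u C q * pd_u (pd_u C) q)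
      + pd_u C q * fU (fun q => pd_v tgtH (phi q)) q + fU (fun q => pd_v tgtW (phi q)) q * fU (pd_u A) q)).
  { apply (sim_fU n (pd_v (fH s)) (fun q => -1 * (/ pd_u C q * pd_u (pd_u C) q)
      + pd_u C q * pd_v tgtH (phi q) + pd_v tgtW (phi q) * pd_u A q)).
    apply sim_loc; [exact S0|]; apply loc_pair; intros q K.
    rewrite (pullback_H_v phi tgt q K), (V_v_eq q K); reflexivity. }
  apply (sim_trans _ _ _ _ _ (sim_trans _ _ _ _ _ E1 E)), sim_loc; [apply E|].
  generalize near_P; apply filter_imp; intros q HP; unfold fU, Fpu.
  change (PP T (frzU x0 v0 q)) with (P q).
  change (fU (pd_v preH) (frzU x0 v0 q)) with (pd_v preH (frzU x0 v0 q)).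
  field; exact HP.
Qed.

Lemma fU_H_vv n : sim n p0 (fU (pd_v (pd_v (fH s)))) (fU (pd_v (pd_v preH))).
Proof.
  assert (S1 := sol_C n); assert (S2 := sol_A_u n).
  assert (S4 := sim_phi_fU n (pd_v (pd_v tgtW)) (smooth_pd_v _ (smooth_pd_v _ smooth_tgtW)));
    assert (S6 := sim_phi_fU n (pd_v (pd_v tgtH)) (smooth_pd_v _ (smooth_pd_v _ smooth_tgtH))).
  assert (S0 : smooth_at p0 (pd_v (pd_v (fH s)))) by (do 2 apply (smooth_at_pdd p0 Dv); apply ksec_s).
  assert (E : sim n p0 (fun q => fU (fun q => pd_v (pd_v tgtH) (phi q)) q
      + fU (fun q => pd_v (pd_v tgtW) (phi q)) q * / pd_u C q * fU (pd_u A) q)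
    (fun q => fU (fun q => pd_v (pd_v tgtH) (psi T q)) q
      + fU (fun q => pd_v (pd_v tgtW) (psi T q)) q * / P q * fU (Fau T) q)).
  { sim_tac c_u_p0_neq0. }
  assert (E1 : sim n p0 (fU (pd_v (pd_v (fH s)))) (fun q => fU (fun q => pd_v (pd_v tgtH) (phi q)) q
      + fU (fun q => pd_v (pd_v tgtW) (phi q)) q * / pd_u C q * fU (pd_u A) q)).
  { apply (sim_fU n (pd_v (pd_v (fH s))) (fun q => pd_v (pd_v tgtH) (phi q)
      + pd_v (pd_v tgtW) (phi q) * / pd_u C q * pd_u A q)).
    apply sim_loc; [exact S0|]; apply loc_pair; intros q K.
    rewrite (pullback_H_vv phi tgt q K), (V_v_eq q K); reflexivity. }
  apply (sim_trans _ _ _ _ _ (sim_trans _ _ _ _ _ E1 E)), sim_loc; [apply E|].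
  generalize (filter_and _ _ near_P (locally_fU _ (near_psi (pd_v (pd_v tgtW)) (smooth_pd_v _ (smooth_pd_v _ smooth_tgtW))
    ltac:(rewrite tgtW_vv_q0; apply nz_all)))).
  apply filter_imp; intros q [HP HW]; unfold fU, Fau.
  change (PP T (frzU x0 v0 q)) with (P q).
  change (fU (pd_v (pd_v preH)) (frzU x0 v0 q)) with (pd_v (pd_v preH) (frzU x0 v0 q)).
  field; split; [exact HW|exact HP].
Qed.

Lemma Z_eq c : isZ c -> evalc c (jet_of s p0) = evalc c zt.
Proof.
  destruct c as [d|i j k|i j k|i j k]; cbn [isZ evalc jet_of jH jW jh base]; [reflexivity| | |tauto].
  - destruct j as [|j]; [|tauto].
    destruct k as [|[|[|k]]]; [| | |tauto]; intros _.
    + rewrite (sim_frzU_pd i p0 (fH s) preH i (fU_H i) (le_n _)); apply pd_bor.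
    + rewrite pd_Sv, (sim_frzU_pd i p0 _ _ i (fU_H_v i) (le_n _)), <- pd_Sv; apply pd_bor.
    + rewrite !pd_Sv, (sim_frzU_pd i p0 _ _ i (fU_H_vv i) (le_n _)), <- !pd_Sv; apply pd_bor.
  - destruct k as [|[|[|k]]].
    + intros _; rewrite (sim_frzX_pd (i + j) p0 (fW s) preW i j (fX_W _) (le_n _)); apply pd_bor.
    + intros _; rewrite pd_Sv, (sim_frzX_pd (i + j) p0 _ _ i j (fX_W_v _) (le_n _)), <- pd_Sv.
      apply pd_bor.
    + destruct i as [|i], j as [|j]; try tauto; intros _; exact W_vv_eq.
    + destruct i as [|i], j as [|j]; tauto.
Qed.

End Solution.

(** The source jet th1 is the one constructed: it is pulled back from th', and placed at the base
    point of zt. *)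
Lemma reach : exists th1, same_orbit th1 th' /\ in_E th1 /\
  forall c, isZ c -> evalc c th1 = evalc c zt.
Proof.
  destruct (table_fixpoint Phi Phi_contractive) as [T HT].
  exists (jet_of (pullback (phi T) tgt) p0); split; [|split].
  - exists (phi T); apply phi_prolonged, HT.
  - apply ksec_in_E, ksec_s, HT.
  - apply Z_eq, HT.
Qed.

End Reach.

(** * Zariski density *)

Fixpoint peval (c : list R) (t : R) : R :=
  match c with nil => 0 | a :: c => a + t * peval c t end.

Lemma peval_add c d : exists e, forall t, peval e t = peval c t + peval d t.
Proof.
  revert d; induction c as [|a c IH]; intros d; [exists d; intros; cbn; ring|].
  destruct d as [|b d]; [exists (a :: c); intros; cbn; ring|].
  destruct (IH d) as [e He]; exists (a + b :: e); intros t; cbn; rewrite He; ring.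
Qed.

Lemma peval_scal a d : exists e, forall t, peval e t = a * peval d t.
Proof.
  induction d as [|b d [e He]]; [exists nil; intros; cbn; ring|].
  exists (a * b :: e); intros t; cbn; rewrite He; ring.
Qed.

Lemma peval_mul c d : exists e, forall t, peval e t = peval c t * peval d t.
Proof.
  induction c as [|a c [e He]]; [exists nil; intros; cbn; ring|].
  destruct (peval_scal a d) as [f Hf], (peval_add f (0 :: e)) as [g Hg].
  exists g; intros t; rewrite Hg, Hf; cbn; rewrite He; ring.
Qed.

Lemma peval_factor c r : exists d, length d = pred (length c) /\
  forall t, peval c t = peval c r + (t - r) * peval d t.
Proof.
  induction c as [|a [|b c] IH]; [exists nil; split; [reflexivity|intros; cbn; ring]
    |exists nil; split; [reflexivity|intros; cbn; ring]|].
  destruct IH as (d & Hl & Hd); exists (peval (b :: c) r :: d); split; [cbn in *; lia|].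
  intros t; change (a + t * peval (b :: c) t = a + r * peval (b :: c) r +
    (t - r) * (peval (b :: c) r + t * peval d t)); rewrite Hd; ring.
Qed.

(** Induction on the number of coefficients: each root splits off a linear factor. *)
Lemma peval_roots c : (exists t, peval c t <> 0) -> exists L, forall t, peval c t = 0 -> In t L.
Proof.
  remember (length c) as n eqn:Hn; assert (Hn' : (length c <= n)%nat) by lia; clear Hn.
  revert c Hn'; induction n as [|n IH]; intros c Hn [t0 H0].
  - destruct c; [contradiction (H0 eq_refl)|cbn in Hn; lia].
  - destruct (excluded_middle_informative (exists r, peval c r = 0)) as [[r Hr] | Hno].
    + destruct (peval_factor c r) as (d & Hl & Hd).
      destruct (IH d) as [L HL].
      * destruct c; cbn in *; lia.
      * exists t0; intros E; apply H0; rewrite Hd, Hr, E; ring.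
      * exists (r :: L); intros t Ht; rewrite Hd, Hr, Rplus_0_l in Ht.
        apply Rmult_integral in Ht; destruct Ht as [Ht | Ht]; [left; lra|right; auto].
    + exists nil; intros t Ht; apply Hno; exists t; exact Ht.
Qed.

Lemma fresh_point (L : list R) : exists t, 0 <= t <= 1 /\ ~ In t L.
Proof.
  set (f := fun n : nat => / (INR n + 1)).
  destruct (excluded_middle_informative (forall n, In (f n) L)) as [H | H].
  - exfalso.
    assert (Hinj : forall n m, f n = f m -> n = m).
    { intros n m E; apply INR_eq; apply Rinv_eq_reg in E; lra. }
    assert (ND : NoDup (map f (seq 0 (S (length L))))).
    { apply Injective_map_NoDup; [exact Hinj|apply seq_NoDup]. }
    assert (HL := NoDup_incl_length ND (l' := L)).
    rewrite length_map, length_seq in HL.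
    enough (S (length L) <= length L)%nat by lia; apply HL.
    intros t Ht; apply in_map_iff in Ht; destruct Ht as (n & <- & _); apply H.
  - apply not_all_ex_not in H; destruct H as [n Hn]; exists (f n); split; [|exact Hn].
    assert (0 <= INR n) by apply pos_INR; unfold f; split.
    + left; apply Rinv_0_lt_compat; lra.
    + rewrite <- Rinv_1; apply Rinv_le_contravar; lra.
Qed.

(** E is convex, being cut out by linear equations and h > 0; so segments stay in E, and jet
    polynomials restrict to polynomials in t. *)
Definition segment (th0 th1 : jet) (t : R) : jet :=
  let mix (f g : table) i j k := f i j k + t * (g i j k - f i j k) in
  mkJet (pu (base th0) + t * (pu (base th1) - pu (base th0)),
         px (base th0) + t * (px (base th1) - px (base th0)),
         pv (base th0) + t * (pv (base th1) - pv (base th0)))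
    (mix (jH th0) (jH th1)) (mix (jW th0) (jW th1)) (mix (jh th0) (jh th1)).

Lemma jet_ext th th' : (forall c, evalc c th = evalc c th') -> th = th'.
Proof.
  intros H.
  assert (H0 : base th = base th') by (apply co_ext; intros d; exact (H (cB d))).
  assert (HH : jH th = jH th')
    by (do 3 (apply functional_extensionality; intro); exact (H (cH _ _ _))).
  assert (HW : jW th = jW th')
    by (do 3 (apply functional_extensionality; intro); exact (H (cW _ _ _))).
  assert (Hh : jh th = jh th')
    by (do 3 (apply functional_extensionality; intro); exact (H (ch _ _ _))).
  destruct th, th'; cbn in *; congruence.
Qed.

Lemma evalc_segment th0 th1 t c :
  evalc c (segment th0 th1 t) = evalc c th0 + t * (evalc c th1 - evalc c th0).
Proof. destruct c as [[]| | |]; reflexivity. Qed.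

Lemma segment_0 th0 th1 : segment th0 th1 0 = th0.
Proof. apply jet_ext; intros c; rewrite evalc_segment; ring. Qed.

Lemma segment_1 th0 th1 : segment th0 th1 1 = th1.
Proof. apply jet_ext; intros c; rewrite evalc_segment; ring. Qed.

Lemma segment_in_E th0 th1 t : 0 <= t <= 1 -> in_E th0 -> in_E th1 -> in_E (segment th0 th1 t).
Proof.
  intros Ht [P0 Z0] [P1 Z1]; split; cbn.
  - destruct (Rle_lt_dec t (/ 2)); nra.
  - intros i j k; rewrite Z0, Z1; ring.
Qed.

Lemma jet_poly_segment r Q th0 th1 : jet_poly r Q ->
  exists c, forall t, peval c t = Q (segment th0 th1 t).
Proof.
  revert Q; apply jet_poly_ind.
  - intros a; exists (a :: nil); intros t; cbn; ring.
  - intros c _; exists (evalc c th0 :: evalc c th1 - evalc c th0 :: nil); intros t.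
    rewrite evalc_segment; cbn [peval]; ring.
  - intros F G _ _ [c Hc] [d Hd]; destruct (peval_add c d) as [e He]; exists e; intros t.
    rewrite He, Hc, Hd; reflexivity.
  - intros F G _ _ [c Hc] [d Hd]; destruct (peval_mul c d) as [e He]; exists e; intros t.
    rewrite He, Hc, Hd; reflexivity.
Qed.

(** On the segment joining a non-zero of Q to one of Q' both restrict to non-zero polynomials in t,
    so all but finitely many t serve for both. *)
Lemma nonzero_on_E_mul r Q r' Q' : jet_poly r Q -> jet_poly r' Q' ->
  nonzero_on_E Q -> nonzero_on_E Q' -> exists th, in_E th /\ Q th <> 0 /\ Q' th <> 0.
Proof.
  intros HQ HQ' (th0 & E0 & N0) (th1 & E1 & N1).
  destruct (jet_poly_segment r Q th0 th1 HQ) as [c Hc], (jet_poly_segment r' Q' th0 th1 HQ') as [d Hd].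
  destruct (peval_roots c) as [L HL]; [exists 0; rewrite Hc, segment_0; exact N0|].
  destruct (peval_roots d) as [M HM]; [exists 1; rewrite Hd, segment_1; exact N1|].
  destruct (fresh_point (L ++ M)) as (t & Ht & Hn).
  exists (segment th0 th1 t); split; [apply segment_in_E; assumption|].
  rewrite <- Hc, <- Hd; split; intros E; apply Hn, in_or_app; auto.
Qed.

(** * A jet at which Delta does not vanish *)

Definition one_at (a b c i j k : nat) : R :=
  if Nat.eq_dec i a then if Nat.eq_dec j b then if Nat.eq_dec k c then 1 else 0 else 0 else 0.

(** The non-zero coordinates are W_v, W_vv, h, H_x and H_uvv, all equal to 1. The term H_x makes D_x
    J1 = 1 and H_uvv makes D_u J2 = 4, while D_u J1 and D_x J2 vanish; Delta becomes triangular with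
    diagonal 2, 2, -4. *)
Definition jet0 : jet := mkJet (0, 0, 0)
  (fun i j k => one_at 0 1 0 i j k + one_at 1 0 2 i j k)
  (fun i j k => one_at 0 0 1 i j k + one_at 0 0 2 i j k)
  (fun i j k => one_at 0 0 0 i j k).

Lemma jet0_in_E : in_E jet0.
Proof.
  split; [cbn; lra|]; intros i j k; cbn; unfold one_at.
  destruct (Nat.eq_dec i 0), (Nat.eq_dec j 0), (Nat.eq_dec (S k) 0); try reflexivity; lia.
Qed.

Lemma jet0_qreg : qreg jet0 <> 0.
Proof. unfold qreg, W_v, W_vv; cbn; lra. Qed.

Ltac jet0_tac :=
  unfold I1, J1, J2, var_H, var_W, var_h, h_x, W_v, W_vv, W_xv, W_uv, H_vv, H_xv;
  eapply isD_DD, is_derive_ext;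
  [ intros t; symmetry; cbn -[pow]; reflexivity
  | auto_derive; [repeat split; try exact I; try lra | field_simplify; try lra ] ].

Lemma jet0_Delta : Delta jet0 <> 0.
Proof.
  assert (A1 : apply nabla1 I1 jet0 = 2).
  { rewrite apply1; replace (DD Dv I1 jet0) with 2; [unfold n1v, W_v, W_vv; cbn; field|symmetry].
    jet0_tac. }
  assert (A2 : apply nabla2 I1 jet0 = 0).
  { rewrite apply2; replace (DD Dx I1 jet0) with 0; [|symmetry; jet0_tac].
    unfold n2v, h_x, W_v, W_vv, W_xv, var_h; cbn; field. }
  assert (X2 : DD Dx J1 jet0 = 1) by jet0_tac.
  assert (U2 : DD Du J1 jet0 = 0) by jet0_tac.
  assert (X3 : DD Dx J2 jet0 = 0) by jet0_tac.
  assert (U3 : DD Du J2 jet0 = 4) by jet0_tac.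
  assert (U1 : DD Du I1 jet0 = 0) by jet0_tac.
  assert (C2 : n2v jet0 = 0) by (unfold n2v, h_x, W_v, W_vv, W_xv, var_h; cbn; field).
  assert (C2' : n2x jet0 = 2) by (unfold n2x, W_v; cbn; field).
  assert (C3 : n3u jet0 = -1) by (unfold n3u, W_v, W_vv; cbn; field).
  assert (C3' : n3x jet0 = 0) by (unfold n3x, W_v, H_vv; cbn; field).
  assert (C3'' : n3v jet0 = 0) by (unfold n3v, W_v, W_uv, H_xv; cbn; field).
  unfold Delta, det3; rewrite A1, A2, !apply3, !apply2, X2, U2, X3, U3, U1, C2, C2', C3, C3', C3''.
  lra.
Qed.

(** * Generation *)

Lemma in_A_iterated n F : iterated Is Ns n F -> in_A F.
Proof.
  intros HF; destruct (rat_frac qreg F (rat_iterated 2 qreg jet_poly_qreg Dom_qreg n F HF))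
    as (r & P & Q & HP & HQ & E).
  set (l := Nat.max 2 r); assert (L1 : (2 <= l)%nat) by apply Nat.le_max_l;
    assert (L2 : (r <= l)%nat) by apply Nat.le_max_r.
  assert (Hne : forall th, Q th * qreg th <> 0 -> Q th <> 0 /\ qreg th <> 0).
  { intros th H; split; intros E0; apply H; rewrite E0; ring. }
  (* The common factor [qreg] makes the denominator vanish wherever regularity of the frame fails,
     so that no other points have to be considered. *)
  exists l, l, (fun th => P th * qreg th), (fun th => Q th * qreg th).
  split; [|split; [|split; [|split]]].
  - apply poly_mul; [apply (jet_poly_le r)|apply (jet_poly_le 2)]; auto using jet_poly_qreg.
  - apply poly_mul; [apply (jet_poly_le r)|apply (jet_poly_le 2)]; auto using jet_poly_qreg.
  - exists jet0; split; [apply jet0_in_E|].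
    destruct (E jet0 (conj jet0_in_E jet0_qreg)) as [HN _].
    apply Rmult_neq_0; [exact HN|apply jet0_qreg].
  - intros th HE H; destruct (Hne th H) as [N1 N2].
    destruct (E th (conj HE N2)) as [_ ->]; field; auto.
  - intros th th' HE HE' Ho H _; apply (invariant_orbit n F th th'); auto; apply (Hne th H).
Qed.

(** A common denominator for the coefficients of the three derivations. *)
Definition qfrm (th : jet) : R := W_v th * W_vv th * var_h th.

Lemma invariant_derivation_of X (Pu Px Pv : jet -> R) :
  In X Ns -> jet_poly 2 Pu -> jet_poly 2 Px -> jet_poly 2 Pv ->
  (forall th, W_v th <> 0 -> W_vv th <> 0 -> var_h th <> 0 ->
    X th = (Pu th / qfrm th, Px th / qfrm th, Pv th / qfrm th)) ->
  invariant_derivation X.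
Proof.
  intros HX Hu Hx Hv E.
  assert (Hne : forall th, qfrm th <> 0 -> W_v th <> 0 /\ W_vv th <> 0 /\ var_h th <> 0).
  { unfold qfrm; intros th H; repeat split; intros E0; apply H; rewrite E0; ring. }
  exists 2%nat, Pu, Px, Pv, qfrm; split; [|split; [|split; [|split; [|split; [|split]]]]]; auto.
  - apply poly_mul; [exact jet_poly_qreg|].
    apply (jet_poly_le 0); [lia|exact (jet_poly_crd (ch 0 0 0))].
  - exists jet0; split; [apply jet0_in_E|unfold qfrm, W_v, W_vv, var_h; cbn; lra].
  - intros th HE H; destruct (Hne th H) as (N1 & N2 & N3); auto.
  - intros phi th th' HE HE' Hp H _; destruct (Hne th H) as (N1 & N2 & _).
    destruct (prolonged_kpair phi th th' HE HE' Hp) as (s' & K & Eth & Eth').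
    rewrite Eth in N1, N2; rewrite Eth' at 1; rewrite Eth at 2.
    exact (invariant_nabla phi s' X (base th) K HX N1 N2).
Qed.

Ltac jp :=
  repeat first
    [ apply poly_const | apply poly_add | apply poly_mul
    | apply (jet_poly_le 2 2 W_v (le_n _)), (jet_poly_le 1); [lia|exact (jet_poly_crd (cW 0 0 1))]
    | exact (jet_poly_crd (cW 0 0 2)) | exact (jet_poly_crd (cW 0 1 1))
    | exact (jet_poly_crd (cW 1 0 1)) | exact (jet_poly_crd (cH 0 0 2))
    | exact (jet_poly_crd (cH 0 1 1))
    | apply (jet_poly_le 1 2 h_x); [lia|exact (jet_poly_crd (ch 0 1 0))]
    | apply (jet_poly_le 0 2 var_h); [lia|exact (jet_poly_crd (ch 0 0 0))] ].

Lemma nabla_invariant_derivations :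
  invariant_derivation nabla1 /\ invariant_derivation nabla2 /\ invariant_derivation nabla3.
Proof.
  split; [|split].
  - apply (invariant_derivation_of nabla1 (fun _ => 0) (fun _ => 0)
      (fun th => W_v th * (W_v th * var_h th))); [cbn; auto|jp|jp|jp|].
    intros th N1 N2 N3; unfold nabla1, qfrm; apply point_eq; field; auto.
  - apply (invariant_derivation_of nabla2 (fun _ => 0) (fun th => 2 * (W_vv th * var_h th))
      (fun th => h_x th * W_v th + -2 * (var_h th * W_xv th))); [cbn; auto|jp|jp|jp|].
    intros th N1 N2 N3; unfold nabla2, qfrm; apply point_eq; field; auto.
  - apply (invariant_derivation_of nabla3 (fun th => -1 * (W_vv th * (W_vv th * var_h th)))
      (fun th => H_vv th * (W_vv th * var_h th))
      (fun th => (W_uv th + -1 * H_xv th) * (W_vv th * var_h th))); [cbn; auto|jp|jp|jp|].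
    intros th N1 N2 N3; unfold nabla3, qfrm; apply point_eq; field; auto.
Qed.

(** Where [qreg] does not vanish Delta is a quotient of jet polynomials with non-zero denominator,
    so its zeros there are those of the numerator. *)
Lemma generic_poly : exists r q, jet_poly r q /\ nonzero_on_E q /\
  forall th, in_E th -> (q th <> 0 <-> qreg th <> 0 /\ Delta th <> 0).
Proof.
  destruct (rat_frac qreg Delta (rat_Delta 2 qreg jet_poly_qreg Dom_qreg)) as (r & P & Q & HP & HQ & E).
  assert (Hiff : forall th, in_E th -> (qreg th * P th <> 0 <-> qreg th <> 0 /\ Delta th <> 0)).
  { intros th HE; split.
    - intros H; assert (Nq : qreg th <> 0) by (intros E0; apply H; rewrite E0; ring).
      split; [exact Nq|]; destruct (E th (conj HE Nq)) as [NQ ->].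
      apply Rmult_neq_0; [|apply Rinv_neq_0_compat, NQ].
      intros E0; apply H; rewrite E0; ring.
    - intros [Nq ND]; destruct (E th (conj HE Nq)) as [NQ ED].
      apply Rmult_neq_0; [exact Nq|].
      intros E0; apply ND; rewrite ED, E0; field; exact NQ. }
  exists (Nat.max 2 r), (fun th => qreg th * P th); split; [|split; [|exact Hiff]].
  - apply poly_mul; [apply (jet_poly_le 2)|apply (jet_poly_le r)]; auto using jet_poly_qreg;
      [apply Nat.le_max_l|apply Nat.le_max_r].
  - exists jet0; split; [apply jet0_in_E|]; apply Hiff; [apply jet0_in_E|].
    split; [apply jet0_qreg|apply jet0_Delta].
Qed.

Lemma uniform_bound1 (P : nat -> nat -> Prop) :
  (forall i N M, (N <= M)%nat -> P i N -> P i M) -> (forall i, exists N, P i N) ->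
  forall l, exists N, forall i, (i <= l)%nat -> P i N.
Proof.
  intros Hm Hex; induction l as [|l [N HN]].
  - destruct (Hex O) as [N HN]; exists N; intros i Hi; replace i with O by lia; exact HN.
  - destruct (Hex (S l)) as [M HM]; exists (Nat.max N M); intros i Hi.
    destruct (Nat.eq_dec i (S l)) as [-> | Hne].
    + apply (Hm _ M); [lia|exact HM].
    + apply (Hm _ N); [lia|apply HN; lia].
Qed.

Lemma uniform_bound3 (P : nat -> nat -> nat -> nat -> Prop) :
  (forall i j k N M, (N <= M)%nat -> P i j k N -> P i j k M) ->
  (forall i j k, exists N, P i j k N) ->
  forall l, exists N, forall i j k, (i + j + k <= l)%nat -> P i j k N.
Proof.
  intros Hm Hex l.
  destruct (uniform_bound1 (fun i N => forall j, (j <= l)%nat -> forall k, (k <= l)%nat -> P i j k N))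
    with (l := l) as [N HN].
  - intros i N M HNM H j Hj k Hk; apply (Hm _ _ _ N); auto.
  - intros i; apply (uniform_bound1 (fun j N => forall k, (k <= l)%nat -> P i j k N)).
    + intros j N M HNM H k Hk; apply (Hm _ _ _ N); auto.
    + intros j; apply (uniform_bound1 (fun k N => P i j k N)); auto; intros k N M; apply Hm.
  - exists N; intros i j k H; apply HN; lia.
Qed.

(** * Expressing arbitrary invariants and separating orbits *)

Section Generation.

Variables (rq : nat) (q : jet -> R).
Hypothesis Hq : jet_poly rq q.
Hypothesis Hiff : forall th, in_E th -> (q th <> 0 <-> qreg th <> 0 /\ Delta th <> 0).

Let Hgen : forall th, Dom q th -> W_v th <> 0 /\ W_vv th <> 0 /\ Delta th <> 0.
Proof.
  intros th [HE H]; apply (Hiff th HE) in H; destruct H as [H1 H2].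
  apply qreg_neq0 in H1; tauto.
Qed.

Let Hreg : forall th, Dom q th -> W_v th <> 0 /\ W_vv th <> 0.
Proof. intros th Hth; destruct (Hgen th Hth) as (? & ? & ?); auto. Qed.

Lemma Dom_reg th : Dom q th -> qreg th <> 0.
Proof. intros H; apply qreg_neq0, Hreg, H. Qed.

(** There are finitely many coordinates of order at most l, so one N serves for all of them. It
    depends on l only, as generation requires N to be chosen before the invariant. *)
Lemma kpoly_crd_bound l :
  exists N, (1 <= N)%nat /\ forall c, (ordc c <= l)%nat -> kpoly q N (evalc c).
Proof.
  assert (Hc : forall c, exists N, kpoly q N (evalc c)) by exact (kin_crd rq q Hq Hgen).
  assert (Hb : forall f : nat -> nat -> nat -> crd,
    exists N, forall i j k, (i + j + k <= l)%nat -> kpoly q N (evalc (f i j k))).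
  { intros f; apply (uniform_bound3 (fun i j k N => kpoly q N (evalc (f i j k)))); auto.
    intros i j k N M; apply kpoly_le. }
  destruct (Hc (cB Du)) as [N1 B1], (Hc (cB Dx)) as [N2 B2], (Hc (cB Dv)) as [N3 B3],
    (Hb cH) as [N4 B4], (Hb cW) as [N5 B5], (Hb ch) as [N6 B6].
  exists (1 + N1 + N2 + N3 + N4 + N5 + N6)%nat; split; [lia|].
  intros [[]|i j k|i j k|i j k]; cbn [ordc]; intros Ho;
    [apply (kpoly_le q N1)|apply (kpoly_le q N2)|apply (kpoly_le q N3)|apply (kpoly_le q N4)
    |apply (kpoly_le q N5)|apply (kpoly_le q N6)]; auto; lia.
Qed.

Lemma kpoly_jet_poly N l F :
  (forall c, (ordc c <= l)%nat -> kpoly q N (evalc c)) -> jet_poly l F -> kpoly q N F.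
Proof.
  intros Hc; revert F; apply jet_poly_ind; auto.
  - intros c; exists (fun _ => c); split; [apply poly_const|reflexivity].
  - intros F G _ _ (F' & HF & EF) (G' & HG & EG); exists (fun th => F' th + G' th).
    split; [apply poly_add; assumption|]; intros th Hth; rewrite EF, EG; auto.
  - intros F G _ _ (F' & HF & EF) (G' & HG & EG); exists (fun th => F' th * G' th).
    split; [apply poly_mul; assumption|]; intros th Hth; rewrite EF, EG; auto.
Qed.

Definition invs (N : nat) (G : jet -> R) : Prop := exists n, (n <= N)%nat /\ iterated Is Ns n G.

Definition same_Z (th th0 : jet) : Prop := forall c, isZ c -> evalc c th = evalc c th0.

Definition same_inv (th th' : jet) : Prop := forall n F, iterated Is Ns n F -> F th = F th'.

(* The only denominator left once the coordinates in Z are frozen. *)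
Definition den (th : jet) : R := I1 th * Delta th.

Lemma Delta_poly N : (1 <= N)%nat -> poly_in (invs N) Delta.
Proof.
  intros HN.
  assert (Hi : forall F, iterated Is Ns 1 F -> poly_in (invs N) F)
    by (intros F HF; apply poly_gen; exists 1%nat; auto).
  assert (Hmin : forall F G, poly_in (invs N) F -> poly_in (invs N) G ->
    poly_in (invs N) (fun th => F th - G th)).
  { intros F G HF HG.
    replace (fun th => F th - G th) with (fun th => F th + -1 * G th)
      by (apply functional_extensionality; intros; ring).
    apply poly_add; [exact HF|]; apply poly_mul; [apply poly_const|exact HG]. }
  unfold Delta, det3.
  repeat first
    [ apply Hi; first [apply iter_1 | apply iter_2 | apply iter_3];
        first [exact iter_I1 | exact iter_J1 | exact iter_J2]
    | apply Hmin | apply poly_add | apply poly_mul ].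
Qed.

Lemma den_poly N : (1 <= N)%nat -> poly_in (invs N) den.
Proof.
  intros HN; apply poly_mul; [|apply Delta_poly, HN].
  apply poly_gen; exists O; split; [lia|apply iter_I1].
Qed.

Lemma pow_poly S (F : jet -> R) m : poly_in S F -> poly_in S (fun th => F th ^ m).
Proof.
  intros H; induction m as [|m IH]; cbn; [apply poly_const|].
  apply (poly_mul S F (fun th => F th ^ m)); assumption.
Qed.

Lemma same_inv_den th th1 : same_inv th1 th -> I1 th1 = I1 th /\ Delta th1 = Delta th.
Proof.
  intros H; split; [exact (H _ _ iter_I1)|]; unfold Delta.
  rewrite (H _ _ (iter_1 _ _ iter_I1)), (H _ _ (iter_2 _ _ iter_I1)), (H _ _ (iter_3 _ _ iter_I1)),
    (H _ _ (iter_1 _ _ iter_J1)), (H _ _ (iter_2 _ _ iter_J1)), (H _ _ (iter_3 _ _ iter_J1)),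
    (H _ _ (iter_1 _ _ iter_J2)), (H _ _ (iter_2 _ _ iter_J2)), (H _ _ (iter_3 _ _ iter_J2)).
  reflexivity.
Qed.

Lemma den_neq0 th : Dom q th -> den th <> 0.
Proof.
  intros Hth; apply Rmult_neq_0; [|apply Hgen, Hth].
  apply (I1_neq0 q Hgen th Hth).
Qed.

(** Here th1 is to be the representative of the orbit of th with the Z-coordinates of th0. At th1
    the generators in Z are constants and the others are invariants of th or their inverses, so G is
    a polynomial in invariants over a power of [den]. *)
Lemma specialise_gen th0 N G : (1 <= N)%nat -> Dom q th0 -> poly_in (kgen N) G ->
  exists m G0, poly_in (invs N) G0 /\ forall th th1, Dom q th -> Dom q th1 ->
    same_Z th1 th0 -> same_inv th1 th -> G th1 * den th ^ m = G0 th.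
Proof.
  intros HN H0 HG.
  induction HG as [c|G HG|F G _ (m1 & F0 & PF & EF) _ (m2 & G0 & PG & EG)
    |F G _ (m1 & F0 & PF & EF) _ (m2 & G0 & PG & EG)].
  - exists O, (fun _ => c); split; [apply poly_const|]; intros; cbn; ring.
  - destruct HG as [c Hc|n G Hn HG| | | |].
    + exists O, (fun _ => evalc c th0); split; [apply poly_const|]; intros th th1 _ _ HZ _.
      rewrite (HZ c Hc); cbn; ring.
    + exists O, G; split; [apply poly_gen; exists n; auto|]; intros th th1 _ _ _ HI.
      rewrite (HI n G HG); cbn; ring.
    + exists O, (fun _ => / W_v th0); split; [apply poly_const|]; intros th th1 _ _ HZ _.
      assert (E : W_v th1 = W_v th0) by exact (HZ (cW 0 0 1) I); rewrite E; cbn; ring.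
    + exists O, (fun _ => / W_vv th0); split; [apply poly_const|]; intros th th1 _ _ HZ _.
      assert (E : W_vv th1 = W_vv th0) by exact (HZ (cW 0 0 2) I); rewrite E; cbn; ring.
    (* The inverse of I1 is Delta / [den], and symmetrically for the inverse of Delta below. *)
    + exists 1%nat, Delta; split; [apply Delta_poly, HN|]; intros th th1 Hth _ _ HI.
      destruct (same_inv_den th th1 HI) as [-> _].
      assert (N1 := I1_neq0 q Hgen th Hth); unfold den; field; exact N1.
    + exists 1%nat, I1; split; [apply poly_gen; exists O; split; [lia|apply iter_I1]|].
      intros th th1 Hth _ _ HI; destruct (same_inv_den th th1 HI) as [_ ->].
      destruct (Hgen th Hth) as (_ & _ & N1); unfold den; field; exact N1.
  - exists (m1 + m2)%nat, (fun th => F0 th * den th ^ m2 + G0 th * den th ^ m1); split.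
    + apply poly_add; apply poly_mul; auto; apply pow_poly, den_poly, HN.
    + intros th th1 A1 A2 A3 A4; rewrite <- (EF th th1), <- (EG th th1), pow_add by assumption; ring.
  - exists (m1 + m2)%nat, (fun th => F0 th * G0 th); split; [apply poly_mul; assumption|].
    intros th th1 A1 A2 A3 A4; rewrite <- (EF th th1), <- (EG th th1), pow_add by assumption; ring.
Qed.

Lemma specialise th0 N l F : (1 <= N)%nat -> (forall c, (ordc c <= l)%nat -> kpoly q N (evalc c)) ->
  Dom q th0 -> jet_poly l F ->
  exists m F0, poly_in (invs N) F0 /\ forall th th1, Dom q th -> Dom q th1 ->
    same_Z th1 th0 -> same_inv th1 th -> F th1 * den th ^ m = F0 th.
Proof.
  intros HN Hc H0 HF; destruct (kpoly_jet_poly N l F Hc HF) as (G & HG & E).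
  destruct (specialise_gen th0 N G HN H0 HG) as (m & G0 & PG & EG).
  exists m, G0; split; [exact PG|]; intros th th1 A1 A2 A3 A4.
  rewrite (E th1 A2); apply EG; assumption.
Qed.

Lemma reach_generic th th0 : Dom q th -> Dom q th0 ->
  exists th1, same_orbit th1 th /\ Dom q th1 /\ same_Z th1 th0 /\ same_inv th1 th.
Proof.
  intros Hth H0.
  destruct (reach th th0 (proj1 Hth) (Dom_reg th Hth) (Dom_reg th0 H0)) as (th1 & Ho & HE & HZ).
  assert (Hr : qreg th1 <> 0).
  { unfold qreg; replace (W_v th1) with (W_v th0) by (symmetry; exact (HZ (cW 0 0 1) I)).
    replace (W_vv th1) with (W_vv th0) by (symmetry; exact (HZ (cW 0 0 2) I)).
    apply (Dom_reg th0 H0). }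
  assert (HI : same_inv th1 th)
    by (intros n F HF; apply (invariant_orbit n F); auto; apply Hth).
  exists th1; split; [exact Ho|split; [|split; assumption]]; split; [exact HE|].
  apply (Hiff th1 HE); split; [exact Hr|]; destruct (same_inv_den th th1 HI) as [_ ->].
  apply (Hgen th Hth).
Qed.

Lemma rat_invs N F : poly_in (invs N) F -> rat q F.
Proof.
  induction 1 as [c|F (n & _ & HF)|F G _ IH1 _ IH2|F G _ IH1 _ IH2];
    [apply rat_const|apply (rat_iterated rq q Hq Hreg n F HF)|apply rat_plus|apply rat_mult]; assumption.
Qed.

(** An invariant F = P / Q is evaluated at the normalised representative of the orbit, where P and Q
    become P0 / [den]^a and Q0 / [den]^b. The bound N comes from Q, of order at most l; the order r
    of P varies with F and affects the numerator only. *)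
Lemma generation l : nonzero_on_E q -> exists N, forall F, diff_invariant l F ->
  exists P Q : jet -> R,
    poly_in (fun G => exists n, iterated Is Ns n G) P /\
    poly_in (fun G => exists n, (n <= N)%nat /\ iterated Is Ns n G) Q /\
    exists (r : nat) (q : jet -> R), jet_poly r q /\ nonzero_on_E q /\
      forall th, in_E th -> q th <> 0 -> Q th <> 0 /\ F th = P th / Q th.
Proof.
  intros Hnz; destruct (kpoly_crd_bound l) as (N & HN & HcN); exists N.
  intros F (r & P & Q & HP & HQ & NQ & EF & Inv).
  destruct (kpoly_crd_bound r) as (M & HM & HcM).
  destruct (nonzero_on_E_mul rq q l Q Hq HQ Hnz NQ) as (th0 & E0 & N0 & NQ0).
  assert (D0 : Dom q th0) by (split; assumption).
  destruct (specialise th0 M r P HM HcM D0 HP) as (a & P0 & PP0 & EP).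
  destruct (specialise th0 N l Q HN HcN D0 HQ) as (b & Q0 & PQ0 & EQ).
  exists (fun th => P0 th * den th ^ b), (fun th => Q0 th * den th ^ a).
  split; [|split].
  - apply poly_mul; [|apply pow_poly];
      (eapply poly_in_mono; [|first [exact PP0 | exact (den_poly 1 (le_n _))]]);
      intros G (n & _ & HG); exists n; exact HG.
  - apply poly_mul; [exact PQ0|]; apply pow_poly, den_poly, HN.
  - destruct (rat_frac q Q0 (rat_invs N Q0 PQ0)) as (r2 & P2 & Q2 & HP2 & HQ2 & E2).
    exists (rq + l + r2)%nat, (fun th => q th * Q th * P2 th); split; [|split].
    + apply poly_mul; [apply poly_mul|]; (eapply jet_poly_le; [|eassumption]); lia.
    + exists th0; split; [exact E0|].
      assert (H1 : Q0 th0 <> 0).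
      { rewrite <- (EQ th0 th0 D0 D0) by (intros ? ?; reflexivity || (intros; reflexivity)).
        apply Rmult_neq_0; [exact NQ0|apply pow_nonzero, den_neq0, D0]. }
      destruct (E2 th0 D0) as [NQ2 EQ2].
      repeat apply Rmult_neq_0; auto.
      intros E; apply H1; rewrite EQ2, E; field; exact NQ2.
    + intros th HE H.
      assert (N1 : q th <> 0) by (intros E; apply H; rewrite E; ring).
      assert (N2 : Q th <> 0) by (intros E; apply H; rewrite E; ring).
      assert (N3 : P2 th <> 0) by (intros E; apply H; rewrite E; ring).
      assert (Dth : Dom q th) by (split; assumption).
      assert (N4 : Q0 th <> 0).
      { destruct (E2 th Dth) as [NQ2 ->]; apply Rmult_neq_0;
          [exact N3|apply Rinv_neq_0_compat, NQ2]. }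
      destruct (reach_generic th th0 Dth D0) as (th1 & Ho & D1 & HZ & HI).
      assert (Nd := den_neq0 th Dth).
      assert (EQ1 := EQ th th1 Dth D1 HZ HI); assert (EP1 := EP th th1 Dth D1 HZ HI).
      assert (N5 : Q th1 <> 0) by (intros E; apply N4; rewrite <- EQ1, E; ring).
      assert (Na := pow_nonzero _ a Nd); assert (Nb := pow_nonzero _ b Nd).
      split; [apply Rmult_neq_0; assumption|].
      rewrite <- (Inv th1 th (proj1 D1) HE Ho N5 N2), (EF th1 (proj1 D1) N5), <- EQ1, <- EP1.
      field; auto.
Qed.

(** Move th' to the Z-coordinates of th. The jet reached shares with th all generators of the ring,
    hence all coordinates by [kin_crd], and so is th itself. *)
Lemma separation th th' : Dom q th -> Dom q th' -> same_inv th th' -> same_orbit th th'.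
Proof.
  intros Hth Hth' HI.
  destruct (reach_generic th' th Hth' Hth) as (th1 & Ho & D1 & HZ & HI1).
  enough (E : th1 = th) by (rewrite E in Ho; exact Ho).
  assert (HI2 : same_inv th1 th).
  { intros n F HF; rewrite (HI1 n F HF); symmetry; apply (HI n F HF). }
  apply jet_ext; intros c; destruct (kin_crd rq q Hq Hgen c) as (N & G & HG & E).
  rewrite (E th1 D1), (E th Hth); clear E; induction HG as [a|G HG|F G _ IH1 _ IH2|F G _ IH1 _ IH2];
    [reflexivity| |rewrite IH1, IH2; reflexivity|rewrite IH1, IH2; reflexivity].
  destruct (same_inv_den th th1 HI2) as [EI ED].
  destruct HG as [c' Hc|n G _ HG| | | |].
  - apply HZ, Hc.
  - apply (HI2 n G HG).
  - f_equal; exact (HZ (cW 0 0 1) I).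
  - f_equal; exact (HZ (cW 0 0 2) I).
  - f_equal; exact EI.
  - f_equal; exact ED.
Qed.

End Generation.

Theorem theorem12 :
  (in_A I1 /\ in_A J1 /\ in_A J2) /\
  (invariant_derivation nabla1 /\
   invariant_derivation nabla2 /\
   invariant_derivation nabla3) /\
  lie_tresse_generated (I1 :: J1 :: J2 :: nil) (nabla1 :: nabla2 :: nabla3 :: nil).
Proof.
  split; [|split; [exact nabla_invariant_derivations|]].
  - repeat split; eapply in_A_iterated; [exact iter_I1|exact iter_J1|exact iter_J2].
  - destruct generic_poly as (rq & q & Hq & Hnz & Hiff); split; [exact in_A_iterated|split].
    + intros l; exact (generation rq q Hq Hiff l Hnz).
    + exists rq, q; split; [exact Hq|split; [exact Hnz|]].
      intros th th' HE HE' N N' HI; apply (separation rq q Hq Hiff); [split|split|]; assumption.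
Qed.
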